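(* Let $d,r\in\mathbb{N}$ and let $\sigma\in C^r(\mathbb{R})$ be $r$-finite. Let $U=U_p\times U_q\subseteq\mathbb{R}^{2d}$ be open, $K\in C^{r+1}(U_p)$, $V\in C^{r+1}(U_q)$, $H(p,q)=K(p)+V(q)$, and let $\Phi:[0,\infty)\times U\to\mathbb{R}^{2d}$ be the phase flow of $\dot x=J^{-1}\nabla H(x)$, assumed to exist for all times and to map into $U$. Then for every $T>0$, every compact $W\subseteq U$ and every $\epsilon>0$ there is a TLA-SympNet $\psi$ with $\|\Phi-\psi\|_{C^r([0,T]\times W;\mathbb{R}^{2d})}<\epsilon$.
   Context: $J=\begin{pmatrix}0&I_d\\-I_d&0\end{pmatrix}$. $\sigma$ is $r$-finite if $0<\int_\mathbb{R}|\sigma^{(r)}(x)|\,dx<\infty$; applied componentwise. Linear modules: for $k\in\mathbb{N}$ and symmetric $S_1,\dots,S_k\in\mathbb{R}^{d\times d}$, $\mathcal{L}(p,q)=M_k\cdots M_2M_1\binom{p}{q}$ where $M_j=\begin{pmatrix}I&S_j\\0&I\end{pmatrix}$ for odd $j$ and $M_j=\begin{pmatrix}I&0\\S_j&I\end{pmatrix}$ for even $j$ (no time input, no bias). Activation modules: for $a,b\in\mathbb{R}^d$, $\tilde\sigma_{a,b}(y)=\operatorname{diag}(a)\sigma(y+b)$; $\mathcal{N}^{up}(h,(p,q))=(p+h\tilde\sigma_{a,b}(q),q)$, $\mathcal{N}^{low}(h,(p,q))=(p,q+h\tilde\sigma_{a,b}(p))$. A TLA-SympNet is any map $\psi(h,x)=(v_k^{-1}\circ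 w_k(h,\cdot)\circ v_k\circ\dots\circ v_1^{-1}\circ w_1(h,\cdot)\circ v_1)(x)$ with $k\in\mathbb{N}$, $v_j$ linear modules and $w_j$ activation modules. The $C^r([0,T]\times W)$ norm is $\sum_{|\alpha|\le r}\max_i\sup|D^\alpha F^{(i)}|$ with derivatives in both $h$ and $x$. *)

(* Defs.v *)
From HB Require Import structures.
From mathcomp Require Import all_boot all_order all_algebra.
From mathcomp Require Import all_classical all_reals all_analysis.
Set Implicit Arguments. Unset Strict Implicit. Unset Printing Implicit Defensive.
Import Order.TTheory GRing.Theory Num.Theory numFieldNormedType.Exports.
Local Open Scope classical_set_scope.
Local Open Scope ring_scope.

Section TLA.
Variable R : realType.

Definition ej (n : nat) (j : 'I_n) : 'rV[R]_n := delta_mx 0 j.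

(* difference quotient filter for the partial derivative of G in direction
   e_j at x, relative to the domain S (points x + t e_j outside S are
   excluded; for an open S this is the usual two-sided partial derivative) *)
Definition pdx_quot (n : nat) (S : set 'rV[R]_n) (j : 'I_n)
    (G : 'rV[R]_n -> R) (x : 'rV[R]_n) : set_system R :=
  (fun t : R => t^-1 * (G (x + t *: ej j) - G x))
    @ within [set t : R | t != 0 /\ S (x + t *: ej j)] (nbhs (0 : R)).

Definition pdx (n : nat) (S : set 'rV[R]_n) (j : 'I_n)
    (G : 'rV[R]_n -> R) (x : 'rV[R]_n) : R := lim (pdx_quot S j G x).

Definition grad (n : nat) (S : set 'rV[R]_n) (G : 'rV[R]_n -> R)
    (x : 'rV[R]_n) : 'rV[R]_n := \row_(j < n) pdx S j G x.

Fixpoint Ck (n : nat) (O : set 'rV[R]_n) (k : nat) (G : 'rV[R]_n -> R) : Prop :=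
  (forall x, O x -> {for x, continuous G}) /\
  match k with
  | 0 => True
  | k'.+1 => forall j : 'I_n,
      (forall x, O x -> exists l : R, pdx_quot O j G x --> l) /\
      Ck O k' (pdx O j G)
  end.

Fixpoint Ck_real (k : nat) (f : R -> R) : Prop :=
  continuous f /\
  match k with
  | 0 => True
  | k'.+1 => (forall x, derivable f x 1) /\ Ck_real k' (@derive1 R R f)
  end.

Definition r_finite (r : nat) (sigma : R -> R) : Prop :=
  (0 < \int[@lebesgue_measure R]_x (`| iter r (@derive1 R R) sigma x |)%:E < +oo)%E.

(* direction None = time h, Some k = k-th space coordinate *)
Definition shift (n : nat) (j : option 'I_n) (t : R) (y : R * 'rV[R]_n)
    : R * 'rV[R]_n :=
  match j with
  | None => (y.1 + t, y.2)
  | Some k => (y.1, y.2 + t *: ej k)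
  end.

Definition pd (n : nat) (S : set (R * 'rV[R]_n)) (j : option 'I_n)
    (G : R * 'rV[R]_n -> R) (y : R * 'rV[R]_n) : R :=
  lim ((fun t : R => t^-1 * (G (shift j t y) - G y))
         @ within [set t : R | t != 0 /\ S (shift j t y)] (nbhs (0 : R))).

Definition Dalpha (n r : nat) (S : set (R * 'rV[R]_n))
    (alpha : {ffun option 'I_n -> 'I_r.+1}) (G : R * 'rV[R]_n -> R)
    : R * 'rV[R]_n -> R :=
  foldr (fun j g => iter (alpha j) (pd S j) g) G (enum {: option 'I_n}).

(* The C^r([0,T] x W; R^m) norm of F, a map defined on the domain S
   (derivatives are taken in S = dom F and evaluated on [0,T] x W):
     sum_{|alpha| <= r} max_i sup_{[0,T] x W} |D^alpha F^(i)| *)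
Definition CrNorm (n m r : nat) (S : set (R * 'rV[R]_n)) (T : R)
    (W : set 'rV[R]_n) (F : R -> 'rV[R]_n -> 'rV[R]_m) : R :=
  \sum_(alpha : {ffun option 'I_n -> 'I_r.+1} |
          (\sum_(j : option 'I_n) (alpha j : nat) <= r)%N)
    \big[Num.max/0]_(i < m)
       sup [set `| Dalpha S alpha (fun y => F y.1 y.2 0 i) y |
            | y in [set y : R * 'rV[R]_n | 0 <= y.1 <= T /\ W y.2]].

Definition Jmx (d : nat) : 'M[R]_(d + d) := block_mx 0 1%:M (- 1%:M) 0.

Definition prodU (d : nat) (Up Uq : set 'rV[R]_d) : set 'rV[R]_(d + d) :=
  [set x | Up (lsubmx x) /\ Uq (rsubmx x)].

Definition Ham (d : nat) (K V : 'rV[R]_d -> R) (x : 'rV[R]_(d + d)) : R :=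
  K (lsubmx x) + V (rsubmx x).

Definition ham_field (d : nat) (U : set 'rV[R]_(d + d)) (H : 'rV[R]_(d + d) -> R)
    (x : 'rV[R]_(d + d)) : 'rV[R]_(d + d) :=
  (invmx (Jmx d) *m (grad U H x)^T)^T.

Definition solves_on_nonneg (m : nat) (f : 'rV[R]_m -> 'rV[R]_m)
    (gamma : R -> 'rV[R]_m) : Prop :=
  forall h : R, 0 <= h ->
    (fun t : R => t^-1 *: (gamma (h + t) - gamma h))
      @ within [set t : R | t != 0 /\ 0 <= h + t] (nbhs (0 : R))
    --> f (gamma h).

Definition phase_flow (m : nat) (U : set 'rV[R]_m) (f : 'rV[R]_m -> 'rV[R]_m)
    (Phi : R -> 'rV[R]_m -> 'rV[R]_m) : Prop :=
  forall x, U x ->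
    [/\ Phi 0 x = x,
        (forall h, 0 <= h -> U (Phi h x)),
        solves_on_nonneg f (fun h => Phi h x) &
        (forall gamma : R -> 'rV[R]_m, gamma 0 = x ->
           (forall h, 0 <= h -> U (gamma h)) -> solves_on_nonneg f gamma ->
           forall h, 0 <= h -> gamma h = Phi h x)].

(* M_j, with j counted from 1: upper for odd j, lower for even j
   (acting on x = (p, q) written as a row vector) *)
Definition Mmod (d : nat) (j : nat) (S : 'M[R]_d) (x : 'rV[R]_(d + d))
    : 'rV[R]_(d + d) :=
  let p := lsubmx x in let q := rsubmx x in
  if odd j then row_mx (p + (S *m q^T)^T) q
  else row_mx p ((S *m p^T)^T + q).

Fixpoint lin_go (d : nat) (j : nat) (Ss : seq 'M[R]_d) (x : 'rV[R]_(d + d))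
    : 'rV[R]_(d + d) :=
  match Ss with
  | [::] => x
  | Sm :: Ss' => lin_go j.+1 Ss' (Mmod j Sm x)
  end.

Definition lin_module (d : nat) (Ss : seq 'M[R]_d) (x : 'rV[R]_(d + d))
    : 'rV[R]_(d + d) := lin_go 1 Ss x.

Definition valid_lin (d : nat) (Ss : seq 'M[R]_d) : Prop :=
  (0 < size Ss)%N /\ (forall S, S \in Ss -> S^T = S).

(* inverse of a linear module: L^{-1} = M_1^{-1} ... M_k^{-1},
   where M_j^{-1} is M_j with S_j replaced by -S_j *)
Fixpoint lin_inv_go (d : nat) (j : nat) (Ss : seq 'M[R]_d) (x : 'rV[R]_(d + d))
    : 'rV[R]_(d + d) :=
  match Ss with
  | [::] => x
  | Sm :: Ss' => Mmod j (- Sm) (lin_inv_go j.+1 Ss' x)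
  end.

Definition lin_module_inv (d : nat) (Ss : seq 'M[R]_d) (x : 'rV[R]_(d + d))
    : 'rV[R]_(d + d) := lin_inv_go 1 Ss x.

Definition sigma_ab (d : nat) (sigma : R -> R) (a b : 'rV[R]_d) (y : 'rV[R]_d)
    : 'rV[R]_d := \row_(i < d) (a 0 i * sigma (y 0 i + b 0 i)).

Definition act_module (d : nat) (sigma : R -> R) (up : bool) (a b : 'rV[R]_d)
    (h : R) (x : 'rV[R]_(d + d)) : 'rV[R]_(d + d) :=
  let p := lsubmx x in let q := rsubmx x in
  if up then row_mx (p + h *: sigma_ab sigma a b q) q
  else row_mx p (q + h *: sigma_ab sigma a b p).

(* one block  v^{-1} o w(h, .) o v : (S_1..S_k of v, up/low, a, b) *)
Definition tla_layer (d : nat) := (seq 'M[R]_d * bool * 'rV[R]_d * 'rV[R]_d)%type.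

Definition layer_apply (d : nat) (sigma : R -> R) (l : tla_layer d) (h : R)
    (x : 'rV[R]_(d + d)) : 'rV[R]_(d + d) :=
  let: (Ss, up, a, b) := l in
  lin_module_inv Ss (act_module sigma up a b h (lin_module Ss x)).

Definition tla_net (d : nat) (sigma : R -> R) (ls : seq (tla_layer d)) (h : R)
    (x : 'rV[R]_(d + d)) : 'rV[R]_(d + d) :=
  foldl (fun y l => layer_apply sigma l h y) x ls.

Definition valid_tla (d : nat) (ls : seq (tla_layer d)) : Prop :=
  (0 < size ls)%N /\ (forall l, l \in ls -> valid_lin l.1.1.1).

End TLA.

(* Main.v *)
Require Import Defs.
From HB Require Import structures.
From mathcomp Require Import all_boot all_order all_algebra.
From mathcomp Require Import all_classical all_reals all_analysis.
From mathcomp Require Import ring lra.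
Set Implicit Arguments. Unset Strict Implicit. Unset Printing Implicit Defensive.
Import Order.TTheory GRing.Theory Num.Theory numFieldNormedType.Exports.
Local Open Scope classical_set_scope.
Local Open Scope ring_scope.

(* With the time h frozen as a parameter, Phi(h, x) is the time-one flow of the
   field (h, x) |-> (0, h J^{-1} grad H(x)), and a step of size h/n of the
   symplectic Euler scheme is an explicit Euler step along a perturbation of this
   field. Derivatives of an Euler step are Euler steps of the tangent field, so
   convergence of schemes in C^r follows by induction on r from plain convergence;
   the latter holds by compactness, limits of Euler polygons being solutions, and
   uniqueness of solutions.

   Linear modules conjugate an activation of one coordinate into the shear
   p += h a sigma(w.q + b) w, so symplectic Euler steps are TLA-SympNets as soon as
   grad K and grad V are sums of ridge fields a sigma(w.x + b) w. It remains to
   approximate K and V in C^{r+1} by sums of ridge functions of an antiderivative A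
   of sigma. Since sigma^(r) is nonzero and integrable, no iterated difference of A
   vanishes identically, so rescaled Taylor expansions of these differences yield
   all univariate monomials, hence all products of affine forms by polarization.
   Bernstein polynomials then approximate K and V in C^{r+1}. *)

(** * Locally uniform convergence with derivatives *)

(** For r = 0 the Hamiltonian field is merely continuous and no Lipschitz constant controls the
    error of a scheme. Uniqueness comes from the hypothesis on the phase flow alone, and concerns
    solutions on the whole half-line that stay in [U]; hence ultralimits and a first-exit argument.
    Lipschitz bounds appear only in the fibres of tangent fields.

    Differentiability is asked of the approximants; derivatives of the flow come out as limits.
    Convergence is relative to a set because the flow has one-sided time derivatives at h = 0 and
    the fields converge only inside [U].

    A, with A' = sigma, has r + 1 derivatives, whereas extracting t^p in C^(r+1) takes r + 1 + p.
    Differencing a p-fold antiderivative of A p times smooths A while staying in the closed span;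
    hence the iterated differences. K and V are set to zero outside a compact neighbourhood:
    exponentially small Bernstein weights make the jump harmless, derivatives included. *)

Section ContinuousConvergence.
Variable R : realType.
Implicit Types V W X : normedModType R.

Definition evt V (y : V) (P : nat -> V -> Prop) : Prop :=
  \forall z \near filter_prod \oo (nbhs y), P z.1 z.2.

Lemma evtP V (y : V) P : evt y P <->
  exists N : nat, exists2 e : R, 0 < e &
    forall n y', (N <= n)%N -> `|y' - y| < e -> P n y'.
Proof.
split=> [[[A B] /= [[N _ NA] /nbhs_ballP[e /= e0 eB]] AB]|[N [e e0 H]]].
  exists N, e => // n y' Nn y'e; apply: (AB (n, y')); split => /=.
    exact: NA.
  by apply: eB; rewrite -ball_normE /= distrC.
exists ([set n | (N <= n)%N], ball y e); first split => /=.
- by exists N.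
- exact: nbhsx_ballx.
by move=> [n y'] /= []; rewrite -ball_normE /= distrC => *; apply: H.
Qed.

Lemma evtS V (y : V) (P Q : nat -> V -> Prop) :
  (forall n z, P n z -> Q n z) -> evt y P -> evt y Q.
Proof. by move=> PQ; apply: filterS => z; exact: PQ. Qed.

Lemma evtS2 V (y : V) (P1 P2 Q : nat -> V -> Prop) :
  (forall n z, P1 n z -> P2 n z -> Q n z) -> evt y P1 -> evt y P2 -> evt y Q.
Proof. by move=> PQ; apply: filterS2 => z; exact: PQ. Qed.

Lemma evtI V (y : V) (P Q : nat -> V -> Prop) :
  evt y P -> evt y Q -> evt y (fun n z => P n z /\ Q n z).
Proof. by apply: evtS2. Qed.

Lemma evt_ge V (y : V) N : evt y (fun n _ => (N <= n)%N).
Proof. by apply/evtP; exists N, 1. Qed.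

Lemma evt_near V (y : V) (e : R) : 0 < e -> evt y (fun _ z => `|z - y| < e).
Proof. by move=> e0; apply/evtP; exists 0%N, e. Qed.

(* [G n y'] tends to [F y] jointly as [n] tends to infinity and [y'] to [y]
   inside [D]; this amounts to locally uniform convergence to a continuous limit. *)
Definition ccvg V W (D : set V) (G : nat -> V -> W) (F : V -> W) : Prop :=
  forall y, D y -> forall e : R, 0 < e ->
    evt y (fun n y' => D y' -> `|G n y' - F y| < e).

(* Joint convergence of the maps and of their first [r] derivatives, phrased
   through the tangent map [(y, v) |-> (G y, dG y v)]. *)
Fixpoint Ccvg r V W (D : set V) (G : nat -> V -> W) (F : V -> W) : Prop :=
  if r is r'.+1 then
    exists (dG : nat -> V -> V -> W) (dF : V -> V -> W),
      (forall n y, is_diff y (G n) (dG n y)) /\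
      @Ccvg r' (V * V)%type (W * W)%type (D `*` setT)
        (fun n z => (G n z.1, dG n z.1 z.2)) (fun z => (F z.1, dF z.1 z.2))
  else ccvg D G F.

Lemma Ccvg_ext r V W (D : set V) (G G' : nat -> V -> W) (F F' : V -> W) :
  (forall n y, G n y = G' n y) -> (forall y, D y -> F y = F' y) ->
  Ccvg r D G F -> Ccvg r D G' F'.
Proof.
elim: r V W D G G' F F' => [|r IH] V W D G G' F F' GG' FF' /=.
  by move=> H y Dy e e0; rewrite -FF'//; apply: evtS (H y Dy e e0) => n z; rewrite GG'.
move=> [dG [dF [dGP CC]]]; exists dG, dF; split.
  by move=> n y; rewrite (_ : G' n = G n)//; apply/funext => z; rewrite GG'.
by apply: IH CC => [n z|z [/= D1 _]]; rewrite ?GG' ?FF'.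
Qed.

Lemma ccvg_fst V W X (D : set V) (G : nat -> V -> W * X) F : ccvg D G F ->
  ccvg D (fun n y => (G n y).1) (fun y => (F y).1).
Proof.
move=> H y Dy e e0; apply: evtS (H y Dy e e0) => n z h Dz; apply: le_lt_trans (h Dz).
by rewrite prod_normE le_max lexx.
Qed.

Lemma ccvg_snd V W X (D : set V) (G : nat -> V -> W * X) F : ccvg D G F ->
  ccvg D (fun n y => (G n y).2) (fun y => (F y).2).
Proof.
move=> H y Dy e e0; apply: evtS (H y Dy e e0) => n z h Dz; apply: le_lt_trans (h Dz).
by rewrite prod_normE le_max lexx orbT.
Qed.

Lemma ccvg_comp V W X (D : set V) (D' : set W) (G : nat -> W -> X) F
    (B : nat -> V -> W) C :
  (forall y, D y -> D' (C y) /\ evt y (fun n y' => D y' -> D' (B n y'))) ->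
  ccvg D' G F -> ccvg D B C -> ccvg D (fun n y => G n (B n y)) (fun y => F (C y)).
Proof.
move=> H GF BC y Dy e e0; have [Cy BD] := H _ Dy.
have /evtP[N [d d0 K]] := GF _ Cy _ e0.
apply: evtS2 (evt_ge y N) (evtI BD (BC _ Dy _ d0)) => n z Nn [D'B Bz] Dz.
by apply: K => //; [exact: Bz | exact: D'B].
Qed.

(** The base component of the tangent convergence, read along the zero section v = 0. *)
Lemma Ccvg_ccvg r V W (D : set V) (G : nat -> V -> W) F : Ccvg r D G F -> ccvg D G F.
Proof.
elim: r V W D G F => [//|r IH] V W D G F [dG [dF [_ /IH /ccvg_fst H]]].
move=> y Dy e e0; have /evtP[N [d d0 K]] := H (y, 0) (conj Dy I) e e0.
apply/evtP; exists N, d => // n z Nn zd Dz; apply: (K n (z, 0)) => //=.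
by rewrite prod_normE /= subr0 normr0 gt_max zd.
Qed.

(** The tangent of a composition is the composition of the tangents, so induction on the order
    carries the chain rule. [B n] may leave [D'] for small [n]; hence the eventual inclusion near
    each point. *)
Lemma Ccvg_comp r V W X (D : set V) (D' : set W) (G : nat -> W -> X) F
    (B : nat -> V -> W) C :
  (forall y, D y -> D' (C y) /\ evt y (fun n y' => D y' -> D' (B n y'))) ->
  Ccvg r D' G F -> Ccvg r D B C ->
  Ccvg r D (fun n y => G n (B n y)) (fun y => F (C y)).
Proof.
elim: r V W X D D' G F B C => [|r IH] V W X D D' G F B C H; first exact: ccvg_comp.
move=> [dG [dF [dGP CG]]] [dB [dC [dBP CB]]].
exists (fun n y v => dG n (B n y) (dB n y v)), (fun y v => dF (C y) (dC y v)); split.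
  by move=> n y; exact: (@is_diff_comp _ _ _ _ (B n) (dB n y) (G n) (dG n (B n y)) y).
apply: IH CG CB => -[y v] [/= Dy _]; have [Cy BD] := H _ Dy; split=> //.
have /evtP[N [d d0 K]] := BD.
apply/evtP; exists N, d => // n [z w] Nn; rewrite prod_normE gt_max /= => /andP[zd _] [/= Dz _].
by split => //; exact: K.
Qed.

Lemma Ccvg_comp_open r V W X (D : set V) (D' : set W) (G : nat -> W -> X) F
    (B : nat -> V -> W) C :
  open D' -> (forall y, D y -> D' (C y)) ->
  Ccvg r D' G F -> Ccvg r D B C ->
  Ccvg r D (fun n y => G n (B n y)) (fun y => F (C y)).
Proof.
move=> oD' CD GF BC; apply: Ccvg_comp GF (BC) => y Dy; split; first exact: CD.
have := open_nbhs_nbhs (conj oD' (CD _ Dy)) => /nbhs_ballP[e /= e0 eD].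
apply: evtS (Ccvg_ccvg BC Dy e0) => n z h Dz; apply: eD.
by rewrite -ball_normE /= distrC; exact: h.
Qed.

Lemma Ccvg_comp_all r V W X (D : set V) (G : nat -> W -> X) F (B : nat -> V -> W) C :
  Ccvg r setT G F -> Ccvg r D B C ->
  Ccvg r D (fun n y => G n (B n y)) (fun y => F (C y)).
Proof. by apply: Ccvg_comp_open => //; exact: openT. Qed.

Lemma Ccvg_cst r V W (D : set V) (c : nat -> W) (l : W) :
  c @ \oo --> l -> Ccvg r D (fun n _ => c n) (fun=> l).
Proof.
elim: r V W D c l => [|r IH] V W D c l cl /=.
  move=> y Dy e e0; apply/evtP.
  have [N _ NH] : \forall n \near \oo, `|c n - l| < e.
    by move/cvgr_distC_lt: cl; exact.
  by exists N, 1 => // n z Nn _ _; exact: NH.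
exists (fun _ _ _ => 0), (fun _ _ => 0); split.
  by move=> n y; exact: is_diff_cst.
apply: (IH _ _ _ (fun n => (c n, 0)) (l, 0)).
by apply: cvg_pair => //; exact: cvg_cst.
Qed.

Lemma Ccvg_lin r V W (D : set V) (f : V -> W) : linear f -> continuous f ->
  Ccvg r D (fun=> f) f.
Proof.
elim: r V W D f => [|r IH] V W D f lf cf /=.
  move=> y Dy e e0; have /cvgr_distC_lt/(_ _ e0)/nbhs_ballP[d /= d0 H] := cf y.
  by apply/evtP; exists 0%N, d => // n z _ zd _; apply: H; rewrite -ball_normE /= distrC.
pose L : {linear V -> W} := HB.pack f (GRing.isLinear.Build _ _ _ _ f lf).
exists (fun _ _ => f), (fun=> f); split.
  move=> _ y; split; first exact: (@linear_differentiable _ _ _ L).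
  exact: (@diff_lin _ _ _ L).
apply: (IH _ _ _ (fun z : V * V => (f z.1, f z.2))).
  by move=> a [x1 x2] [y1 y2] /=; rewrite !lf.
move=> z; apply: cvg_pair.
  exact: (continuous_comp (g := f) cvg_fst (cf _)).
exact: (continuous_comp (g := f) cvg_snd (cf _)).
Qed.

Lemma Ccvg_pair r V W X (D : set V) (G : nat -> V -> W) F (G' : nat -> V -> X) F' :
  Ccvg r D G F -> Ccvg r D G' F' ->
  Ccvg r D (fun n y => (G n y, G' n y)) (fun y => (F y, F' y)).
Proof.
elim: r V W X D G F G' F' => [|r IH] V W X D G F G' F' /=.
  move=> H H' y Dy e e0; apply: evtS2 (H y Dy e e0) (H' y Dy e e0) => n z h h' Dz.
  by rewrite prod_normE gt_max h ?h'.
move=> [dG [dF [dGP CG]]] [dG' [dF' [dGP' CG']]].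
exists (fun n y v => (dG n y v, dG' n y v)), (fun y v => (dF y v, dF' y v)); split.
  by move=> n y; exact: is_diff_pair.
(* The tangent of a pair groups values first and derivatives second, whereas the induction
   hypothesis delivers one tangent after the other; [s] exchanges the two middle factors. *)
pose s (z : (W * W) * (X * X)) := ((z.1.1, z.2.1), (z.1.2, z.2.2)).
have sl : linear s by move=> a [[? ?] [? ?]] [[? ?] [? ?]].
have sc : continuous s.
  have cf (Y Z : normedModType R) : continuous (fst : Y * Z -> Y).
    by move=> z; exact: cvg_fst.
  have cs (Y Z : normedModType R) : continuous (snd : Y * Z -> Z).
    by move=> z; exact: cvg_snd.
  move=> z.
  have c1 := @continuous_comp _ _ _ fst fst z (cf _ _ z) (cf _ _ _).
  have c2 := @continuous_comp _ _ _ snd fst z (cs _ _ z) (cf _ _ _).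
  have c3 := @continuous_comp _ _ _ fst snd z (cf _ _ z) (cs _ _ _).
  have c4 := @continuous_comp _ _ _ snd snd z (cs _ _ z) (cs _ _ _).
  exact: (cvg_pair (cvg_pair c1 c2) (cvg_pair c3 c4)).
exact: (Ccvg_comp_all (Ccvg_lin r setT sl sc) (IH _ _ _ _ _ _ _ _ CG CG')).
Qed.

Lemma Ccvg_lincomp r V W X (D : set V) (G : nat -> V -> W) F (f : W -> X) :
  linear f -> continuous f -> Ccvg r D G F ->
  Ccvg r D (fun n y => f (G n y)) (fun y => f (F y)).
Proof. by move=> lf cf; apply: (Ccvg_comp_all (Ccvg_lin r setT lf cf)). Qed.

Lemma Ccvg_fst r V W X (D : set V) (G : nat -> V -> W * X) F : Ccvg r D G F ->
  Ccvg r D (fun n y => (G n y).1) (fun y => (F y).1).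
Proof.
by apply: (Ccvg_lincomp (f := fst)) => [a [? ?] [? ?]//|z]; exact: cvg_fst.
Qed.

Lemma Ccvg_snd r V W X (D : set V) (G : nat -> V -> W * X) F : Ccvg r D G F ->
  Ccvg r D (fun n y => (G n y).2) (fun y => (F y).2).
Proof.
by apply: (Ccvg_lincomp (f := snd)) => [a [? ?] [? ?]//|z]; exact: cvg_snd.
Qed.

Lemma Ccvg_add r V W (D : set V) (G : nat -> V -> W) F (G' : nat -> V -> W) F' :
  Ccvg r D G F -> Ccvg r D G' F' ->
  Ccvg r D (fun n y => G n y + G' n y) (fun y => F y + F' y).
Proof.
move=> CG CG'.
apply: (Ccvg_lincomp (f := fun z : W * W => z.1 + z.2)) (Ccvg_pair CG CG').
  by move=> a [x1 x2] [y1 y2] /=; rewrite scalerDr addrACA.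
by move=> z; apply: cvgD; [exact: cvg_fst|exact: cvg_snd].
Qed.

Lemma Ccvg_sum r V W (I : Type) (l : seq I) (D : set V) (Gs : I -> nat -> V -> W) Fs :
  (forall p, Ccvg r D (Gs p) (Fs p)) ->
  Ccvg r D (fun n y => \sum_(p <- l) Gs p n y) (fun y => \sum_(p <- l) Fs p y).
Proof.
move=> H; elim: l => [|p l IH].
  apply: Ccvg_ext (Ccvg_cst r D (cvg_cst (0 : W))) => [n y|y _]; by rewrite big_nil.
apply: Ccvg_ext (Ccvg_add (H p) IH) => [n y|y _]; by rewrite big_cons.
Qed.

Lemma is_diff_scale W (p : R * W) :
  is_diff p (fun q => q.1 *: q.2) (fun q => p.1 *: q.2 + q.1 *: p.2).
Proof.
have bil : bilinear_for
    (GRing.Scale.Law.clone _ _ *:%R _) (GRing.Scale.Law.clone _ _ *:%R _)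
    (@GRing.scale R W : R -> W -> W).
  split=> [u'|u] a x y /=; first by rewrite scalerDl scalerA.
  by rewrite scalerDr !scalerA mulrC.
pose f : {bilinear R -> W -> W} := HB.pack (@GRing.scale R W : R -> W -> W)
  (bilinear_isBilinear.Build R R W W _ _ (@GRing.scale R W) bil).
have fc : continuous (fun q : R * W => f q.1 q.2).
  by move=> q; apply: cvgZ; [exact: cvg_fst|exact: cvg_snd].
split; first exact: (@differentiable_bilin _ _ _ _ f).
exact: (@diff_bilin _ _ _ _ f).
Qed.

Lemma Ccvg_scale r V W (D : set V) (s : nat -> V -> R) t (G : nat -> V -> W) F :
  Ccvg r D s t -> Ccvg r D G F ->
  Ccvg r D (fun n y => s n y *: G n y) (fun y => t y *: F y).
Proof.
elim: r V W D s t G F => [|r IH] V W D s t G F /=.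
  move=> S H y Dy e e0.
  have sF : 0 < `|F y| + 1 by rewrite ltr_pwDr.
  have tF : 0 < `|t y| + 1 by rewrite ltr_pwDr.
  pose d := Num.min 1 (e / 2 / (`|t y| + 1)).
  have d0 : 0 < d by rewrite lt_min ltr01 !divr_gt0.
  have d1 : 0 < e / 2 / (`|F y| + 1) by rewrite !divr_gt0.
  apply: evtS2 (S y Dy (Num.min 1 (e / 2 / (`|F y| + 1))) _) (H y Dy d d0) => [n z hs hG Dz|].
    have {hs} := hs Dz; have {hG} := hG Dz.
    rewrite !lt_min => /andP[G1 G2] /andP[s1 s2].
    have -> : s n z *: G n z - t y *: F y
        = (s n z - t y) *: F y + s n z *: (G n z - F y).
      by rewrite scalerBl scalerBr [RHS]addrC addrA subrK.
    apply: (le_lt_trans (ler_normD _ _)); rewrite !normrZ.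
    have st : `|s n z| <= `|t y| + 1.
      have := ler_normD (t y) (s n z - t y); rewrite addrC subrK.
      by move=> /le_trans; apply; rewrite lerD2l ltW.
    rewrite (splitr e) ltr_leD//.
      apply: (le_lt_trans (y := `|s n z - t y| * (`|F y| + 1))).
        by rewrite ler_wpM2l// lerDl.
      by rewrite -ltr_pdivlMr.
    apply: (le_trans (y := (`|t y| + 1) * `|G n z - F y|)).
      by rewrite ler_wpM2r.
    by rewrite mulrC -ler_pdivlMr// ltW.
  by rewrite lt_min ltr01.
move=> [ds [dt [dsP CS]]] [dG [dF [dGP CG]]].
exists (fun n y v => s n y *: dG n y v + ds n y v *: G n y),
  (fun y v => t y *: dF y v + dt y v *: F y); split.
  move=> n y.
  exact: (@is_diff_comp _ _ _ _ _ _ _ _ y (is_diff_pair (dsP n y) (dGP n y))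
    (@is_diff_scale W (s n y, G n y))).
have S1 := Ccvg_fst CS; have S2 := Ccvg_snd CS.
have G1 := Ccvg_fst CG; have G2 := Ccvg_snd CG.
exact: (Ccvg_pair (IH _ _ _ _ _ _ _ S1 G1)
  (Ccvg_add (IH _ _ _ _ _ _ _ S1 G2) (IH _ _ _ _ _ _ _ S2 G1))).
Qed.

End ContinuousConvergence.

(** * Uniform estimates on compact sets *)

Section CompactUniformity.
Variable R : realType.
Implicit Types V W : normedModType R.

(** Continuity of the limit comes from letting the point move: [F y] and [F z] are both close to
    [G n z] for one large [n]. *)
Lemma ccvg_continuous V W (D : set V) (G : nat -> V -> W) F : ccvg D G F ->
  forall y, D y -> forall e : R, 0 < e ->
  exists2 d : R, 0 < d & forall z, D z -> `|z - y| < d -> `|F z - F y| < e.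
Proof.
move=> GF y Dy e e0; have e2 : 0 < e / 2 by rewrite divr_gt0.
have /evtP[N [d d0 K]] := GF y Dy _ e2; exists d => // z Dz zd.
have /evtP[N' [d' d'0 K']] := GF z Dz _ e2.
have /(_ Dz) h1 := K (maxn N N') z (leq_maxl _ _) zd.
have := K' (maxn N N') z (leq_maxr _ _); rewrite subrr normr0 => /(_ d'0 Dz) h2.
rewrite (splitr e) -(subrKA (G (maxn N N') z)).
by rewrite (le_lt_trans (ler_normD _ _))// ltrD// distrC.
Qed.

(** The two arguments may differ: uniform convergence and uniform continuity in one estimate, as
    needed to compare an increment at the current point of a polygon with the field at its starting
    point. *)
Lemma ccvg_unif_compact V W (D C : set V) (G : nat -> V -> W) F :
  ccvg D G F -> compact C -> C `<=` D -> forall e : R, 0 < e ->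
  exists N : nat, exists2 d : R, 0 < d & forall n y z, (N <= n)%N -> C y -> C z ->
    `|y - z| < d -> `|G n y - F z| < e.
Proof.
move=> GF cC CD e e0; have e2 : 0 < e / 2 by rewrite divr_gt0.
have /compact_near_coveringP H := cC.
have := H _ (filter_prod \oo (0 : R)^'+)
  (fun i x => C x -> forall z, C z -> `|x - z| < i.2 -> `|G i.1 x - F z| < e) _.
case.
  move=> x Cx.
  have /evtP[N [d d0 K]] := GF x (CD _ Cx) _ e2.
  have [d' d'0 K'] := ccvg_continuous GF (CD _ Cx) e2.
  pose m := Num.min d d' / 2.
  have m0 : 0 < m by rewrite divr_gt0 // lt_min d0.
  exists (ball x m, [set i : nat * R | (N <= i.1)%N /\ i.2 < m]); first split => /=.
  - exact: nbhsx_ballx.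
  - exists ([set n | (N <= n)%N], [set r | r < m]); first split => /=.
    + by exists N.
    + exact: nbhs_right_lt.
    + by move=> [i1 i2] [].
  move=> [x' [n r]] /= [x'm [Nn rm]] Cx' z Cz xz.
  move: x'm; rewrite -ball_normE /= distrC => x'm.
  have mm : m * 2 <= d /\ m * 2 <= d'.
    by rewrite /m mulfVK ?pnatr_eq0//; split; rewrite ge_min lexx ?orbT.
  rewrite (splitr e) -(subrKA (F x)) (le_lt_trans (ler_normD _ _))// ltrD//.
    apply: (K _ _ Nn) => //; last exact: CD.
    by apply: (lt_le_trans x'm); apply: le_trans mm.1; rewrite ler_pMr// ler1n.
  rewrite distrC; apply: K'; first exact: CD.
  rewrite -(subrKA x') (le_lt_trans (ler_normD _ _))//.
  rewrite (lt_le_trans _ mm.2)// mulr_natr mulr2n ltrD// distrC.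
  exact: lt_trans xz rm.
move=> [A B] [/= [N _ NA] B0] AB.
have [b [Bb b0]] := filter_ex (filterI B0 (nbhs_right_gt (0 : R))).
exists N, b => // n y z Nn Cy Cz yz.
by apply: (AB (n, b)) => //=; split => //; exact: NA.
Qed.

Lemma ccvg_bounded_compact V W (D C : set V) (G : nat -> V -> W) F :
  ccvg D G F -> compact C -> C `<=` D ->
  exists N : nat, exists2 M : R, 0 < M & forall n y, (N <= n)%N -> C y ->
    `|G n y| <= M /\ `|F y| <= M.
Proof.
move=> GF cC CD; have /compact_near_coveringP H := cC.
have := H _ (filter_prod \oo \oo)
  (fun i x => C x -> `|G i.1 x| <= i.2%:R /\ `|F x| <= i.2%:R) _.
case.
  move=> x Cx.
  have /evtP[N [d d0 K]] := GF x (CD _ Cx) _ ltr01.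
  have [d' d'0 K'] := ccvg_continuous GF (CD _ Cx) ltr01.
  pose m := Num.min d d'.
  have m0 : 0 < m by rewrite lt_min d0.
  pose N' := (Num.truncn (`|F x| + 1)).+1.
  exists (ball x m, [set i : nat * nat | (N <= i.1)%N /\ (N' <= i.2)%N]); first split => /=.
  - exact: nbhsx_ballx.
  - exists ([set n | (N <= n)%N], [set n | (N' <= n)%N]); first split => /=.
    + by exists N.
    + by exists N'.
    + by move=> [i1 i2] [].
  move=> [x' [n r]] /= [x'm [Nn rm]] Cx'.
  move: x'm; rewrite -ball_normE /= distrC /m lt_min => /andP[xd xd'].
  have Fr : `|F x| + 1 <= r%:R.
    by apply: le_trans (ltW (truncnS_gt _)) _; rewrite ler_nat.
  have tri (w : W) : `|w - F x| < 1 -> `|w| <= r%:R.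
    move=> w1; apply: le_trans Fr; rewrite -[w in `|w|](subrK (F x)).
    by rewrite (le_trans (ler_normD _ _))// addrC lerD2l ltW.
  split; apply: tri; first by apply: K => //; exact: CD.
  by apply: K' => //; exact: CD.
move=> [A B] [/= [N _ NA] [m _ mB]] AB.
exists N, m.+1%:R; first by rewrite ltr0n.
by move=> n y Nn Cy; apply: (AB (n, m.+1)) => //=; split; [exact: NA|apply: mB => /=].
Qed.

End CompactUniformity.

Section Gronwall.
Variable R : realType.

Lemma discrete_gronwall (a : nat -> R) (b c : R) n : 0 <= b -> 0 <= c ->
  (forall k, (k < n)%N -> a k.+1 <= (1 + c) * a k + b) ->
  a n <= (1 + c) ^+ n * (a 0%N + n%:R * b).
Proof.
move=> b0 c0; elim: n => [|n IH] H; first by rewrite expr0 mul1r mul0r addr0.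
apply: (le_trans (H n (ltnSn n))).
have c1 : 1 <= 1 + c by rewrite lerDl.
have := IH (fun k kn => H k (ltnW kn)) => {}IH.
apply: (le_trans (y := (1 + c) ^+ n.+1 * (a 0%N + n%:R * b) + (1 + c) ^+ n.+1 * b)).
  apply: lerD; first by rewrite exprS -mulrA ler_wpM2l// (le_trans ler01).
  by rewrite ler_peMl// exprn_ege1.
by rewrite -mulrDr -addrA -[in leRHS]natr1 mulrDl mul1r.
Qed.

Lemma compound_le_expR (c : R) n k : 0 <= c -> (k <= n.+1)%N ->
  (1 + c / n.+1%:R) ^+ k <= expR c.
Proof.
move=> c0 kn; have n0 : 0 < (n.+1%:R : R) by rewrite ltr0n.
apply: (le_trans (y := expR (c / n.+1%:R) ^+ k)).
  by rewrite lerXn2r ?nnegrE ?expR_ge0 ?expR_ge1Dx// addr_ge0// divr_ge0// ltW.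
rewrite -expRM_natl ler_expR; rewrite mulrC -mulrA ler_piMr//.
by rewrite ler_pdivrMl// mulr1 ler_nat.
Qed.

End Gronwall.

(** * Convergence of Euler schemes *)

Section EulerSchemes.
Variable R : realType.
Implicit Types V : normedModType R.

Definition euler V (E : nat -> V -> V) (n : nat) (y : V) : V :=
  y + n.+1%:R^-1 *: E n y.

Definition traj V (E : nat -> V -> V) (n k : nat) (y : V) : V := iter k (euler E n) y.

Lemma trajD V (E : nat -> V -> V) n i j y : traj E n (i + j) y = traj E n i (traj E n j y).
Proof. exact: iterD. Qed.

(* [gamma' = F gamma] on [[0, t0]], with differentiability uniform in time. *)
Definition usol V (F : V -> V) (t0 : R) (gamma : R -> V) : Prop :=
  forall e : R, 0 < e -> exists2 tau : R, 0 < tau & forall t t', 0 <= t -> t <= t' ->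
    t' <= t0 -> t' - t <= tau ->
    `|gamma t' - gamma t - (t' - t) *: F (gamma t)| <= e * (t' - t).

Lemma euler_consistent V (O C : set V) (E : nat -> V -> V) F :
  ccvg O E F -> compact C -> C `<=` O -> forall e : R, 0 < e ->
  exists2 tau : R, 0 < tau & exists N, forall n z j, (N <= n)%N ->
    (forall i, (i < j)%N -> C (traj E n i z)) -> j%:R / n.+1%:R <= tau ->
    `|traj E n j z - z - (j%:R / n.+1%:R) *: F z| <= e * (j%:R / n.+1%:R).
Proof.
move=> EF cC CO e e0.
have [N1 [rho rho0 U2]] := ccvg_unif_compact EF cC CO e0.
have [N2 [M M0 U1]] := ccvg_bounded_compact EF cC CO.
have eM : 0 < e + M + 1 by rewrite !addr_gt0.
(* The polygon has speed at most [e + M], so up to this time it stays within [rho] of [z]; the extra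
   1 makes the bound strict. *)
exists (rho / (e + M + 1)); first by rewrite divr_gt0.
exists (maxn N1 N2) => n z j; rewrite geq_max => /andP[n1 n2].
elim: j => [|j IH] H jt.
  by rewrite !mul0r scale0r subr0 /= subrr normr0 mulr0.
have n0 : 0 < (n.+1%:R : R) by rewrite ltr0n.
have jj : j%:R / n.+1%:R <= j.+1%:R / n.+1%:R :> R.
  by rewrite ler_pM2r ?invr_gt0// ler_nat.
have {}IH := IH (fun i ij => H i (ltnW ij)) (le_trans jj jt).
have Cz : C z by apply: (H 0%N).
have Cj := H j (ltnSn j).
have zj : `|traj E n j z - z| < rho.
  rewrite -[X in `|X|](subrK ((j%:R / n.+1%:R) *: F z)).
  apply: (le_lt_trans (ler_normD _ _)).
  apply: (le_lt_trans (y := (e + M) * (j%:R / n.+1%:R))).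
    rewrite mulrDl lerD// normrZ ger0_norm ?divr_ge0 ?ler0n// mulrC.
    by rewrite ler_wpM2r ?divr_ge0 ?ler0n//; have [] := U1 n z n2 Cz.
  apply: (le_lt_trans (ler_wpM2l _ (le_trans jj jt))); first by rewrite addr_ge0// ltW.
  by rewrite mulrA ltr_pdivrMr// mulrC ltr_pM2l// ltrDl.
have Ej := U2 n _ _ n1 Cj Cz zj.
have -> : traj E n j.+1 z - z - (j.+1%:R / n.+1%:R) *: F z =
    (traj E n j z - z - (j%:R / n.+1%:R) *: F z) + n.+1%:R^-1 *: (E n (traj E n j z) - F z).
  rewrite -[j.+1%:R]natr1 mulrDl mul1r scalerDl scalerBr /traj iterS {1}/euler -!/(traj _ _ _ _).
  by rewrite opprD !addrA -!addrA; congr (_ + _); rewrite addrCA; congr (_ + _);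
    rewrite addrCA.
rewrite -[j.+1%:R]natr1 mulrDl mul1r mulrDr (le_trans (ler_normD _ _))// lerD//.
by rewrite normrZ gtr0_norm ?invr_gt0// mulrC ler_wpM2r ?invr_ge0 ?ltW.
Qed.

(** A single ultrafilter makes the polygons converge at all times simultaneously, in place of
    extracting subsequences. *)
Lemma ultra_compact_cvg (T : Type) (X : topologicalType) (U : set_system T)
    (f : T -> X) (C : set X) :
  UltraFilter U -> compact C -> U (f @^-1` C) -> exists2 p, C p & f @ U --> p.
Proof.
move=> UF cC UC; have PU : ProperFilter U by exact: ultra_proper.
have [p [Cp clp]] := cC (f @ U) _ UC; exists p => // A pA.
have [//|nA] := in_ultra_setVsetC (f @^-1` A) UF.
by have [x [/= Ax]] := clp (~` A) A nA pA.
Qed.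

(* Euler polygons are equi-Lipschitz, so their pointwise limit along an
   ultrafilter is a solution. *)
Lemma traj_ultralimit V (O C : set V) (E : nat -> V -> V) F
    (U : set_system (nat * V)) (K : nat * V -> nat) (y0 : V) (t0 : R) :
  ccvg O E F -> compact C -> C `<=` O -> UltraFilter U ->
  (forall N, U [set z | (N <= z.1)%N]) -> (fun z => z.2) @ U --> y0 -> 0 <= t0 ->
  U [set z | (K z <= z.1.+1)%N /\ forall i, (i <= K z)%N -> C (traj E z.1 i z.2)] ->
  (fun z => (K z)%:R / z.1.+1%:R : R) @ U --> t0 ->
  exists gamma : R -> V, [/\ gamma 0 = y0, forall t, C (gamma t), usol F t0 gamma &
    (fun z => traj E z.1 (K z) z.2) @ U --> gamma t0].
Proof.
move=> EF cC CO UF UN U2 t0_ge0 UK Kt.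
have PU : ProperFilter U by exact: ultra_proper.
(* For [t0] = 0 the index [K z] need not vanish, only its share of the time tends to 0; the polygon
   moves by at most [1 + M] times this share, and the limit path is constant. *)
move: t0_ge0 Kt; rewrite le_eqVlt => /predU1P[<-|t00] Kt.
  have Cz2 : U [set z | C z.2] by apply: filterS UK => z [_ /(_ 0%N (leq0n _))].
  have Cy0 : C y0.
    exact: (closed_cvg _ (compact_closed (@norm_hausdorff _ _) cC) Cz2).
  exists (fun=> y0); split => //.
    move=> e e0; exists 1 => // t t' tge tt' t'0 _.
    have -> : t' = t by apply/eqP; rewrite eq_le tt' andbT (le_trans t'0).
    by rewrite !subrr scale0r subr0 normr0 mulr0.
  have [tau tau0 [N EC]] := euler_consistent EF cC CO ltr01.
  have [N' [M M0 B]] := ccvg_bounded_compact EF cC CO.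
  have K0 : (fun z => (K z)%:R / z.1.+1%:R * (1 + M) : R) @ U --> (0 : R).
    rewrite -[X in _ --> X](mul0r (1 + M)); exact: (cvgM Kt (cvg_cst (1 + M))).
  have S0 : (fun z => traj E z.1 (K z) z.2 - z.2) @ U --> (0 : V).
    apply/cvgrPdist_le => e e0; have H3 := cvgr_le _ K0 _ e0.
    have H4 := cvgr_lt _ Kt _ tau0; have H5 := UN (maxn N N').
    near=> z; rewrite sub0r normrN.
    have [_ CK] : (K z <= z.1.+1)%N /\ forall i, (i <= K z)%N -> C (traj E z.1 i z.2).
      by near: z.
    have : (maxn N N' <= z.1)%N by near: z; exact: H5.
    rewrite geq_max => /andP[Nz Nz'].
    have Ktau : (K z)%:R / z.1.+1%:R < tau by near: z; exact: H4.
    have Ke : (K z)%:R / z.1.+1%:R * (1 + M) <= e by near: z; exact: H3.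
    apply: le_trans Ke.
    have := EC _ z.2 (K z) Nz (fun i iK => CK i (ltnW iK)) (ltW Ktau).
    rewrite mul1r => h; have [_ FM] := B _ z.2 Nz' (CK 0%N (leq0n _)).
    rewrite -[X in `|X|](subrK (((K z)%:R / z.1.+1%:R) *: F z.2)).
    rewrite (le_trans (ler_normD _ _))// mulrDr mulr1 lerD// normrZ ger0_norm ?divr_ge0//.
    by rewrite ler_wpM2l// divr_ge0.
  rewrite (_ : (fun z => _) = (fun z => (traj E z.1 (K z) z.2 - z.2) + z.2)).
    by rewrite -[X in _ --> X]add0r; exact: cvgD.
  by apply/funext => z; rewrite subrK.
(* Index reached at time [t], capped by [K z] since the polygon is known to stay in [C] only so far.
   From [t0] on it is exactly [K z], so that the value at [t0] is the limit of the stopped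
   polygons. *)
pose idx t z := if t < t0 then minn (Num.truncn (t * z.1.+1%:R)) (K z) else K z.
have idxK t z : (idx t z <= K z)%N by rewrite /idx; case: ifP => // _; exact: geq_minr.
have Cidx t : U [set z | C (traj E z.1 (idx t z) z.2)].
  by apply: filterS UK => z [_]; apply; exact: idxK.
have lim t : exists p, C p /\ (fun z => traj E z.1 (idx t z) z.2) @ U --> p.
  by have [p] := ultra_compact_cvg (f := fun z => traj E z.1 (idx t z) z.2) UF cC (Cidx t); exists p.
have [g gP] := choice lim.
have norm_small (e : R) : 0 < e -> U [set z | z.1.+1%:R^-1 < e].
  move=> e0; apply: filterS (UN (Num.truncn e^-1)) => z /= h.
  rewrite invf_plt ?posrE ?ltr0n// (lt_le_trans (truncnS_gt _))// ler_nat//.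
have idxt t : 0 <= t -> t <= t0 -> (fun z => (idx t z)%:R / z.1.+1%:R : R) @ U --> t.
  move=> t_ge0; rewrite le_eqVlt /idx => /predU1P[->|tt0].
    by rewrite ltxx.
  rewrite tt0; apply/cvgrPdist_lt => e e0.
  have /cvgrPdist_lt/(_ _ e0) Ke := Kt.
  have /cvgrPdist_lt/(_ (t0 - t)) Ktt := Kt.
  rewrite subr_gt0 in Ktt.
  apply: filterS3 (norm_small _ e0) Ke (Ktt tt0) => z nz Kz Kz2.
  have n0 : 0 < (z.1.+1%:R : R) by rewrite ltr0n.
  have m0 : 0 <= t * z.1.+1%:R by rewrite mulr_ge0// ltW.
  have tz : (Num.truncn (t * z.1.+1%:R) < (K z).+1)%N.
    rewrite ltnS -(ler_nat R) (le_trans (y := t * z.1.+1%:R)) ?truncn_le//.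
    rewrite -ler_pdivlMr//; move: Kz2; rewrite ltr_norml => /andP[_].
    by rewrite ltrD2l ltrN2 => /ltW.
  rewrite (minn_idPl _)//.
  have /andP[tr1 tr2] := truncn_itv m0.
  rewrite ger0_norm; last by rewrite subr_ge0 ler_pdivrMr.
  apply: le_lt_trans nz; rewrite lerBlDr -{1}[z.1.+1%:R^-1]mul1r -mulrDl ler_pdivlMr// nat1r.
  exact: ltW.
exists g; split.
- have [_ h] := gP 0; apply: (cvg_unique _ h) => //.
  apply: cvg_trans U2; apply: near_eq_cvg; near=> z.
  by rewrite /idx t00 mul0r truncn0 min0n.
- by move=> t; have [] := gP t.
- move=> e e0; have [tau tau0 [N EC]] := euler_consistent EF cC CO e0.
  exists (tau / 2); first by rewrite divr_gt0.
  move=> t t' t_ge0 tt' t't0 tau2.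
  have [Ct ct] := gP t; have [Ct' ct'] := gP t'.
  have it := idxt t t_ge0 (le_trans tt' t't0).
  have it' := idxt t' (le_trans t_ge0 tt') t't0.
  have Fc : (fun z => F (traj E z.1 (idx t z) z.2)) @ U --> F (g t).
    apply/cvgrPdist_lt => eps eps0.
    have [d d0 Fd] := ccvg_continuous EF (CO _ Ct) eps0.
    move/cvgrPdist_lt: ct => /(_ _ d0) ct.
    apply: filterS2 ct (Cidx t) => z; rewrite distrC => zd Cz.
    by rewrite distrC; apply: Fd => //; exact: CO.
  have idd : (fun z => (idx t' z)%:R / z.1.+1%:R - (idx t z)%:R / z.1.+1%:R : R) @ U --> t' - t.
    exact: cvgB.
  apply: (@ler_cvg_to _ U _ _
    (fun z => `|traj E z.1 (idx t' z) z.2 - traj E z.1 (idx t z) z.2 -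
       ((idx t' z)%:R / z.1.+1%:R - (idx t z)%:R / z.1.+1%:R) *: F (traj E z.1 (idx t z) z.2)|)
    (fun z => e * ((idx t' z)%:R / z.1.+1%:R - (idx t z)%:R / z.1.+1%:R))).
  + exact: (cvg_norm (cvgB (cvgB ct' ct) (cvgZ idd Fc))).
  + exact: (cvgM (cvg_cst e) idd).
  have ltau : t' - t < tau by rewrite (le_lt_trans tau2)// ltr_pdivrMr// ltr_pMr// ltr1n.
  have H3 := cvgr_lt _ idd _ ltau.
  have H4 := UN N.
  near=> z.
  have [Kz CK] : (K z <= z.1.+1)%N /\ forall i, (i <= K z)%N -> C (traj E z.1 i z.2).
    by near: z.
  have Nz : (N <= z.1)%N by near: z; exact: H4.
  have : (idx t' z)%:R / z.1.+1%:R - (idx t z)%:R / z.1.+1%:R < tau.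
    by near: z; exact: H3.
  have leidx : (idx t z <= idx t' z)%N.
    rewrite /idx; case: ifP => h; case: ifP => h'.
    - by rewrite leq_min geq_minr andbT geq_min le_truncn // ler_wpM2r.
    - exact: geq_minr.
    - by rewrite (le_lt_trans tt' h') in h.
    - by [].
  rewrite -mulrBl -natrB// => hz.
  have := EC z.1 (traj E z.1 (idx t z) z.2) (idx t' z - idx t z)%N Nz.
  rewrite -trajD subnK//; apply => [i ilt|]; last exact: ltW.
  rewrite -trajD; apply: CK; rewrite (leq_trans _ (idxK t' z))//.
  by rewrite ltnW// addnC -ltn_subRL.
- have [_] := gP t0; apply: cvg_trans; apply: near_eq_cvg; near=> z.
  by rewrite /idx ltxx.
Unshelve. all: by end_near. Qed.

End EulerSchemes.

(** * Convergence of schemes with derivatives *)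

Section FlowConvergence.
Variable R : realType.
Implicit Types V W : normedModType R.

(** Finite dimension is expressed by compact closed balls because this property passes directly to
    [V * V], the space of the tangent scheme. *)
Definition proper V := forall M : R, compact [set x : V | `|x| <= M].

Lemma proper_prod V W : proper V -> proper W -> proper (V * W)%type.
Proof.
move=> pV pW M.
rewrite (_ : [set x | _] = [set x : V | `|x| <= M] `*` [set x : W | `|x| <= M]).
  exact: compact_setX.
by apply/seteqP; split => -[x y] /=; rewrite prod_normE ge_max => /andP.
Qed.

(* Near each point of [D] the schemes stay in a compact part of the domain [O]
   of [F], and solutions issued from [D] are unique. *)
Definition well_posed V (O D : set V) (E : nat -> V -> V) (F : V -> V) : Prop :=
  forall y, D y ->
  (exists C, [/\ compact C, C `<=` O & evt y (fun n y' => D y' ->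
     forall i, (i <= n.+1)%N -> C (traj E n i y'))]) /\
  (forall C, compact C -> C `<=` O -> forall g g' : R -> V,
     usol F 1 g -> usol F 1 g' -> (forall t, C (g t)) -> (forall t, C (g' t)) ->
     g 0 = y -> g' 0 = y -> forall t, 0 <= t -> t <= 1 -> g t = g' t).

(** Every ultrafilter refining the joint filter at [y] yields a solution in the limit, and
    uniqueness fixes its value at time 1. A failure of convergence would persist along some
    ultrafilter, contradicting this. *)
Lemma well_posed_cvg V (O D : set V) E F : ccvg O E F -> well_posed O D E F ->
  exists P : V -> V, ccvg D (fun n => traj E n n.+1) P /\
    forall y, D y -> exists C g, [/\ compact C, C `<=` O, usol F 1 g &
      [/\ forall t, C (g t), g 0 = y & g 1 = P y]].
Proof.
move=> EF WP.
have lim y : exists p : V, D y -> (forall e : R, 0 < e ->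
    evt y (fun n y' => D y' -> `|traj E n n.+1 y' - p| < e)) /\
    exists C g, [/\ compact C, C `<=` O, usol F 1 g &
      [/\ forall t, C (g t), g 0 = y & g 1 = p]].
  have [Dy|nDy] := pselect (D y); last by exists 0.
  have [[C [cC CO CE]] uniq] := WP y Dy.
  pose A := filter_prod \oo (within D (nbhs y)).
  have PA : ProperFilter A.
    by apply: filter_prod_proper; apply: within_nbhs_proper; exact: subset_closure.
  have evtA P : evt y (fun n y' => D y' -> P n y') -> A [set z | P z.1 z.2].
    move/evtP=> [N [d d0 K]].
    exists ([set n | (N <= n)%N], [set z | D z /\ `|z - y| < d]); first split => /=.
    - by exists N.
    - rewrite /within /=; apply/nbhs_ballP; exists d => //= z.
      by rewrite -ball_normE /= distrC.
    by move=> [n z] /= [Nn [Dz zd]]; exact: K.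
  have sol (U : set_system (nat * V)) : UltraFilter U -> A `<=` U ->
      exists g : R -> V, [/\ g 0 = y, forall t, C (g t), usol F 1 g &
        (fun z => traj E z.1 z.1.+1 z.2) @ U --> g 1].
    move=> UF AU; apply: (@traj_ultralimit R V O C E F U (fun z => z.1.+1) y 1) => //.
    - by move=> N; apply: AU; apply: (evtA (fun n _ => (N <= n)%N)); apply: evtS (evt_ge y N).
    - have PU : ProperFilter U by exact: ultra_proper.
      apply/cvgrPdist_lt => e e0; apply: AU.
      apply: (evtA (fun _ z => `|y - z| < e)).
      by apply: evtS (evt_near y e0) => n z; rewrite distrC.
    - apply: AU.
      apply: (evtA (fun n z => (n.+1 <= n.+1)%N /\ forall i, (i <= n.+1)%N -> C (traj E n i z))).
      by apply: evtS CE => n z h /h.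
    - have PU : ProperFilter U by exact: ultra_proper.
      rewrite (_ : (fun z => _) = fun=> 1); first exact: cvg_cst.
      by apply/funext => z; rewrite divff// pnatr_eq0.
  have [U0 [U0F AU0]] := ultraFilterLemma PA.
  have [g0 [g00 g0C g0s _]] := sol U0 U0F AU0.
  exists (g0 1) => _; split; last by exists C, g0.
  move=> e e0; apply: contrapT => nH.
  pose B := [set z : nat * V | `|traj E z.1 z.1.+1 z.2 - g0 1| < e].
  have PB : ProperFilter (within (~` B) A).
    split; last exact: within_filter.
    rewrite /within /= => -[[A1 A2] /= [[N _ NA] A2n] A12].
    apply: nH; have [d /= d0 dA] := (nbhs_ballP _ _).1 A2n.
    apply/evtP; exists N, d => // n z Nn zd Dz; apply: contrapT => Bz.
    apply: (A12 (n, z) _ Bz); split; first exact: NA.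
    by apply: dA => //; rewrite -ball_normE /= distrC.
  have [U [UF AU]] := ultraFilterLemma PB.
  have UB : U (~` B) by apply: AU; exact: withinT.
  have [|g [g_0 gC gs gl]] := sol U UF.
    by move=> X AX; apply: AU; apply: filterS AX => z Xz _.
  have g1 : g 1 = g0 1 by apply: (uniq C).
  move: gl; rewrite g1 => /cvgrPdist_lt/(_ _ e0) H.
  have PU : ProperFilter U by exact: ultra_proper.
  have [z [/= h1 []]] := filter_ex (filterI H UB).
  by rewrite /B /= distrC.
have [P HP] := choice lim.
by exists P; split => y Dy; have [] := HP y Dy.
Qed.


Lemma is_diff_linear V W (f df : V -> W) x : is_diff x f df -> linear df.
Proof. by move=> d a u v; have <- := @diff_val _ _ _ _ _ _ _ d; rewrite linearP. Qed.

Definition tangent V W (G : nat -> V -> W) (dG : nat -> V -> V -> W) n (z : V * V) : W * W :=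
  (G n z.1, dG n z.1 z.2).

Lemma traj_tangent1 V (E : nat -> V -> V) dE n k z :
  (traj (tangent E dE) n k z).1 = traj E n k z.1.
Proof. by elim: k => //= k; rewrite /traj /= {1}/euler /= => ->. Qed.

Lemma traj_tangent2 V (E : nat -> V -> V) dE n k z :
  (traj (tangent E dE) n k.+1 z).2 = (traj (tangent E dE) n k z).2 +
    n.+1%:R^-1 *: dE n (traj E n k z.1) (traj (tangent E dE) n k z).2.
Proof. by rewrite -(traj_tangent1 E dE). Qed.

Lemma is_diff_traj V (E : nat -> V -> V) dE n k y :
  (forall y, is_diff y (E n) (dE n y)) ->
  is_diff y (traj E n k) (fun v => (traj (tangent E dE) n k (y, v)).2).
Proof.
move=> Ed; elim: k => [|k IH]; first exact: is_diff_id.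
have := is_diffD IH (@is_diffZ _ _ _ _ _ n.+1%:R^-1 _ (is_diff_comp IH (Ed (traj E n k y)))).
by congr is_diff_def; apply/funext => v; rewrite traj_tangent2.
Qed.

(** Linearity of [dE n y] turns a bound on [C] times the unit ball into an operator norm bound.
    Linearity is at hand for the approximants, so the Lipschitz bound on [dF] is obtained from
    theirs in the limit. *)
Lemma tangent_bounded V (O C : set V) (E : nat -> V -> V) dE F dF :
  proper V -> (forall n y, is_diff y (E n) (dE n y)) ->
  ccvg (O `*` setT) (tangent E dE) (fun z => (F z.1, dF z.1 z.2)) ->
  compact C -> C `<=` O -> exists2 M : R, 0 < M &
    (exists N, forall n y v, (N <= n)%N -> C y -> `|dE n y v| <= M * `|v|) /\
    (forall y v w, C y -> `|dF y v - dF y w| <= M * `|v - w|).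
Proof.
move=> pV Ed TEF cC CO.
have [|N [M M0 B]] := ccvg_bounded_compact (ccvg_snd TEF) (compact_setX cC (pV 1)).
  by move=> [y v] /= [/CO].
have dEB n y v : (N <= n)%N -> C y -> `|dE n y v| <= M * `|v|.
  move=> Nn Cy; have [->|v0] := eqVneq v 0.
    have := is_diff_linear (Ed n y) 1 0 0.
    by rewrite scaler0 !addr0 scale1r => /eqP; rewrite -subr_eq0 opprD addrA subrr sub0r oppr_eq0 => /eqP ->;
      rewrite !normr0 mulr0.
  have nv : 0 < `|v| by rewrite normr_gt0.
  have dEZ : dE n y (`|v|^-1 *: v) = `|v|^-1 *: dE n y v.
    have := is_diff_linear (Ed n y) (`|v|^-1 - 1) v v.
    by rewrite !scalerBl !scale1r !subrK.
  have [] := B n (y, `|v|^-1 *: v) Nn.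
    by split => //=; rewrite normrZ normfV normr_id mulVf// gt_eqF.
  by rewrite /= dEZ normrZ normfV normr_id mulrC ler_pdivrMr.
exists M => //; split; first by exists N.
move=> y v w Cy; apply/ler_addgt0Pr => e e0.
have e2 : 0 < e / 2 by rewrite divr_gt0.
have /evtP[N1 [d1 d10 H1]] := ccvg_snd TEF (conj (CO _ Cy) I : (O `*` setT) (y, v)) e2.
have /evtP[N2 [d2 d20 H2]] := ccvg_snd TEF (conj (CO _ Cy) I : (O `*` setT) (y, w)) e2.
pose n := maxn N (maxn N1 N2).
have /= := H1 n (y, v) _ _ (conj (CO _ Cy) I).
rewrite subrr normr0 /n !leq_max leqnn !orbT -/n => /(_ erefl d10) h1.
have /= := H2 n (y, w) _ _ (conj (CO _ Cy) I).
rewrite subrr normr0 /n !leq_max leqnn !orbT -/n => /(_ erefl d20) h2.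
have lin : dE n y v - dE n y w = dE n y (v - w).
  by have := is_diff_linear (Ed n y) (-1) w v; rewrite !scaleN1r addrC => <-; rewrite addrC.
have -> : dF y v - dF y w = dE n y (v - w) + ((dE n y w - dF y w) - (dE n y v - dF y v)).
  rewrite -lin; move: (dE n y v) (dE n y w) (dF y v) (dF y w) => a b c e'.
  by rewrite opprB [_ + (c - a)]addrC addrA [a - b + _]addrC !subrKA.
apply: (le_trans (ler_normD _ _)); apply: lerD.
  by apply: dEB => //; rewrite /n leq_max leqnn.
by apply: (le_trans (ler_normB _ _)); rewrite (splitr e) lerD// ltW.
Qed.

(** In the base both properties are inherited. In the fibre the scheme is linear and the field
    Lipschitz, so the discrete Gronwall inequality gives confinement to a ball and uniqueness. *)
Lemma well_posed_tangent V (O D : set V) E dE F dF :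
  proper V -> (forall n y, is_diff y (E n) (dE n y)) -> well_posed O D E F ->
  ccvg (O `*` setT) (tangent E dE) (fun z => (F z.1, dF z.1 z.2)) ->
  well_posed (O `*` setT) (D `*` setT) (tangent E dE) (fun z => (F z.1, dF z.1 z.2)).
Proof.
move=> pV Ed WP TEF [y0 v0] [/= Dy _]; have [[C [cC CO CE]] uniq] := WP _ Dy; split.
  have [M M0 [[N B] _]] := tangent_bounded pV Ed TEF cC CO.
  (* [expR M] bounds the growth over [n.+1] steps; the starting vectors [v] lie within 1 of [v0]. *)
  pose L := expR M * (`|v0| + 1).
  exists (C `*` [set v | `|v| <= L]); split.
  - exact: compact_setX.
  - by move=> [y v] [/CO].
  have /evtP[N1 [d d0 K]] := CE.
  apply/evtP; exists (maxn N N1), (Num.min d 1); first by rewrite lt_min d0 ltr01.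
  move=> n [y v]; rewrite geq_max => /andP[n1 n2].
  rewrite prod_normE /= gt_max !lt_min => /andP[/andP[yd _] /andP[_ v1]] [/= Dy' _] i ni.
  rewrite /setX /= traj_tangent1; split; first exact: (K n y).
  have := @discrete_gronwall R (fun k => `|(traj (tangent E dE) n k (y, v)).2|) 0
    (M / n.+1%:R) i (lexx 0).
  cbv beta; rewrite mulr0 addr0 => h.
  apply: (le_trans (h _ _)).
  - by rewrite divr_ge0// ltW.
  - move=> k ki; rewrite addr0 traj_tangent2 (le_trans (ler_normD _ _))// mulrDl mul1r lerD2l.
    rewrite normrZ normfV normr_nat mulrAC mulrC ler_wpM2r ?invr_ge0//.
    by apply: B => //; apply: (K n y) => //; exact: leq_trans (ltnW ki) ni.
  apply: ler_pM => //; first by rewrite exprn_ge0// addr_ge0// divr_ge0// ltW.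
    by apply: compound_le_expR => //; exact: ltW.
  rewrite -[v](subrK v0) (le_trans (ler_normD _ _))// addrC lerD2l.
  exact: ltW.
move=> Ch cCh ChO g g' gs gs' gC gC' g0 g0'.
pose C' := fst @` Ch.
have cC' : compact C'.
  apply: continuous_compact => //; apply: continuous_subspaceT => z; exact: cvg_fst.
have C'O : C' `<=` O by move=> _ [z /ChO[/= Oz _] <-].
have usol1 h : usol (fun z => (F z.1, dF z.1 z.2)) 1 h -> usol F 1 (fst \o h).
  move=> hs e e0; have [tau tau0 H] := hs e e0; exists tau => // t t' t0 tt' t1 td.
  by apply: le_trans (H t t' t0 tt' t1 td); rewrite prod_normE le_max lexx.
have [M M0 [_ B]] := tangent_bounded pV Ed TEF cC' C'O.
have eq1 t : 0 <= t -> t <= 1 -> (g t).1 = (g' t).1.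
  apply: (uniq C' cC' C'O (fst \o g) (fst \o g')); rewrite /= ?g0 ?g0' //.
  - exact: usol1.
  - exact: usol1.
  - by move=> u; exists (g u).
  - by move=> u; exists (g' u).
move=> t t0 t1; apply: injective_projections; first exact: eq1.
apply/eqP; rewrite -subr_eq0 -normr_le0; apply/ler_addgt0Pr => e e0; rewrite add0r.
(* Each of the two solutions deviates from an Euler step at rate [e'], and the sum is amplified by
   at most [expR M] over unit time. *)
pose e' := e / (2 * expR M).
have e'0 : 0 < e' by rewrite divr_gt0// mulr_gt0// expR_gt0.
have [tau tau0 H] := gs e' e'0; have [tau' tau'0 H'] := gs' e' e'0.
pose m := Num.truncn (Num.min tau tau')^-1.
have mtau : m.+1%:R^-1 <= Num.min tau tau'.
  by rewrite invf_ple ?posrE ?ltr0n// ?lt_min ?tau0// ltW// truncnS_gt.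
pose s k : R := t * (k%:R / m.+1%:R).
have sS k : s k.+1 - s k = t / m.+1%:R.
  by rewrite /s -mulrBr -mulrBl -natr1 addrAC subrr add0r mul1r.
have s0 k : 0 <= s k by rewrite mulr_ge0// divr_ge0.
have s1 k : (k <= m.+1)%N -> s k <= 1.
  move=> km; rewrite mulr_ile1// ?divr_ge0// ler_pdivrMr ?ltr0n// mul1r ler_nat//.
have sm : s m.+1 = t by rewrite /s divff ?mulr1// pnatr_eq0.
have tm : 0 <= t / m.+1%:R by rewrite divr_ge0.
have ss k : s k <= s k.+1 by rewrite -subr_ge0 sS.
have := @discrete_gronwall R (fun k => `|(g (s k)).2 - (g' (s k)).2|)
  (2 * e' * (t / m.+1%:R)) (M / m.+1%:R) m.+1.
have s_0 : s 0%N = 0 by rewrite /s mul0r mulr0.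
cbv beta; rewrite sm s_0 g0 g0' subrr normr0 add0r => h.
apply: (le_trans (h _ _ _)).
- by rewrite mulr_ge0// mulr_ge0// ltW.
- by rewrite divr_ge0// ltW.
- move=> k km.
  have step : s k.+1 - s k <= Num.min tau tau'.
    by rewrite sS (le_trans _ mtau)// ler_piMl.
  move: step; rewrite le_min => /andP[st st'].
  have := H _ _ (s0 k) (ss k) (s1 _ km) st; rewrite prod_normE ge_max /= => /andP[_ h1].
  have := H' _ _ (s0 k) (ss k) (s1 _ km) st'; rewrite prod_normE ge_max /= => /andP[_ h2].
  have Cg : C' (g' (s k)).1 by exists (g' (s k)).
  have := B _ (g (s k)).2 (g' (s k)).2 Cg.
  rewrite -(eq1 _ (s0 k) (s1 _ (ltnW km))) in h2 *.
  move: h1 h2; rewrite !sS.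
  move: (g (s k.+1)).2 (g (s k)).2 (g' (s k.+1)).2 (g' (s k)).2 => a b a' b'.
  move: (dF _ b) (dF _ b') => p q h1 h2 h3.
  have -> : a - a' = (b - b') + (t / m.+1%:R) *: (p - q) +
    ((a - b - (t / m.+1%:R) *: p) - (a' - b' - (t / m.+1%:R) *: q)).
    rewrite scalerBr; move: (_ *: p) (_ *: q) => P Q.
    have S (x y z u : V) : (x - z) + (y - u) = (x + y) - (z + u) by rewrite opprD addrACA.
    by rewrite !S; congr (_ - _); rewrite addrC [X in _ + X]addrC addrA !subrK.
  apply: (le_trans (ler_normD _ _)); apply: lerD; last first.
    by apply: (le_trans (ler_normB _ _)); rewrite -mulrA mulr_natl mulr2n lerD.
  apply: (le_trans (ler_normD _ _)); rewrite mulrDl mul1r lerD2l normrZ ger0_norm//.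
  apply: (le_trans (ler_wpM2l tm h3)).
  by rewrite mulrA ler_wpM2r// mulrAC ler_wpM2r ?invr_ge0// ler_piMl// ltW.
apply: (le_trans (y := expR M * (2 * e'))).
  apply: ler_pM.
  - by rewrite exprn_ge0// addr_ge0// divr_ge0// ltW.
  - by rewrite mulr_ge0// mulr_ge0// mulr_ge0// ltW.
  - by apply: compound_le_expR => //; exact: ltW.
  - rewrite mulrCA [_ * (t / _)]mulrCA divff ?pnatr_eq0// mulr1 ler_piMr// mulr_ge0//.
    exact: ltW.
by rewrite /e' mulrCA mulrA [_ / _]mulrC mulVKf// ?mulf_neq0// gt_eqF// expR_gt0.
Qed.

Lemma ccvg_unique V W (D : set V) (G : nat -> V -> W) F F' :
  ccvg D G F -> ccvg D G F' -> forall y, D y -> F y = F' y.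
Proof.
move=> H H' y Dy; apply/eqP; rewrite -subr_eq0 -normr_le0.
apply/ler_addgt0Pr => e e0; rewrite add0r; have e2 : 0 < e / 2 by rewrite divr_gt0.
have /evtP[N [d d0 K]] := H y Dy _ e2; have /evtP[N' [d' d'0 K']] := H' y Dy _ e2.
have /= := K (maxn N N') y (leq_maxl _ _) _ Dy; rewrite subrr normr0 => /(_ d0) h.
have /= := K' (maxn N N') y (leq_maxr _ _) _ Dy; rewrite subrr normr0 => /(_ d'0) h'.
rewrite -(subrKA (G (maxn N N') y)) (le_trans (ler_normD _ _))// (splitr e) lerD ?ltW//.
by rewrite distrC.
Qed.

(** Induction over all spaces at once, since the tangent scheme on [V * V] is again of the same
    kind. The derivative of the limit is the fibre component of the limit of the tangent scheme. *)
Theorem flow_Ccvg r V (O D : set V) E F : proper V -> Ccvg r O E F ->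
  well_posed O D E F -> exists P, Ccvg r D (fun n => traj E n n.+1) P.
Proof.
elim: r V O D E F => [|r IH] V O D E F pV.
  by move=> CE /(well_posed_cvg CE)[P []]; exists P.
move=> [dE [dF [dEP CE]]] WP.
have [P CP] := IH _ _ _ _ _ (proper_prod pV pV) CE
  (well_posed_tangent pV dEP WP (Ccvg_ccvg CE)).
exists (fun y => (P (y, 0)).1); exists
  (fun n y v => (traj (tangent E dE) n n.+1 (y, v)).2), (fun y v => (P (y, v)).2); split.
  by move=> n y; exact: is_diff_traj.
apply: Ccvg_ext (CP) => [n [y v]|[y v] [/= Dy _]].
  by rewrite -(traj_tangent1 E dE n n.+1 (y, v)); case: (traj _ _ _ _).
have cP := ccvg_fst (Ccvg_ccvg CP).
rewrite [LHS]surjective_pairing; congr pair.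
(* A priori the base component of the tangent limit could depend on [v]; for every [v] it is the
   limit of the same polygons. *)
apply: (ccvg_unique (D := D) (G := fun n => traj E n n.+1)
  (F := fun y => (P (y, v)).1) (F' := fun y => (P (y, 0)).1)) => //;
  move=> z Dz e e0; [have := cP (z, v) (conj Dz I) e e0|have := cP (z, 0) (conj Dz I) e e0];
  move=> /evtP[N [d d0 K]]; apply/evtP; exists N, d => // n w Nn wz Dw.
  have := K n (w, v) Nn; rewrite traj_tangent1 /=; apply => //.
  by rewrite prod_normE /= subrr normr0 gt_max wz.
have := K n (w, 0) Nn; rewrite traj_tangent1 /=; apply => //.
by rewrite prod_normE /= subrr normr0 gt_max wz.
Qed.

End FlowConvergence.

(** * Closed balls and compact neighbourhoods *)

Section RowVectors.
Variables (R : realType) (d : nat).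
Implicit Types x : 'rV[R]_d.

Lemma norm_coord x i : `|x 0 i| <= `|x|.
Proof.
rewrite [leRHS]/Num.norm /= mx_normrE.
exact: (le_bigmax _ (fun k : 'I_1 * 'I_d => `|x k.1 k.2|) (0, i)).
Qed.

Lemma norm_le_coord x (a : R) : 0 <= a -> (forall i, `|x 0 i| <= a) -> `|x| <= a.
Proof.
move=> a0 H; rewrite [leLHS]/Num.norm /= mx_normrE; apply: bigmax_le => // -[k i] _ /=.
by rewrite ord1; exact: H.
Qed.

Lemma proper_rV : proper 'rV[R]_d.
Proof.
move=> r; apply: bounded_closed_compact.
  by exists r; split; [exact: num_real | move=> N MN x /= /le_trans; apply; exact: ltW].
rewrite (_ : [set x | _] = (fun x : 'rV[R]_d => `|x|) @^-1` [set a : R | a <= r])//.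
by apply: closed_comp; [move=> x _; exact: norm_continuous|exact: closed_le].
Qed.

Lemma proper_state : proper (R * 'rV[R]_d)%type.
Proof.
apply: proper_prod proper_rV => M.
have := @segment_compact R (- M) M; congr compact; apply/seteqP.
by split => x /=; rewrite in_itv /= ler_norml.
Qed.

End RowVectors.

Section Tube.
Variable R : realType.

Lemma compact_tube (V : normedModType R) (A O : set V) :
  proper V -> compact A -> open O -> A `<=` O ->
  exists2 rho : R, 0 < rho & exists C, [/\ compact C, C `<=` O &
    forall z a, A a -> `|z - a| <= rho -> C z].
Proof.
move=> pV cA oO AO; have /compact_near_coveringP H := cA.
have := H _ (0 : R)^'+ (fun r x => forall z, `|z - x| <= r -> O z) _.
case.
  move=> x Ax.
  have /nbhs_ballP[d /= d0 dO] := open_nbhs_nbhs (conj oO (AO _ Ax)).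
  have d2 : 0 < d / 2 by rewrite divr_gt0.
  exists (ball x (d / 2), [set r | r < d / 2]); first split => /=.
  - exact: nbhsx_ballx.
  - exact: nbhs_right_lt.
  move=> [x' r] /= [x'x rd] z zx'; apply: dO; move: x'x; rewrite -!ball_normE /= => x'x.
  rewrite -(subrKA x') (splitr d) (le_lt_trans (ler_normD _ _))// ltrD//.
  by rewrite distrC (le_lt_trans zx').
move=> e /= e0 He.
have e2 : 0 < e / 2 by rewrite divr_gt0.
exists (e / 2) => //.
exists ((fun w : V * V => w.1 + w.2) @` (A `*` [set x | `|x| <= e / 2])); split.
- apply: continuous_compact; last exact: compact_setX.
  apply: continuous_subspaceT => w; apply: cvgD; [exact: cvg_fst|exact: cvg_snd].
- move=> _ [[a b] [/= Aa be] <-]; apply: (He (e / 2)) Aa _ _ => //.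
    by rewrite /= sub0r normrN gtr0_norm// ltr_pdivrMr// ltr_pMr// ltr1n.
  by rewrite addrC addKr.
- by move=> z a Aa za; exists (a, z - a) => //=; rewrite addrC subrK.
Qed.

End Tube.

(** * The phase flow with time as a parameter *)

Section PhaseFlow.
Variable R : realType.

Lemma solves_on_nonnegP m (f : 'rV[R]_m -> 'rV[R]_m) g :
  solves_on_nonneg f g <->
  (forall h, 0 <= h -> forall e : R, 0 < e -> exists2 d : R, 0 < d &
     forall t, 0 <= h + t -> `|t| < d ->
       `|g (h + t) - g h - t *: f (g h)| <= e * `|t|).
Proof.
split=> H h h0.
  move=> e e0; have /cvgrPdist_le/(_ _ e0)/nbhs_ballP[d /= d0 dH] := H h h0.
  exists d => // t ht td; have [->|t0] := eqVneq t 0.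
    by rewrite addr0 subrr scale0r subrr !normr0 mulr0.
  have := dH t; rewrite -ball_normE /= sub0r normrN => /(_ td (conj t0 ht)).
  have -> : f (g h) - t^-1 *: (g (h + t) - g h) =
      - (t^-1 *: (g (h + t) - g h - t *: f (g h))).
    by rewrite [in RHS]scalerBr scalerA mulVf// scale1r opprB.
  by rewrite normrN normrZ normfV ler_pdivrMl ?normr_gt0// mulrC.
apply/cvgrPdist_le => e e0; have [d d0 dH] := H h h0 e e0.
apply/nbhs_ballP; exists d => //= t; rewrite -ball_normE /= sub0r normrN => td [t0 ht].
have -> : f (g h) - t^-1 *: (g (h + t) - g h) =
    - (t^-1 *: (g (h + t) - g h - t *: f (g h))).
  by rewrite [in RHS]scalerBr scalerA mulVf// scale1r opprB.
by rewrite normrN normrZ normfV ler_pdivrMl ?normr_gt0// mulrC; exact: dH.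
Qed.

Lemma solves_continuous m (f : 'rV[R]_m -> 'rV[R]_m) g : solves_on_nonneg f g ->
  continuous (fun s : R => g (Num.max 0 s)).
Proof.
move=> /solves_on_nonnegP H s; apply/cvgrPdist_lt => e e0.
have s0 : 0 <= Num.max 0 s by rewrite le_max lexx.
have [d d0 Hd] := H _ s0 1 ltr01.
pose M := 1 + `|f (g (Num.max 0 s))|.
have M0 : 0 < M by rewrite ltr_pwDl.
apply/nbhs_ballP; exists (Num.min d (e / M)) => /=; first by rewrite lt_min d0 divr_gt0.
move=> s' /=; rewrite lt_min => /andP[ss1 ss2].
have ss : `|Num.max 0 s' - Num.max 0 s| <= `|s - s'|.
  rewrite /Num.max; case: ltP => h1; case: ltP => h2.
  - by rewrite distrC.
  - by rewrite subr0 gtr0_norm// distrC ger0_norm; lra.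
  - by rewrite sub0r normrN gtr0_norm// ger0_norm; lra.
  - by rewrite subrr normr0.
have := Hd (Num.max 0 s' - Num.max 0 s).
rewrite addrC subrK le_max lexx => /(_ erefl (le_lt_trans ss ss1)).
rewrite mul1r => h; rewrite distrC.
rewrite -[X in `|X|](subrK ((Num.max 0 s' - Num.max 0 s) *: f (g (Num.max 0 s)))).
apply: (le_lt_trans (ler_normD _ _)); rewrite normrZ.
apply: (le_lt_trans (y := `|s - s'| * M)); last by rewrite -ltr_pdivlMr.
rewrite mulrDr mulr1 lerD//; first exact: le_trans ss.
by rewrite ler_wpM2r.
Qed.

(** A derivative vanishing uniformly in time forces constancy: the errors over a subdivision add up
    to at most [e / (t + 1) * t], below [e]. *)
Lemma usol_cst (V : normedModType R) (u : R -> V) (t0 : R) :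
  (forall e : R, 0 < e -> exists2 tau : R, 0 < tau & forall t t', 0 <= t -> t <= t' ->
    t' <= t0 -> t' - t <= tau -> `|u t' - u t| <= e * (t' - t)) ->
  forall t, 0 <= t -> t <= t0 -> u t = u 0.
Proof.
move=> H t t_ge0 tt0; apply/eqP; rewrite -subr_eq0 -normr_le0.
apply/ler_addgt0Pr => e e0; rewrite add0r.
have t1 : 0 < t + 1 by rewrite ltr_pwDr.
have [tau tau0 {}H] := H (e / (t + 1)) (divr_gt0 e0 t1).
pose m := Num.truncn (t / tau).
pose s k : R := t * (k%:R / m.+1%:R).
have sS k : s k.+1 - s k = t / m.+1%:R.
  by rewrite /s -mulrBr -mulrBl -natr1 addrAC subrr add0r mul1r.
have s0 k : 0 <= s k by rewrite mulr_ge0// divr_ge0.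
have s1 k : (k <= m.+1)%N -> s k <= t0.
  move=> km; apply: le_trans tt0; rewrite ler_piMr// ler_pdivrMr ?ltr0n// mul1r ler_nat//.
have sm : s m.+1 = t by rewrite /s divff ?mulr1// pnatr_eq0.
have tm : t / m.+1%:R <= tau.
  by rewrite ler_pdivrMr ?ltr0n// mulrC -ler_pdivrMr// ltW// truncnS_gt.
have ss k : s k <= s k.+1 by rewrite -subr_ge0 sS divr_ge0.
have step k : (k <= m.+1)%N -> `|u (s k) - u 0| <= e / (t + 1) * s k.
  elim: k => [|k IH] km.
    have -> : s 0%N = 0 by rewrite /s mul0r mulr0.
    by rewrite subrr normr0 mulr0.
  rewrite -(subrKA (u (s k))) (le_trans (ler_normD _ _))//.
  rewrite -[s k.+1](subrK (s k)) [in leRHS]mulrDr lerD ?IH ?(ltnW km)// subrK.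
  by apply: H => //; [exact: s1 | rewrite sS].
have := step m.+1 (leqnn _); rewrite sm => /le_trans; apply.
by rewrite mulrAC ler_pdivrMr// ler_pM2l// lerDl.
Qed.

End PhaseFlow.

Section ScaledFlow.
Variables (R : realType) (m : nat) (U : set 'rV[R]_m) (f : 'rV[R]_m -> 'rV[R]_m).
Variable Phi : R -> 'rV[R]_m -> 'rV[R]_m.
Hypothesis HPhi : phase_flow U f Phi.
Hypothesis oU : open U.
Hypothesis fc : forall x, U x -> forall e : R, 0 < e -> exists2 d : R, 0 < d &
  forall z, U z -> `|z - x| < d -> `|f z - f x| < e.

(* The time-one flow of [scaled] at [(h, x)] is [(h, Phi h x)]: time becomes a
   parameter, so that its derivatives are treated like those in [x]. *)
Definition scaled (z : R * 'rV[R]_m) : R * 'rV[R]_m := (0, z.1 *: f z.2).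

(** The first component is constant and the second solves the equation with speed [h]; rescaling
    time gives a solution of the original equation, but only up to [h * t1]. As uniqueness is
    assumed on the whole half-line, the path is continued by the flow from its end point. For [h] =
    0 it is constant. *)
Lemma usol_scaled (g : R -> R * 'rV[R]_m) (t0 M h : R) x :
  usol scaled t0 g -> (forall t, U (g t).2) -> (forall t, `|scaled (g t)| <= M) ->
  0 <= h -> g 0 = (h, x) ->
  forall t, 0 <= t -> t <= t0 -> g t = (h, Phi (h * t) x).
Proof.
move=> gs gU gM h0 g0.
have g1 t : 0 <= t -> t <= t0 -> (g t).1 = h.
  move=> t_ge0 tt0; transitivity (g 0).1; last by rewrite g0.
  apply: (usol_cst (t0 := t0) (u := fun t => (g t).1 : R)) => // e e0.
  have [tau tau0 H] := gs e e0; exists tau => // t1 t2 a b c d.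
  have := H t1 t2 a b c d; rewrite prod_normE ge_max /= => /andP[+ _].
  by rewrite scaler0 subr0.
pose xi t := (g t).2.
have xiP e : 0 < e -> exists2 tau : R, 0 < tau & forall t t', 0 <= t -> t <= t' ->
    t' <= t0 -> t' - t <= tau -> `|xi t' - xi t - (t' - t) *: (h *: f (xi t))| <= e * (t' - t).
  move=> e0; have [tau tau0 H] := gs e e0; exists tau => // t1 t2 a b c d.
  have := H t1 t2 a b c d; rewrite prod_normE ge_max /= => /andP[_].
  by rewrite g1// (le_trans b).
have xi0 : xi 0 = x by rewrite /xi g0.
have Ux : U x by rewrite -xi0; exact: gU.
suff xiPhi t1 : 0 <= t1 -> t1 <= t0 -> xi t1 = Phi (h * t1) x.
  by move=> t t_ge0 tt0; rewrite [LHS]surjective_pairing g1// -xiPhi.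
move=> t1_ge0 t1t0; have [Phi0 PhiU Phis uniq] := HPhi Ux.
move: h0; rewrite le_eqVlt => /predU1P[h0|h0].
  rewrite -h0 mul0r Phi0 -xi0.
  apply: (usol_cst (t0 := t0)) => // e e0; have [tau tau0 H] := xiP e e0.
  exists tau => // a b a0 ab bt ba; have := H a b a0 ab bt ba.
  by rewrite -h0 scale0r scaler0 subr0.
have Ut1 := gU t1; have [Q0 QU Qs _] := HPhi Ut1.
pose gam s := if s <= h * t1 then xi (s / h) else Phi (s - h * t1) (xi t1).
have gamr s : h * t1 <= s -> gam s = Phi (s - h * t1) (xi t1).
  rewrite /gam le_eqVlt => /predU1P[<-|sh]; last by rewrite leNgt sh.
  by rewrite lexx subrr Q0 mulrAC divff ?mul1r// gt_eqF.
have gaml s : s <= h * t1 -> gam s = xi (s / h) by rewrite /gam => ->.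
have hK : h * t1 / h = t1 by rewrite mulrAC divff ?mul1r// gt_eqF.
have divh s : s <= h * t1 -> s / h <= t1 by rewrite ler_pdivrMr// mulrC.
transitivity (gam (h * t1)); first by rewrite gaml// hK.
have ht1 : 0 <= h * t1 by rewrite mulr_ge0// ltW.
apply: uniq ht1; first by rewrite gaml ?mul0r// mulr_ge0// ltW.
  move=> s s0; have [sl|sr] := leP s (h * t1); first by rewrite gaml//; exact: gU.
  by rewrite gamr ?(ltW sr)//; apply: QU; rewrite subr_ge0 ltW.
(* [usol] evaluates the field at the left end of a time interval, while the derivative from the left
   at [t] involves its value at the right end; continuity of [f] along [xi], whose displacement is
   controlled by [M], bridges the gap. *)
have xid t (e : R) : 0 < e -> exists2 d : R, 0 < d & forall t', 0 <= t' -> t' <= t -> t <= t0 ->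
    t - t' < d -> `|f (xi t') - f (xi t)| < e.
  move=> e0; have [d d0 Hd] := fc (gU t) e0.
  have [tau tau0 H] := xiP 1 ltr01.
  have M0 : 0 < 1 + `|M| by rewrite ltr_pwDl.
  exists (Num.min tau (d / (1 + `|M|))); first by rewrite lt_min tau0 divr_gt0.
  move=> t' t'0 t't tt0; rewrite lt_min => /andP[ta tb].
  apply: Hd; first exact: gU.
  have tt' : 0 <= t - t' by rewrite subr_ge0.
  have := H t' t t'0 t't tt0 (ltW ta); rewrite mul1r => hh.
  rewrite distrC -[X in `|X|](subrK ((t - t') *: (h *: f (xi t')))).
  apply: (le_lt_trans (ler_normD _ _)).
  apply: (le_lt_trans (y := (t - t') * (1 + `|M|))); last by rewrite -ltr_pdivlMr.
  rewrite mulrDr mulr1 lerD// normrZ ger0_norm// ler_wpM2l//.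
  have := gM t'; rewrite prod_normE ge_max /= (g1 t')// ?(le_trans t't)// => /andP[_ hM].
  exact: (le_trans hM (ler_norm M)).
apply/solves_on_nonnegP => s s0 e e0.
have e2 : 0 < e / 2 by rewrite divr_gt0.
have he2 : 0 < e / 2 * h by rewrite mulr_gt0.
have [tau tau0 H] := xiP _ he2.
have ehK t : e / 2 * h * (t / h) = e / 2 * t by field; rewrite gt_eqF.
have htau : 0 < h * tau by rewrite mulr_gt0.
have sh0 : 0 <= s / h by rewrite divr_ge0// ltW.
have [sr|sl] := ltP (h * t1) s.
  have sr0 : 0 < s - h * t1 by rewrite subr_gt0.
  have [d d0 Hd] := (solves_on_nonnegP f _).1 Qs (s - h * t1) (ltW sr0) e e0.
  exists (Num.min d (s - h * t1)); first by rewrite lt_min d0.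
  move=> t st; rewrite lt_min => /andP[td]; rewrite ltr_norml => /andP[tl _].
  have hst : h * t1 <= s + t by lra.
  rewrite !gamr ?(ltW sr)//.
  by have := Hd t _ td; rewrite addrAC; apply; lra.
rewrite [gam s]gaml//.
have [d d0 Hd] := xid (s / h) _ e2.
have [d' d'0 Hr] : exists2 d : R, 0 < d & forall t, 0 < t -> t < d ->
   `|gam (s + t) - xi (s / h) - t *: f (xi (s / h))| <= e * t.
  move: sl; rewrite le_eqVlt => /predU1P[sE|sl].
    have [d' d'0 Hd'] := (solves_on_nonnegP f _).1 Qs 0 (lexx 0) e e0.
    exists d' => // t t_gt0 td'.
    have := Hd' t; rewrite add0r Q0 gtr0_norm// => /(_ (ltW t_gt0) td').
    by rewrite sE gamr ?lerDl ?(ltW t_gt0)// hK [_ + t]addrC addrK.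
  exists (Num.min (h * tau) (h * t1 - s)); first by rewrite lt_min htau subr_gt0.
  move=> t t_gt0; rewrite lt_min => /andP[ta tb].
  have st : s + t <= h * t1 by lra.
  rewrite gaml//.
  have := H (s / h) ((s + t) / h) sh0.
  have -> : (s + t) / h - s / h = t / h by rewrite -mulrBl addrAC subrr add0r.
  rewrite scalerA divfK ?gt_eqF// ler_pM2r ?invr_gt0// lerDl (ltW t_gt0).
  rewrite (le_trans (divh _ st))// ler_pdivrMr// [tau * h]mulrC (ltW ta).
  move=> /(_ erefl erefl erefl) /le_trans; apply.
  by rewrite ehK ler_wpM2r ?(ltW t_gt0)// ler_pdivrMr// ler_pMr// ler1n.
exists (Num.min d' (Num.min (h * d) (h * tau))).
  by rewrite !lt_min d'0 htau mulr_gt0.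
move=> t st; rewrite !lt_min => /and3P[ta tb tc].
have [t_lt0|t_gt0|->] := ltgtP t 0; last first.
- by rewrite addr0 gaml// subrr scale0r subrr !normr0 mulr0.
- by rewrite gtr0_norm// in ta *; exact: Hr.
- rewrite ltr0_norm// in ta tb tc *.
  have stl : s + t <= h * t1 by lra.
  rewrite gaml//.
  have st0 : 0 <= (s + t) / h by rewrite divr_ge0// ltW.
  have := H ((s + t) / h) (s / h) st0.
  have tE : s / h - (s + t) / h = (- t) / h by rewrite -mulrBl opprD addNKr.
  rewrite tE scalerA divfK ?gt_eqF// ler_pM2r ?invr_gt0// gerDl (ltW t_lt0).
  rewrite (le_trans (divh _ sl))// ler_pdivrMr// [tau * h]mulrC (ltW tc).
  move=> /(_ erefl erefl erefl) h1.
  have h2 : `|f (xi ((s + t) / h)) - f (xi (s / h))| < e / 2.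
    apply: Hd => //.
    - by rewrite ler_pM2r ?invr_gt0// gerDl ltW.
    - exact: (le_trans (divh _ sl)).
    - by rewrite tE ltr_pdivrMr// mulrC.
  have -> : xi ((s + t) / h) - xi (s / h) - t *: f (xi (s / h)) =
     - (xi (s / h) - xi ((s + t) / h) - (- t) *: f (xi ((s + t) / h))) +
     t *: (f (xi ((s + t) / h)) - f (xi (s / h))).
    rewrite scaleNr opprK scalerBr opprD opprB addrA; congr (_ - _).
    by rewrite subrK.
  apply: (le_trans (ler_normD _ _)); rewrite normrN normrZ ltr0_norm//.
  rewrite [e in leRHS]splitr [leRHS]mulrDl lerD//.
    by apply: (le_trans h1); rewrite ehK.
  by rewrite mulrC ler_wpM2r ?ltW// oppr_gt0.
Qed.

Let O : set (R * 'rV[R]_m) := setT `*` U.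
Let D : set (R * 'rV[R]_m) := [set y | 0 <= y.1 /\ U y.2].

(** Confinement is a first-exit argument: polygons that leave the tube around the exact orbit are
    stopped at the first index where they are more than [rho / 2] away. Along an ultrafilter they
    tend to a point of a solution, which by uniqueness lies on the exact orbit at the exit time,
    against the distance. *)
Lemma well_posed_scaled E : ccvg O E scaled -> well_posed O D E scaled.
Proof.
move=> CE [h x] [/= h0 Ux].
have oO : open O.
  rewrite (_ : O = snd @^-1` U); first by apply: open_comp => // z _; exact: cvg_snd.
  by apply/seteqP; split => z //= [].
split; last first.
  move=> C cC CO g g' gs gs' gC gC' g0 g0' t t0 t1.
  have [N [M M0 B]] := ccvg_bounded_compact CE cC CO.
  rewrite (usol_scaled (M := M) gs _ _ h0 g0) ?(usol_scaled (M := M) gs' _ _ h0 g0')//.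
  - by move=> u; have [] := CO _ (gC' u).
  - by move=> u; have [] := B N _ (leqnn _) (gC' u).
  - by move=> u; have [] := CO _ (gC u).
  - by move=> u; have [] := B N _ (leqnn _) (gC u).
have [Phi0 PhiU Phis uniq] := HPhi Ux.
pose ex (t : R) := (h, Phi (Num.max 0 (h * t)) x).
have exc : continuous ex.
  move=> t; have c1 : {for t, continuous (fun t : R => h * t)}.
    exact: (cvgM (cvg_cst h) cvg_id).
  have cP : {for h * t, continuous (fun s : R => Phi (Num.max 0 s) x)}.
    by have cP := solves_continuous Phis; exact: cP.
  have c2 := continuous_comp c1 cP.
  exact: (cvg_pair (cvg_cst h) c2).
pose A := ex @` `[0, 1]%classic.
have cA : compact A.
  by apply: continuous_compact; [exact: continuous_subspaceT|exact: segment_compact].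
have AO : A `<=` O.
  by move=> _ [t _ <-]; split => //=; apply: PhiU; rewrite le_max lexx.
have Aex t : 0 <= t -> t <= 1 -> A (ex t).
  by move=> t0 t1; exists t => //=; rewrite in_itv /= t0.
have [rho rho0 [C [cC CO CA]]] := compact_tube (@proper_state R m) cA oO AO.
exists C; split => //.
have [N0 [M M0 B]] := ccvg_bounded_compact CE cC CO.
have r2 : 0 < rho / 2 by rewrite divr_gt0.
pose bad (z : nat * (R * 'rV[R]_m)) i :=
  (i <= z.1.+1)%N && (rho / 2 < `|traj E z.1 i z.2 - ex (i%:R / z.1.+1%:R)|).
apply: contrapT => nH.
pose G := [set z : nat * (R * 'rV[R]_m) | exists i, bad z i].
have PG : ProperFilter (within G (filter_prod \oo (nbhs (h, x)))).
  split; last exact: within_filter.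
  rewrite /within /= => -[[A1 A2] /= [[N _ NA] A2n] A12].
  apply: nH; have [d /= d0 dA] := (nbhs_ballP _ _).1 A2n.
  apply/evtP; exists N, d => // n z Nn zd Dz i ni; apply: contrapT => nC.
  apply: (A12 (n, z)); first (split; first exact: NA).
    by apply: dA; rewrite -ball_normE /= distrC.
  exists i; rewrite /bad ni /= ltNge; apply/negP => le; apply: nC.
  apply: (CA _ (ex (i%:R / n.+1%:R))).
    by apply: Aex; rewrite ?divr_ge0// ler_pdivrMr ?ltr0n// mul1r ler_nat.
  by rewrite (le_trans le)// ler_pdivrMr// ler_pMr// ler1n.
have [F [FU FG]] := ultraFilterLemma PG.
have PF : ProperFilter F by exact: ultra_proper.
have FE P : evt (h, x) P -> F [set z | P z.1 z.2].
  by move=> HP; apply: FG; apply: filterS HP.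
have FB : F G by apply: FG; exact: withinT.
have /choice[K KP] z : exists K, G z -> bad z K /\ forall i, (i < K)%N -> ~~ bad z i.
  have [Gz|nG] := pselect (G z); last by exists 0%N.
  have [K bK Km] := ex_minnP Gz; exists K => _; split => // i iK.
  by apply: contraTN iK => /Km; rewrite leqNgt.
have Fy : (fun z => z.2) @ F --> (h, x).
  apply/cvgrPdist_lt => e e0; apply: (FE (fun _ z => `|(h, x) - z| < e)).
  by apply: evtS (evt_near (h, x) e0) => n z; rewrite distrC.
have Fnorm (e : R) : 0 < e -> F [set z | z.1.+1%:R^-1 < e].
  move=> e0; apply: filterS (FE _ (evt_ge (h, x) (Num.truncn e^-1))) => z /= hz.
  by rewrite invf_plt ?posrE ?ltr0n// (lt_le_trans (truncnS_gt _))// ler_nat.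
(* Half of the radius is reserved for the exit step: its length is at most [M / n.+1], below
   [rho / 2] for large [n], so the polygon is still in [C] at index [K z]. *)
have KC : F [set z | (K z <= z.1.+1)%N /\ forall i, (i <= K z)%N -> C (traj E z.1 i z.2)].
  have M2 : 0 < rho / 2 / M by rewrite divr_gt0.
  apply: filterS3 FB (filterI (FE _ (evt_near (h, x) r2)) (FE _ (evt_ge (h, x) N0)))
    (Fnorm _ M2) => z Gz [/= zn Nz] nz.
  have [/andP[Kn Kb] Kmin] := KP z Gz; split => // i.
  have ok j : (j < K z)%N -> `|traj E z.1 j z.2 - ex (j%:R / z.1.+1%:R)| <= rho / 2.
    move=> jK; have := Kmin j jK; rewrite /bad (leq_trans (ltnW jK) Kn) /=.
    by rewrite -leNgt.
  have exA j : (j <= K z)%N -> A (ex (j%:R / z.1.+1%:R)).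
    move=> jK; apply: Aex; rewrite ?divr_ge0// ler_pdivrMr ?ltr0n// mul1r ler_nat.
    exact: leq_trans Kn.
  have rr : rho / 2 <= rho by rewrite ler_pdivrMr// ler_pMr// ler1n.
  rewrite leq_eqVlt => /predU1P[->|iK]; last first.
    by apply: (CA _ _ (exA i (ltnW iK))); rewrite (le_trans (ok i iK)).
  case E0 : (K z) Kb exA ok => [|k] Kb exA ok.
    move: Kb; rewrite mul0r /ex mulr0 /Num.max ltxx Phi0 /= => /lt_trans/(_ zn).
    by rewrite ltxx.
  have Ck : C (traj E z.1 k z.2).
    by apply: (CA _ _ (exA k (leqnSn k))); rewrite (le_trans (ok k _)).
  apply: (CA _ _ (exA k (leqnSn k))).
  rewrite /traj iterS /euler -/(traj E z.1 k z.2) addrAC (le_trans (ler_normD _ _))//.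
  rewrite (splitr rho) lerD ?ok// normrZ normfV normr_nat mulrC -ler_pdivlMr ?invr_gt0 ?ltr0n//.
  have [EM _] := B z.1 _ Nz Ck; rewrite (le_trans EM)// invrK.
  rewrite -ler_pdivrMr ?ltr0n// mulrC -ler_pdivlMr// ltW//.
have [t0 t01 Kt] : exists2 t0 : R, `[0, 1]%classic t0 &
    (fun z => (K z)%:R / z.1.+1%:R : R) @ F --> t0.
  apply: (ultra_compact_cvg FU (@segment_compact R 0 1)).
  apply: filterS KC => z [Kn _] /=; rewrite in_itv /= divr_ge0//=.
  by rewrite ler_pdivrMr ?ltr0n// mul1r ler_nat.
move: t01; rewrite /= in_itv /= => /andP[t00 t01].
have [g [g0 gC gs gl]] := traj_ultralimit CE cC CO FU
  (fun N => FE _ (evt_ge (h, x) N)) Fy t00 KC Kt.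
have gt : g t0 = ex t0.
  rewrite (usol_scaled (M := M) gs _ _ h0 g0)//.
  - by rewrite /ex max_r// mulr_ge0.
  - by move=> u; have [] := CO _ (gC u).
  - by move=> u; have [] := B N0 _ (leqnn _) (gC u).
have exl : (fun z => ex ((K z)%:R / z.1.+1%:R)) @ F --> ex t0.
  exact: (cvg_comp _ _ Kt (exc t0)).
have dl : (fun z => traj E z.1 (K z) z.2 - ex ((K z)%:R / z.1.+1%:R)) @ F --> (0 : R * 'rV[R]_m).
  by rewrite -(subrr (g t0)) {2}gt; exact: cvgB.
move/cvgrPdist_lt: dl => /(_ _ r2) dl.
have [z [Gz]] := filter_ex (filterI FB dl).
rewrite /= sub0r normrN => zl; have [/andP[_]] := KP z Gz.
by rewrite ltNge (ltW zl).
Qed.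

Lemma scaled_limit E P : ccvg O E scaled -> ccvg D (fun n => traj E n n.+1) P ->
  forall y, D y -> P y = (y.1, Phi y.1 y.2).
Proof.
move=> CE CP y Dy.
have [P' [CP' P'P]] := well_posed_cvg CE (well_posed_scaled CE).
rewrite (ccvg_unique CP CP' Dy).
have [C [g [cC CO gs [gC g0 <-]]]] := P'P _ Dy.
have [N [M M0 B]] := ccvg_bounded_compact CE cC CO.
have [h0 _] := Dy; rewrite [y]surjective_pairing in g0.
rewrite (usol_scaled (M := M) gs _ _ h0 g0) ?mulr1//.
- by move=> u; have [] := CO _ (gC u).
- by move=> u; have [] := B N _ (leqnn _) (gC u).
Qed.

End ScaledFlow.

(** * The norm of C^r *)

Section NormConvergence.
Variables (R : realType) (n : nat) (U : set 'rV[R]_n).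
Hypothesis oU : open U.
Let V : normedModType R := (R * 'rV[R]_n)%type.
Let D : set V := [set y : R * 'rV[R]_n | 0 <= y.1 /\ U y.2].

Definition dir (j : option 'I_n) : R * 'rV[R]_n :=
  if j is Some k then (0, ej R k) else (1, 0).

Lemma shiftE j t y : Defs.shift j t y = y + t *: dir j :> R * 'rV[R]_n.
Proof.
case: j y => [k|] [y1 y2]; rewrite /Defs.shift /dir /=.
  by apply: injective_projections => //=; rewrite /GRing.scale /= mulr0 addr0.
apply: injective_projections => /=; first by rewrite /GRing.scale /= mulr1.
by rewrite scaler0 addr0.
Qed.

(** At [h] = 0 time increments are one-sided. Forward shifts stay in [D], which makes the filter of
    difference quotients proper; the segment to an admissible shift stays in [D], as the mean value
    argument demands. *)
Lemma domain_segment j y : D y -> exists2 d : R, 0 < d &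
  (forall t, 0 < t -> t < d -> D (Defs.shift j t y)) /\
  (forall t, `|t| < d -> D (Defs.shift j t y) -> forall s, Num.min 0 t <= s <= Num.max 0 t ->
     D (Defs.shift j s y)).
Proof.
case: y => y1 y2 [/= y10 Uy2]; case: j => [k|] /=; last first.
  exists 1 => //; split=> [t t0 _|t _ [/= yt _] s]; first by rewrite /D /= addr_ge0// ltW.
  rewrite /D /= ge_min le_max => /andP[/orP[s0 _|ts _]]; split => //; lra.
have /nbhs_ballP[d /= d0 dU] := open_nbhs_nbhs (conj oU Uy2).
have e0 : 0 < 1 + `|ej R k| by rewrite ltr_pwDl.
have small t : `|t| < d / (1 + `|ej R k|) -> U (y2 + t *: ej R k).
  move=> td; apply: dU; rewrite -ball_normE /= opprD addNKr normrN normrZ.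
  by move: td; rewrite ltr_pdivlMr//; apply: le_lt_trans; rewrite ler_wpM2l// lerDr.
exists (d / (1 + `|ej R k|)); first by rewrite divr_gt0.
split=> [t t0 td|t td _ s st]; split => //=; apply: small; first by rewrite gtr0_norm.
apply: le_lt_trans td; move: st; rewrite /Num.min /Num.max; case: ltP => t0 /andP[a b].
  by rewrite ger0_norm// gtr0_norm.
by rewrite ler0_norm// ler0_norm// lerN2.
Qed.

Lemma pd_lim j (g : V -> R) y l : D y ->
  (forall e : R, 0 < e -> exists2 d : R, 0 < d & forall t, `|t| < d -> D (Defs.shift j t y) ->
     `|g (Defs.shift j t y) - g y - t * l| <= e * `|t|) ->
  pd D j g y = l.
Proof.
move=> Dy H; rewrite /pd; have [d0 d00 [Hpos _]] := domain_segment j Dy.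
have PF : ProperFilter (within [set t : R | t != 0 /\ D (Defs.shift j t y)] (nbhs (0 : R))).
  split; last exact: within_filter.
  rewrite /within /= => /nbhs_ballP[d /= dgt0 dA].
  pose t := Num.min d d0 / 2.
  have m0 : 0 < Num.min d d0 by rewrite lt_min dgt0.
  have t0 : 0 < t by rewrite divr_gt0.
  have tm : t < Num.min d d0 by rewrite ltr_pdivrMr// ltr_pMr// ltr1n.
  move: tm; rewrite lt_min => /andP[t1 t2].
  apply: (dA t); first by rewrite -ball_normE /= sub0r normrN gtr0_norm.
  by split; [rewrite gt_eqF | exact: Hpos].
apply: cvg_lim => //; apply/cvgrPdist_le => e e0; have [d dgt0 dH] := H e e0.
apply/nbhs_ballP; exists d => //= t; rewrite -ball_normE /= sub0r normrN => td [t0 Dt].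
have -> : l - t^-1 * (g (Defs.shift j t y) - g y) = - (t^-1 * (g (Defs.shift j t y) - g y - t * l)).
  by field.
by rewrite normrN normrM normfV ler_pdivrMl ?normr_gt0// [leRHS]mulrC; exact: dH.
Qed.

Lemma pd_ext j (g g' : V -> R) : (forall y, D y -> g y = g' y) ->
  forall y, D y -> pd D j g y = pd D j g' y.
Proof.
move=> gg' y Dy; rewrite /pd; congr (lim _).
have sub (h h' : V -> R) : (forall y, D y -> h y = h' y) ->
    (fun t : R => t^-1 * (h (Defs.shift j t y) - h y))
      @ within [set t : R | t != 0 /\ D (Defs.shift j t y)] (nbhs (0 : R)) `<=`
    (fun t : R => t^-1 * (h' (Defs.shift j t y) - h' y))
      @ within [set t : R | t != 0 /\ D (Defs.shift j t y)] (nbhs (0 : R)).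
  move=> hh' X; apply: (@filterS _ (nbhs (0 : R))) => t Xt [t0 Dt].
  by have := Xt (conj t0 Dt); rewrite /= !hh'.
by apply/seteqP; split; apply: sub => // z Dz; rewrite gg'.
Qed.

Lemma foldr_pd_ext js (g g' : V -> R) : (forall y, D y -> g y = g' y) ->
  forall y, D y -> foldr (pd D) g js y = foldr (pd D) g' js y.
Proof. by move=> gg'; elim: js => //= j js IH; apply: pd_ext. Qed.

Lemma mean_value_dir (g : V -> R) (dg : V -> V -> R) y v t :
  (forall z, is_diff z g (dg z)) ->
  exists2 s, Num.min 0 t <= s <= Num.max 0 t & g (y + t *: v) - g y = t * dg (y + s *: v) v.
Proof.
move=> gd; pose phi (s : R) := g (y + s *: v).
have phid (s : R) : is_derive s (1 : R) phi (dg (y + s *: v) v).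
  have ld : is_diff s (fun s : R => y + s *: v) (fun s : R => s *: v).
    have := is_diffD (is_diff_cst y s) (is_diff_scalel s v).
    by congr is_diff_def; apply/funext => u /=; rewrite ?add0r.
  have cd := is_diff_comp ld (gd (y + s *: v)).
  have dphi : differentiable phi s by exact: (@ex_diff _ _ _ _ _ _ _ cd).
  have dv : derivable phi s (1 : R) by exact: diff_derivable.
  have := derivableP dv; rewrite deriveE//.
  by rewrite (@diff_val _ _ _ _ _ _ _ cd) /= scale1r.
have phic : continuous phi.
  by move=> s; apply: differentiable_continuous; apply/derivable1_diffP; apply: ex_derive.
have [t0|t0] := leP 0 t.
  have [s] := MVT_segment t0 (fun s _ => phid s) (continuous_subspaceT phic).
  rewrite in_itv /= subr0 /phi scale0r addr0 mulrC => st E; exists s => //.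
have [s] := MVT_segment (ltW t0) (fun s _ => phid s) (continuous_subspaceT phic).
rewrite in_itv /= sub0r /phi scale0r addr0 mulrN mulrC => st E; exists s => //.
by apply: oppr_inj; rewrite -E opprB.
Qed.

(** [F] is differentiated through its approximants: the mean value formula for [G p] has its
    intermediate point in [D], near [y], where [dG p] in the direction [dir j] is close to
    [dF y (dir j)] for large [p]. *)
Lemma pd_ccvg j (G : nat -> V -> R) dG (F : V -> R) dF k y :
  (forall n y, is_diff y (G n) (dG n y)) -> ccvg D G F ->
  ccvg (D `*` setT) (fun n z => dG n z.1 z.2) (fun z => dF z.1 z.2) -> D y ->
  pd D j (fun y => F y - G k y) y = dF y (dir j) - dG k y (dir j).
Proof.
move=> Gd CG CdG Dy; apply: pd_lim => // e e0.
have e2 : 0 < e / 2 by rewrite divr_gt0.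
pose v := dir j.
have v1 : 0 < 1 + `|v| by rewrite ltr_pwDl.
have [d d0 [_ dseg]] := domain_segment j Dy.
have [d1 d10 H1] : exists2 d : R, 0 < d & forall t, `|t| < d -> D (Defs.shift j t y) ->
    `|F (Defs.shift j t y) - F y - t * dF y v| <= e / 2 * `|t|.
  have /evtP[N [d1 d10 K]] := CdG (y, v) (conj Dy I) _ e2.
  exists (Num.min d (d1 / (1 + `|v|))); first by rewrite lt_min d0 divr_gt0.
  (* The radius must not depend on the approximant: [p] is chosen after [t], and the slack [u]
     absorbs the convergence at the two end points. *)
  move=> t; rewrite lt_min => /andP[td td1] Dt; apply/ler_addgt0Pr => u u0.
  have u2 : 0 < u / 2 by rewrite divr_gt0.
  have /evtP[N1 [? r1 K1]] := CG _ Dt _ u2.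
  have /evtP[N2 [? r2 K2]] := CG _ Dy _ u2.
  pose p := maxn N (maxn N1 N2).
  have := K1 p (Defs.shift j t y); rewrite subrr normr0 /p !leq_max leqnn !orbT -/p.
  move=> /(_ erefl r1 Dt) h1.
  have := K2 p y; rewrite subrr normr0 /p !leq_max leqnn !orbT -/p.
  move=> /(_ erefl r2 Dy) h2.
  have [s st E] := mean_value_dir y v t (Gd p).
  have st' : `|s| <= `|t|.
    move: st; rewrite /Num.min /Num.max; case: ltP => t0 /andP[a b].
      by rewrite ger0_norm// gtr0_norm.
    by rewrite ler0_norm// ler0_norm// lerN2.
  have h3 : `|dG p (y + s *: v) v - dF y v| < e / 2.
    apply: (K p (y + s *: v, v)) => /=; first by rewrite /p leq_max leqnn.
      rewrite prod_normE /= subrr normr0 gt_max d10 andbT addrC addKr normrZ.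
      apply: le_lt_trans (ler_wpM2r (normr_ge0 _) st') _.
      by move: td1; rewrite ltr_pdivlMr//; apply: le_lt_trans; rewrite ler_wpM2l// lerDr.
    by split => //=; rewrite -shiftE; exact: (dseg t td Dt).
  have -> : F (Defs.shift j t y) - F y - t * dF y v =
     t * (dG p (y + s *: v) v - dF y v) +
     ((G p y - F y) - (G p (Defs.shift j t y) - F (Defs.shift j t y))).
    by rewrite mulrBr -E shiftE; ring.
  apply: (le_trans (ler_normD _ _)); rewrite lerD//.
    by rewrite normrM mulrC ler_wpM2r// ltW.
  by rewrite (splitr u) (le_trans (ler_normB _ _))// lerD// ltW.
have [d2 d20 H2] : exists2 d : R, 0 < d & forall t, `|t| < d ->
    `|G k (y + t *: v) - G k y - t * dG k y v| <= e / 2 * `|t|.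
  have gd := Gd k y.
  have dg : differentiable (G k) y by exact: (@ex_diff _ _ _ _ _ _ _ gd).
  have dgv : derivable (G k) y v by exact: diff_derivable.
  have := derivableP dgv; rewrite deriveE//.
  rewrite (@diff_val _ _ _ _ _ _ _ gd) => -[dv dE].
  have : (fun h : R => h^-1 *: ((G k \o shift y) (h *: v) - G k y)) @ (0 : R)^' --> dG k y v.
    by rewrite -dE; exact: dv.
  move=> /cvgrPdist_le/(_ _ e2)/nbhs_ballP[d2 /= d20 H2]; exists d2 => // t td.
  have [->|t0] := eqVneq t 0.
    by rewrite scale0r addr0 subrr mul0r subrr normr0 mulr0.
  have := H2 t; rewrite -ball_normE /= sub0r normrN => /(_ td t0).
  rewrite /GRing.scale /= [y + _]addrC.
  have -> : dG k y v - t^-1 * (G k (t *: v + y) - G k y) =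
     - (t^-1 * (G k (t *: v + y) - G k y - t * dG k y v)) by field.
  by rewrite normrN normrM normfV ler_pdivrMl ?normr_gt0// [leRHS]mulrC.
exists (Num.min d1 d2); first by rewrite lt_min d10.
move=> t; rewrite lt_min => /andP[td1 td2] Dt.
have := H2 t td2; rewrite -shiftE => h2; have h1 := H1 t td1 Dt.
have -> : F (Defs.shift j t y) - G k (Defs.shift j t y) - (F y - G k y) - t * (dF y (dir j) - dG k y (dir j))
  = (F (Defs.shift j t y) - F y - t * dF y v) -
    (G k (Defs.shift j t y) - G k y - t * dG k y v) by rewrite /v; ring.
by rewrite (le_trans (ler_normB _ _))// [e in leRHS]splitr [leRHS]mulrDl lerD.
Qed.

(** The innermost derivative is taken first: fixing the direction [dir j] in the tangent convergence
    gives convergence of the derivatives in one order less. *)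
Lemma Ccvg_pd r js (G : nat -> V -> R) F : (size js <= r)%N -> Ccvg r D G F ->
  exists G' F', ccvg D G' F' /\ forall k y, D y ->
    foldr (pd D) (fun y => F y - G k y) js y = F' y - G' k y.
Proof.
elim/last_ind: js r G F => [|js j IH] r G F.
  by move=> _ /Ccvg_ccvg CG; exists G, F.
case: r => [|r]; rewrite size_rcons// ltnS => jr [dG [dF [Gd CG]]].
have Cj : Ccvg r D (fun k y => dG k y (dir j)) (fun y => dF y (dir j)).
  apply: (Ccvg_comp (D' := D `*` setT) (B := fun _ y => (y, dir j))
    (C := fun y => (y, dir j)) (G := fun k z => dG k z.1 z.2) (F := fun z => dF z.1 z.2)).
  - move=> y Dy; split; first by [].
    by apply/evtP; exists 0%N, 1.
  - exact: (Ccvg_snd CG).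
  - apply: Ccvg_pair; last by apply: Ccvg_cst; exact: cvg_cst.
    by apply: (@Ccvg_lin _ r _ _ D id) => // z; exact: cvg_id.
have [G' [F' [CG' E]]] := IH r _ _ jr Cj.
exists G', F'; split => // k y Dy; rewrite -E// foldr_rcons.
apply: foldr_pd_ext => // z Dz; apply: pd_ccvg => //.
- exact: (@Ccvg_ccvg _ r.+1 _ _ D G F (ex_intro _ dG (ex_intro _ dF (conj Gd CG)))).
- exact: (ccvg_snd (Ccvg_ccvg CG)).
Qed.

Lemma CrNorm_cvg m r (T : R) (W : set 'rV[R]_n)
    (G : nat -> R * 'rV[R]_n -> 'rV[R]_m) (F : R * 'rV[R]_n -> 'rV[R]_m) :
  compact W -> W `<=` U -> @Ccvg R r V _ D G F -> forall e : R, 0 < e ->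
  exists k, CrNorm r D T W (fun h x => F (h, x) - G k (h, x)) < e.
Proof.
move=> cW WU CG e e0.
pose C : set V := [set y : R * 'rV[R]_n | 0 <= y.1 <= T /\ W y.2].
have cC : compact C.
  rewrite (_ : C = `[0, T]%classic `*` W).
    by apply: compact_setX => //; exact: segment_compact.
  by apply/seteqP; split => y; rewrite /C /= in_itv.
have CD : C `<=` D by move=> y [/andP[? _] /WU].
pose I := {ffun option 'I_n -> 'I_r.+1}.
(* One share per multi-index; the successor makes the total strictly less than [e]. *)
pose M := #|{: I}|.+1%:R : R.
have M0 : 0 < M by rewrite ltr0n.
have eM : 0 < e / M by rewrite divr_gt0.
have H (a : I) (i : 'I_m) : exists N : nat, forall k, (N <= k)%N ->
    (\sum_(j : option 'I_n) (a j : nat) <= r)%N -> forall y, C y ->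
    `|Dalpha D a (fun y => (F (y.1, y.2) - G k (y.1, y.2)) 0 i) y| < e / M.
  have [ar|] := leqP (\sum_(j : option 'I_n) (a j : nat)) r; last by exists 0%N.
  pose js := flatten [seq nseq (a j) j | j <- enum {: option 'I_n}].
  have jsr : (size js <= r)%N.
    rewrite size_flatten /shape -map_comp sumnE big_map big_enum /=.
    by rewrite (leq_trans _ ar)// leq_sum// => j _; rewrite size_nseq.
  have DE g : Dalpha D a g = foldr (pd D) g js.
    rewrite /Dalpha /js; elim: (enum _) => //= j l ->; rewrite foldr_cat.
    by elim: (nat_of_ord (a j)) => //= k ->.
  have Ci : Ccvg r D (fun k y => G k y 0 i) (fun y => F y 0 i).
    apply: (Ccvg_lincomp (f := fun x : 'rV[R]_m => x 0 i)) CG.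
      by move=> c x z; rewrite !mxE.
    exact: coord_continuous.
  have [G' [F' [CG' E]]] := Ccvg_pd jsr Ci.
  have [N [d d0 K]] := ccvg_unif_compact CG' cC CD eM.
  exists N => k Nk _ y Cy; rewrite DE.
  rewrite (@foldr_pd_ext js _ (fun y => F y 0 i - G k y 0 i) _ y (CD _ Cy)).
    rewrite (E k y (CD _ Cy)) distrC; apply: (K k y y Nk Cy Cy).
    by rewrite subrr normr0.
  by move=> [z1 z2] _ /=; rewrite !mxE.
have /choice[N HN] (a : I) : exists N : nat, forall i k, (N <= k)%N ->
    (\sum_(j : option 'I_n) (a j : nat) <= r)%N -> forall y, C y ->
    `|Dalpha D a (fun y => (F (y.1, y.2) - G k (y.1, y.2)) 0 i) y| < e / M.
  have /choice[N HN] := H a; exists (\max_i N i) => i k Nk.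
  by apply: HN; apply: leq_trans Nk; exact: leq_bigmax.
exists (\max_a N a); rewrite /CrNorm.
set S := \sum_(_ | _) _.
have SM : S <= \sum_(a : I) e / M.
  rewrite /S [leRHS](bigID (fun a : I => (\sum_(j : option 'I_n) (a j : nat) <= r)%N)) /=.
  rewrite ler_wpDr//; first by apply: sumr_ge0 => *; exact: ltW.
  apply: ler_sum => a ar.
  elim/big_ind: _ => [|x y xe ye|i _]; first exact: ltW.
    by rewrite ge_max xe.
  set A := [set _ | _ in _].
  (* [sup] of the empty set is 0, which settles the case where [C] has no point. *)
  have [->|/set0P A0] := eqVneq A set0; first by rewrite sup0 ltW.
  apply: ge_sup => // _ [y Cy <-]; apply: ltW; apply: HN => //.
  exact: leq_bigmax.
apply: (le_lt_trans SM); rewrite sumr_const -[X in X < _]mulr_natl mulrCA gtr_pMr//.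
by rewrite ltr_pdivrMr// mul1r ltr_nat.
Qed.

End NormConvergence.

(** * Ridge functions as networks *)

Section Layers.
Variables (R : realType) (d : nat) (sigma : R -> R).
Implicit Types (w x p q u t : 'rV[R]_d).

Definition dot w x : R := (w *m x^T) 0 0.

Lemma dotE w x : dot w x = \sum_k w 0 k * x 0 k.
Proof. by rewrite /dot mxE; apply: eq_bigr => k _; rewrite mxE. Qed.

(** Gradient of the sum of the ridge functions [c.1.1 * S (dot c.1.2 x + c.2)], where [S] is an
    antiderivative of [sigma]. *)
Definition ridge (L : seq (R * 'rV[R]_d * R)) x : 'rV[R]_d :=
  \sum_(c <- L) (c.1.1 * sigma (dot c.1.2 x + c.2)) *: c.1.2.

(* A symmetric matrix mapping [u != 0] to [t]: symmetry is all that the shears of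
   a linear module are constrained by, so they can turn a basis vector into [w]. *)
Definition sym_to u t : 'M[R]_d :=
  (dot u u)^-1 *: (u^T *m t + t^T *m u) - (dot u t / (dot u u) ^+ 2) *: (u^T *m u).

Lemma dot_mul u t p : u *m t^T *m p = dot u t *: p.
Proof. by rewrite [u *m t^T]mx11_scalar mul_scalar_mx. Qed.

Lemma dot_gt0 u : u != 0 -> 0 < dot u u.
Proof.
move=> u0; rewrite dotE lt_def sumr_ge0 ?andbT; last by move=> *; rewrite -expr2 sqr_ge0.
apply: contra u0 => /eqP s0; apply/eqP/rowP => k; rewrite mxE; apply/eqP.
have := psumr_eq0P (F := fun k => u 0 k * u 0 k) _ s0 => H.
by rewrite -sqrf_eq0 expr2 H// => *; rewrite -expr2 sqr_ge0.
Qed.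

Lemma sym_toT u t : (sym_to u t)^T = sym_to u t.
Proof.
rewrite /sym_to linearB /= !linearZ /= linearD /= !trmx_mul !trmxK.
by rewrite [t^T *m u + _]addrC.
Qed.

Lemma mul_sym_to u t : u != 0 -> u *m sym_to u t = t.
Proof.
move=> /dot_gt0 u0; rewrite /sym_to mulmxBr -!scalemxAr mulmxDr !mulmxA !dot_mul.
rewrite scalerDr !scalerA mulVf ?gt_eqF// scale1r.
have -> : dot u t / dot u u ^+ 2 * dot u u = (dot u u)^-1 * dot u t.
  by field; rewrite gt_eqF.
by rewrite addrK.
Qed.

Lemma Mmod_odd j S p q : odd j -> S^T = S -> Mmod j S (row_mx p q) = row_mx (p + q *m S) q.
Proof. by move=> jo ST; rewrite /Mmod jo row_mxKl row_mxKr trmx_mul trmxK ST. Qed.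

Lemma Mmod_even j S p q : ~~ odd j -> S^T = S ->
  Mmod j S (row_mx p q) = row_mx p (q + p *m S).
Proof.
by move=> /negbTE jo ST; rewrite /Mmod jo row_mxKl row_mxKr trmx_mul trmxK ST addrC.
Qed.

Lemma sigma_ab_delta i a b x :
  sigma_ab sigma (a *: delta_mx 0 i) (const_mx b) x = (a * sigma (x 0 i + b)) *: delta_mx 0 i.
Proof.
apply/rowP => k; rewrite !mxE eqxx /=; case: eqVneq => [->|_]; first by rewrite !mulr1.
by rewrite !mulr0 mul0r.
Qed.

Lemma dot_delta i x : dot x (delta_mx 0 i) = x 0 i.
Proof.
rewrite dotE (bigD1 i)//= mxE !eqxx mulr1 big1 ?addr0// => k ki.
by rewrite mxE (negbTE ki) andbF mulr0.
Qed.

Lemma dotC u t : dot u t = dot t u.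
Proof. by rewrite !dotE; apply: eq_bigr => k _; rewrite mulrC. Qed.

Lemma dot_sym S u t : S^T = S -> dot (u *m S) t = dot u (t *m S).
Proof. by move=> ST; rewrite /dot trmx_mul ST mulmxA. Qed.

Lemma dotDl u t p : dot (u + t) p = dot u p + dot t p.
Proof. by rewrite /dot mulmxDl mxE. Qed.

Lemma dotBl u t p : dot (u - t) p = dot u p - dot t p.
Proof. by rewrite /dot mulmxBl !mxE. Qed.

Lemma dotBr u t p : dot p (u - t) = dot p u - dot p t.
Proof. by rewrite !(dotC p) dotBl. Qed.

(** The activation is a shear along [e] driven by the [i]-th coordinate. The linear module is chosen
    so that this coordinate reads [dot w q] (or [dot w p]), and its inverse returns an increment
    along [e] as one along [w]. *)
Lemma ridge_layer (up : bool) a w b : exists l : tla_layer R d, valid_lin l.1.1.1 /\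
  forall h p q, layer_apply sigma l h (row_mx p q) =
    if up then row_mx (p + h *: ((a * sigma (dot w q + b)) *: w)) q
    else row_mx p (q + h *: ((a * sigma (dot w p + b)) *: w)).
Proof.
have T0 : (0 : 'M[R]_d)^T = 0 by rewrite trmx0.
have TN (S : 'M[R]_d) : S^T = S -> (- S)^T = - S by move=> ST; rewrite linearN /= ST.
(* [sym_to] needs a nonzero source; for [w] = 0 the required map is the identity, given by zero
   amplitude. *)
have [->|w0] := eqVneq w 0.
  exists ([:: 0], up, 0, 0); split.
    by split => // S; rewrite inE => /eqP ->.
  move=> h p q; rewrite /layer_apply /lin_module /lin_module_inv /=.
  have sab0 y : sigma_ab sigma (0 : 'rV[R]_d) 0 y = 0.
    by apply/rowP => k; rewrite !mxE mul0r.
  rewrite Mmod_odd// mulmx0 addr0 /act_module row_mxKl row_mxKr !sab0 !scaler0 !addr0.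
  by case: up; rewrite Mmod_odd ?TN// oppr0 mulmx0 addr0.
have [i wi] : exists i, w 0 i != 0.
  apply/existsP; apply: contraR w0; rewrite negb_exists => /forallP H.
  by apply/eqP/rowP => k; rewrite mxE; apply/eqP; rewrite -[_ == _]negbK.
pose e : 'rV[R]_d := delta_mx 0 i.
have e0 : e != 0.
  by apply/eqP => /rowP/(_ i); rewrite !mxE !eqxx => /eqP; rewrite oner_eq0.
(* In the upper case, reading the coordinate through [A] gives [dot w P] plus a stray [dot e q1]. As
   [B] maps [w] to [w - e], [dot w P] equals [dot w p + dot (w - e) q1], and the total is
   [dot w q]. *)
pose A := sym_to e w; pose B := sym_to w (w - e).
have AT : A^T = A by exact: sym_toT.
have BT : B^T = B by exact: sym_toT.
have eA : e *m A = w by exact: mul_sym_to.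
have wB : w *m B = w - e by exact: mul_sym_to.
have IT : (- 1%:M : 'M[R]_d)^T = - 1%:M by rewrite TN// trmx1.
case: up.
  (* The leading zero matrix shifts the parity, so that the first effective shear is a lower one. *)
  exists ([:: 0; - 1%:M; B; A], true, a *: e, const_mx b); split.
    by split => // S; rewrite !inE => /or4P[] /eqP ->.
  move=> h p q; pose q1 := q - p; pose P := p + q1 *m B; pose Q := q1 + P *m A.
  have E : lin_module [:: 0; - 1%:M; B; A] (row_mx p q) = row_mx P Q.
    rewrite /lin_module /= (@Mmod_odd 1)// mulmx0 addr0.
    rewrite (@Mmod_even 2)// (@Mmod_odd 3)// (@Mmod_even 4)//.
    by rewrite mulmxN mulmx1.
  rewrite /layer_apply E /act_module row_mxKl row_mxKr sigma_ab_delta.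
  have -> : Q 0 i = dot w q.
    rewrite -dot_delta /Q dotDl dot_sym// eA /P dotDl dot_sym// wB dotBr -/e.
    by rewrite /q1 !dotBl (dotC w); ring.
  set c := a * _; rewrite /lin_module_inv /=.
  rewrite (@Mmod_even 4) ?TN// (@Mmod_odd 3) ?TN// (@Mmod_even 2) ?TN ?trmx1//.
  rewrite (@Mmod_odd 1) ?TN//.
  rewrite opprK mulmx1 !mulmxN mulmx0 oppr0 addr0.
  have -> : Q - (P + h *: (c *: e)) *m A = q1 - h *: (c *: w).
    by rewrite mulmxDl -!scalemxAl eA opprD addrA /Q addrK.
  have -> : P + h *: (c *: e) - (q1 - h *: (c *: w)) *m B = p + h *: (c *: w).
    rewrite mulmxBl -!scalemxAl wB /P; move: (q1 *m B) => X.
    by apply/rowP => k; rewrite !mxE; ring.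
  by rewrite /q1; congr row_mx; apply/rowP => k; rewrite !mxE; ring.
exists ([:: - 1%:M; B; A], false, a *: e, const_mx b); split.
  by split => // S; rewrite !inE => /or3P[] /eqP ->.
move=> h p q; pose p1 := p - q; pose Q := q + p1 *m B; pose P := p1 + Q *m A.
have E : lin_module [:: - 1%:M; B; A] (row_mx p q) = row_mx P Q.
  by rewrite /lin_module /= (@Mmod_odd 1)// (@Mmod_even 2)// (@Mmod_odd 3)// mulmxN mulmx1.
rewrite /layer_apply E /act_module row_mxKl row_mxKr sigma_ab_delta.
have -> : P 0 i = dot w p.
  rewrite -dot_delta /P dotDl dot_sym// eA /Q dotDl dot_sym// wB dotBr -/e.
  by rewrite /p1 !dotBl (dotC w); ring.
set c := a * _; rewrite /lin_module_inv /=.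
rewrite (@Mmod_odd 3) ?TN// (@Mmod_even 2) ?TN// (@Mmod_odd 1) ?TN ?trmx1// opprK mulmx1 !mulmxN.
have -> : P - (Q + h *: (c *: e)) *m A = p1 - h *: (c *: w).
  by rewrite mulmxDl -!scalemxAl eA opprD addrA /P addrK.
have -> : Q + h *: (c *: e) - (p1 - h *: (c *: w)) *m B = q + h *: (c *: w).
  rewrite mulmxBl -!scalemxAl wB /Q; move: (p1 *m B) => X.
  by apply/rowP => k; rewrite !mxE; ring.
by rewrite /p1; congr row_mx; apply/rowP => k; rewrite !mxE; ring.
Qed.

Lemma ridge_net (up : bool) L (c : R) : exists ls : seq (tla_layer R d),
  (forall l, l \in ls -> valid_lin l.1.1.1) /\
  forall h p q, tla_net sigma ls h (row_mx p q) =
    if up then row_mx (p + (h * c) *: ridge L q) q else row_mx p (q + (h * c) *: ridge L p).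
Proof.
elim: L => [|[[a w] b] L [ls [lsV lsE]]].
  exists [::]; split => // h p q; rewrite /ridge !big_nil !scaler0 !addr0.
  by case: up.
have [l [lV lE]] := ridge_layer up (c * a) w b.
exists (l :: ls); split; first by move=> l'; rewrite inE => /predU1P[->|/lsV].
move=> h p q; rewrite /tla_net [LHS]/= lE.
case: up lE lsE => lE lsE /=; rewrite /tla_net in lsE; rewrite lsE /ridge !big_cons /=.
  by rewrite -addrA [in RHS]scalerDr !scalerA !mulrA.
by rewrite -addrA [in RHS]scalerDr !scalerA !mulrA.
Qed.

Lemma tla_net_cat (l1 l2 : seq (tla_layer R d)) h (x : 'rV[R]_(d + d)) :
  tla_net sigma (l1 ++ l2) h x = tla_net sigma l2 h (tla_net sigma l1 h x).
Proof. exact: foldl_cat. Qed.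

Lemma tla_net_iter (ls : seq (tla_layer R d)) n h (x : 'rV[R]_(d + d)) :
  tla_net sigma (flatten (nseq n ls)) h x = iter n (tla_net sigma ls h) x.
Proof. by elim: n x => //= n IH x; rewrite tla_net_cat IH -iterSr. Qed.

Lemma ridge_euler_net (LV LK : seq (R * 'rV[R]_d * R)) (n : nat) :
  exists ls : seq (tla_layer R d), valid_tla ls /\
  forall h (x : 'rV[R]_(d + d)), tla_net sigma ls h x = iter n.+1 (fun x : 'rV[R]_(d + d) =>
    let p := lsubmx x + (h / n.+1%:R) *: ridge LV (rsubmx x) in
    row_mx p (rsubmx x + (h / n.+1%:R) *: ridge LK p)) x.
Proof.
(* A layer acting as the identity keeps the list nonempty when both ridge sums are empty. *)
have [l0 [l0V l0E]] := ridge_layer true 0 0 0.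
have [l1 [l1V l1E]] := ridge_net true LV n.+1%:R^-1.
have [l2 [l2V l2E]] := ridge_net false LK n.+1%:R^-1.
exists (flatten (nseq n.+1 (l0 :: l1 ++ l2))); split; first split.
- by rewrite /= .
- move=> l /flattenP[s /nseqP[-> _]]; rewrite inE mem_cat => /or3P[/eqP ->|/l1V|/l2V]//.
move=> h x; rewrite tla_net_iter; apply: eq_iter => y.
rewrite -[y in LHS]hsubmxK [LHS]/= -/(tla_net _ _ _ _) l0E mul0r !scale0r !scaler0 !addr0.
by rewrite -[LHS]/(tla_net sigma (l1 ++ l2) h _) tla_net_cat l1E l2E.
Qed.

End Layers.

(** * Univariate approximation *)

Section Antiderivative.
Variable R : realType.
Implicit Types (f F : R -> R).

Lemma MVT_deriv F f x y : (forall t : R, is_derive t (1 : R) F (f t)) -> x <= y ->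
  exists2 c, x <= c <= y & F y - F x = f c * (y - x).
Proof.
move=> Fd xy.
have Fc : continuous F.
  by move=> s; apply: differentiable_continuous; apply/derivable1_diffP; apply: ex_derive.
have [c] := MVT_segment xy (fun s _ => Fd s) (continuous_subspaceT Fc).
by rewrite in_itv /= => cxy E; exists c.
Qed.

(** Integrals from [- n.+1%:R], normalised at 0, agree on their common domains and are glued. *)
Lemma antiderivative f : continuous f -> exists F : R -> R, forall t : R, is_derive t (1 : R) F (f t).
Proof.
move=> fc.
have loc (n : nat) : exists F : R -> R, F 0 = 0 /\
    forall t : R, - n.+1%:R < t -> is_derive t (1 : R) F (f t).
  pose G (x : R) := (\int[lebesgue_measure]_(t in [set` Interval (BLeft (- n.+1%:R)) (BRight x)]) f t)%R.
  exists (fun x => G x - G 0); split; first by rewrite subrr.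
  move=> t nt.
  have [] := @continuous_FTC1_closed R f (- n.+1%:R) t (t + 1) _ _ _ (fc t).
  - by rewrite ltrDl.
  - apply: continuous_compact_integrable; first exact: segment_compact.
    exact: continuous_subspaceT.
  - exact: nt.
  move=> Gd GE.
  have dG : is_derive t (1 : R) G (f t) by rewrite -GE derive1E; exact: derivableP.
  have := is_deriveB dG (is_derive_cst (G 0) t (1 : R)).
  by rewrite subr0.
have /choice[F FP] := loc.
have agree n k t : - n.+1%:R < t -> (n <= k)%N -> F n t = F k t.
  move=> nt nk.
  have kn : - k.+1%:R <= - n.+1%:R :> R by rewrite lerN2 ler_nat.
  pose H (x : R) := F n x - F k x.
  have Hd (x : R) : - n.+1%:R < x -> is_derive x (1 : R) H 0.
    move=> nx; have := is_deriveB ((FP n).2 x nx) ((FP k).2 x (le_lt_trans kn nx)).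
    by rewrite subrr.
  have Hc (x : R) : - n.+1%:R < x -> {for x, continuous H}.
    move=> nx; apply: differentiable_continuous; apply/derivable1_diffP.
    exact: (@ex_derive _ _ _ _ _ _ _ (Hd x nx)).
  have n0 : - n.+1%:R < 0 :> R by rewrite oppr_lt0 ltr0n.
  suff : H t = H 0.
    by rewrite /H (FP n).1 (FP k).1 subr0 => /eqP; rewrite subr_eq0 => /eqP.
  have mv (a b : R) : - n.+1%:R < a -> a <= b -> H a = H b.
    move=> na ab.
    have [|||c _] := @MVT_segment R H (fun=> 0) a b.
    - exact: ab.
    - by move=> x; rewrite in_itv /= => /andP[ax _]; apply: Hd; exact: lt_trans ax.
    - apply: continuous_in_subspaceT => x; rewrite inE /= in_itv /= => /andP[ax _].
      by apply: Hc; exact: lt_le_trans ax.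
    by rewrite mul0r => /eqP; rewrite subr_eq0 => /eqP.
  have [t0|t0] := leP 0 t; first by rewrite -(mv 0 t).
  by rewrite (mv t 0)// ltW.
pose N (t : R) := (Num.truncn `|t|).
have Nt (t : R) : - (N t).+1%:R < t.
  have := truncnS_gt `|t|; rewrite -/(N t) => h.
  by rewrite ltrNl (le_lt_trans _ h)// ler_normr lexx orbT.
exists (fun t => F (N t) t) => t.
have := (FP (N t).+1).2 t _.
have lt1 : - (N t).+2%:R < t by rewrite (le_lt_trans _ (Nt t))// lerN2 ler_nat.
move=> /(_ lt1); apply: near_eq_is_derive.
near=> u.
have [h|h] := leqP (N u) (N t).+1; first by rewrite (agree _ _ _ (Nt u) h).
apply: agree; last exact: ltnW.
near: u.
exact: lt_nbhsr.
Unshelve. all: by end_near. Qed.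

End Antiderivative.

(** * Towers of antiderivatives and iterated differences *)

Section Tower.
Variable R : realType.
Implicit Types (f F : R -> R).

Lemma is_derive_continuous F f : (forall t : R, is_derive t (1 : R) F (f t)) -> continuous F.
Proof.
by move=> Fd t; apply: differentiable_continuous; apply/derivable1_diffP; apply: ex_derive.
Qed.

Lemma Ck_real_iter r f k : Ck_real r f -> (k <= r)%N ->
  continuous (iter k (@derive1 R R) f) /\
  ((k < r)%N -> forall t : R, derivable (iter k (@derive1 R R) f) t (1 : R)).
Proof.
elim: k r f => [|k IH] r f.
  by case: r => [|r] /= [fc] //; case.
case: r => [//|r] /= [fc [fd Cf]] kr; rewrite -iterS iterSr.
exact: IH.
Qed.

(* [A] lists the derivatives of [f] downwards from order [r], and then iterated
   antiderivatives of [f]. *)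
Lemma tower r f : Ck_real r f -> exists A : nat -> R -> R,
  [/\ forall l (t : R), is_derive t (1 : R) (A l.+1) (A l t), A r = f,
      A 0%N = iter r (@derive1 R R) f & continuous (A 0%N)].
Proof.
move=> Cf.
have an (g : R -> R) : exists F : R -> R, continuous g ->
    forall t : R, is_derive t (1 : R) F (g t).
  have [gc|ngc] := pselect (continuous g); last by exists g.
  by have [F] := antiderivative gc; exists F.
have [anti antiP] := choice an.
pose B j := iter j anti f.
have Bc j : continuous (B j).
  elim: j => [|j IH]; first by have [] := Ck_real_iter Cf (leq0n r).
  exact: is_derive_continuous (antiP _ IH).
exists (fun l => if (l <= r)%N then iter (r - l) (@derive1 R R) f else B (l - r)%N).
split.
- move=> l t; have [lr|rl] := ltnP l r.
    rewrite (ltnW lr) -(subnSK lr).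
    have [_ /(_ _ t)] := Ck_real_iter Cf (leq_subr l.+1 r).
    rewrite ltn_subrL (leq_ltn_trans _ lr)//= => /(_ erefl) d.
    by have := derivableP d; rewrite -derive1E.
  rewrite subSn//=; case: (leqP l r) => [lr|_]; last exact: antiP.
  have <- : r = l by apply/eqP; rewrite eqn_leq rl.
  by rewrite subnn /=; apply: antiP; exact: (Bc 0%N).
- by rewrite leqnn subnn.
- by rewrite leq0n subn0.
- by rewrite leq0n subn0; have [] := Ck_real_iter Cf (leqnn r).
Qed.

Definition dif (g : R -> R) (t : R) : R := g (t + 1) - g t.

Lemma is_derive_comp_shift F f c (t : R) : (forall t : R, is_derive t (1 : R) F (f t)) ->
  is_derive t (1 : R) (fun x => F (x + c)) (f (t + c)).
Proof.
move=> Fd; have h := is_derive_shift t (1 : R) c.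
have := @is_derive1_comp R F (fun x => x + c) t _ _ (Fd (t + c)) h.
by rewrite mulr1.
Qed.

Lemma is_derive_dif p F f : (forall t : R, is_derive t (1 : R) F (f t)) ->
  forall t : R, is_derive t (1 : R) (iter p dif F) (iter p dif f t).
Proof.
elim: p => //= p IH Fd t.
exact: is_deriveB (is_derive_comp_shift 1 t (IH Fd)) (IH Fd t).
Qed.

Lemma is_derive_uniq F (t : R) a b : is_derive t (1 : R) F a -> is_derive t (1 : R) F b -> a = b.
Proof. by move=> [_ <-] [_ <-]. Qed.

(** A function with vanishing difference is 1-periodic, and a 1-periodic function tending to 0 along
    [x + n] is zero; this removes the differences of [u] one at a time. *)
Lemma dif_vanishing p (u : R -> R) :
  (forall x, (fun n : nat => u (x + n%:R)) @ \oo --> (0 : R)) ->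
  (forall x, iter p dif u x = 0) -> forall x, u x = 0.
Proof.
elim: p u => // p IH u u0 H.
apply: (IH u u0) => x.
have v0 q : forall y, (fun n : nat => iter q dif u (y + n%:R)) @ \oo --> (0 : R).
  elim: q => // q IHq y; rewrite /= /dif -[X in _ --> X](subrr 0).
  apply: cvgB; last exact: IHq.
  by under eq_fun do rewrite addrAC; exact: IHq.
have cst n : iter p dif u (x + n%:R) = iter p dif u x.
  elim: n => [|n <-]; first by rewrite addr0.
  by have := H (x + n%:R); rewrite /= /dif => /eqP; rewrite subr_eq0 -addrA natr1 => /eqP.
have := v0 p x; under eq_fun do rewrite cst.
by move=> h; apply: (cvg_unique _ (cvg_cst _) h).
Qed.

Section Nonvanishing.
Variable A : nat -> R -> R.
Hypothesis Ad : forall l (t : R), is_derive t (1 : R) (A l.+1) (A l t).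
Hypothesis Ac : continuous (A 0%N).
Hypothesis Ai : (0 < \int[@lebesgue_measure R]_x (`| A 0%N x |)%:E < +oo)%E.

(** A primitive [B] of the absolute value of [A 0] is nondecreasing and bounded along [x + n] by
    integrability; its increments therefore tend to 0, and they dominate those of [A 1]. *)
Lemma tower_increment_cvg0 (x rho : R) : 0 < rho <= 1 ->
  (fun n : nat => A 1 (x + n%:R + rho) - A 1 (x + n%:R)) @ \oo --> (0 : R).
Proof.
move=> /andP[rho0 rho1].
have nc : continuous (fun t : R => `|A 0%N t|).
  by move=> t; apply: (continuous_comp (Ac (x := t)) (@norm_continuous _ R _)).
have [B Bd] := antiderivative nc.
have Bc := is_derive_continuous Bd.
have Bincr : {homo B : s t / s <= t}.
  move=> s t st; have [c _] := MVT_deriv Bd st.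
  by rewrite -subr_ge0 => ->; rewrite mulr_ge0// subr_ge0.
have AB s t : s <= t -> `|A 1 t - A 1 s| <= B t - B s.
  move=> st; rewrite ler_norml; apply/andP; split.
    have dS u : is_derive u (1 : R) (fun u => B u + A 1 u) (`|A 0%N u| + A 0%N u).
      exact: is_deriveD (Bd u) (Ad 0 u).
    have [c _ E] := MVT_deriv dS st.
    have : 0 <= B t + A 1 t - (B s + A 1 s).
      rewrite E mulr_ge0 ?subr_ge0// -[A 0%N c in X in _ + X]opprK subr_ge0.
      by rewrite -normrN ler_norm.
    lra.
  have dS u : is_derive u (1 : R) (fun u => B u - A 1 u) (`|A 0%N u| - A 0%N u).
    exact: is_deriveB (Bd u) (Ad 0 u).
  have [c _ E] := MVT_deriv dS st.
  have : 0 <= B t - A 1 t - (B s - A 1 s).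
    by rewrite E mulr_ge0 ?subr_ge0// ler_norm.
  lra.
pose I := fine (\int[@lebesgue_measure R]_x (`| A 0%N x |)%:E)%E.
have Bbd n : B (x + n%:R) <= B x + I.
  have [->|n0] := eqVneq n 0%N.
    by rewrite addr0 lerDl fine_ge0// integral_ge0.
  have xn : x < x + n%:R by rewrite ltrDl ltr0n lt0n.
  rewrite -lerBlDl.
  have E := @continuous_FTC2 R (fun t => `|A 0%N t|) B x (x + n%:R) xn
    (continuous_subspaceT nc).
  rewrite -lee_fin EFinB -E.
  - rewrite /I fineK; last by rewrite ge0_fin_numE ?integral_ge0//; case/andP: Ai.
    apply: ge0_subset_integral => //.
    by apply/measurable_realfun.measurable_EFinP; exact: measurable_realfun.continuous_measurable_fun.
  - split; first by move=> t _; exact: ex_derive.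
      exact: (cvg_within_filter _ (Bc x)).
    exact: (cvg_within_filter _ (Bc (x + n%:R))).
  - by move=> t _; rewrite derive1E; case: (Bd t).
have Bcv : cvgn (fun n : nat => B (x + n%:R)).
  apply: nondecreasing_is_cvgn.
    by apply/nondecreasing_seqP => n; apply: Bincr; rewrite lerD2l ler_nat.
  by exists (B x + I) => _ [n _ <-].
have Bcv1 : (fun n : nat => B (x + n.+1%:R) - B (x + n%:R)) @ \oo --> (0 : R).
  rewrite -(subrr (limn (fun n : nat => B (x + n%:R)))); apply: cvgB => //.
  by rewrite (@cvg_shiftS _ (fun n : nat => B (x + n%:R))).
apply/norm_cvg0P; apply: (squeeze_cvgr (f := fun=> 0) _ (cvg_cst _) Bcv1).
apply: nearW => n; rewrite normr_ge0 /=; apply: (le_trans (AB _ _ _)).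
  by rewrite lerDl ltW.
by rewrite lerD2r; apply: Bincr; rewrite -natr1 addrA lerD2l.
Qed.

(* If all differences of order [p] of [A m] vanished, so would those of the
   increments of [A 1]; but these tend to [0] at infinity because [A 0] is
   integrable, hence they would vanish and [A 0] with them. *)
Lemma tower_dif_neq0 p m : exists b : R, iter p dif (A m) b != 0.
Proof.
apply: contrapT => nH.
have {nH}H m' : (m' <= m)%N -> forall b, iter p dif (A (m - m')) b = 0.
  elim: m' => [|m' IH] mm b.
    by rewrite subn0; apply/eqP; apply: contra_notT nH => h; exists b.
  have := is_derive_dif p (Ad (m - m'.+1)) b; rewrite subnSK// => h.
  apply: is_derive_uniq h _.
  rewrite (_ : iter p dif _ = cst 0); first exact: is_derive_cst.
  by apply/funext => t; rewrite IH// ltnW.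
have H0 b : iter p dif (A 0%N) b = 0 by have := H m (leqnn m) b; rewrite subnn.
have per x (rho : R) : 0 < rho <= 1 -> A 1 (x + rho) - A 1 x = 0.
  move=> rho1; apply: (dif_vanishing (p := p) (u := fun x => A 1 (x + rho) - A 1 x)).
    by move=> y; exact: tower_increment_cvg0.
  move=> y.
  have Ed q z : iter q dif (fun x => A 1 (x + rho) - A 1 x) z =
      iter q dif (A 1) (z + rho) - iter q dif (A 1) z.
    elim: q z => //= q IHq z; rewrite /dif !IHq [z + 1 + rho]addrAC; ring.
  rewrite Ed.
  have [|c _ ->] := MVT_deriv (is_derive_dif p (Ad 0)) (x := y) (y := y + rho).
    by case/andP: rho1 => /ltW; rewrite lerDl.
  by rewrite H0 mul0r.
have A0 x : A 0%N x = 0.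
  apply/eqP; rewrite -normr_le0; apply/ler_addgt0Pr => e e0; rewrite add0r.
  have /cvgrPdist_le/(_ _ e0)/nbhs_ballP[d /= d0 dH] := Ac (x := x).
  pose rho := Num.min 1 (d / 2).
  have rho0 : 0 < rho by rewrite lt_min ltr01 divr_gt0.
  have rho1 : rho <= 1 by rewrite ge_min lexx.
  have [|c xc E] := MVT_deriv (Ad 0) (x := x) (y := x + rho); first by rewrite lerDl ltW.
  have := E; rewrite per ?rho0// addrC addKr => /esym/eqP.
  rewrite mulf_eq0 (gt_eqF rho0) orbF => /eqP Ac0.
  have := dH c; rewrite Ac0 subr0; apply.
  rewrite -ball_normE /= distrC ger0_norm ?subr_ge0; last by case/andP: xc.
  have : rho < d by rewrite gt_min ltr_pdivrMr// ltr_pMr// ltr1n orbT.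
  by apply: le_lt_trans; rewrite lerBlDl; case/andP: xc.
case/andP: Ai => + _; under eq_integral do rewrite A0 normr0.
by rewrite integral0 ltxx.
Qed.

End Nonvanishing.
End Tower.
Arguments dif {R}.

Section Calculus.
Variable R : realType.

Lemma real_unif_continuous (f : R -> R) (M e : R) : continuous f -> 0 < e ->
  exists2 d : R, 0 < d & forall x y, `|x| <= M -> `|y| <= M -> `|x - y| < d -> `|f x - f y| < e.
Proof.
move=> fc e0.
have cf : ccvg setT (fun _ : nat => f) f.
  move=> y _ u u0; have /cvgrPdist_lt/(_ _ u0)/nbhs_ballP[d /= d0 dH] := fc y.
  apply/evtP; exists 0%N, d => // _ z _ zd _; rewrite distrC; apply: dH.
  by rewrite -ball_normE /= distrC.
have cM : compact [set x : R | `|x| <= M].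
  have := @segment_compact R (- M) M; congr compact; apply/seteqP.
  by split => x /=; rewrite in_itv /= ler_norml.
have [N [d d0 H]] := ccvg_unif_compact cf cM (fun _ _ => I) e0.
by exists d => // x y xM yM xy; apply: (H N).
Qed.

Lemma is_derive_pow l (t : R) :
  is_derive t (1 : R) (fun v : R => v ^+ l) (l%:R * t ^+ l.-1).
Proof.
case: l => [|l].
  by rewrite mul0r (_ : (fun v => _) = cst 1); first exact: is_derive_cst.
split; first exact: exprn_derivable.
by rewrite exp_derive /GRing.scale /= mulr1.
Qed.

Lemma is_derive_bigsum n (h : nat -> R -> R) (dh : nat -> R) (t : R) :
  (forall i, (i < n)%N -> is_derive t (1 : R) (h i) (dh i)) ->
  is_derive t (1 : R) (fun v => \sum_(i < n) h i v) (\sum_(i < n) dh i).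
Proof.
elim: n => [|n IH] H.
  rewrite big_ord0 (_ : (fun _ => _) = cst 0); first exact: is_derive_cst.
  by apply/funext => v; rewrite big_ord0.
rewrite big_ord_recr /= (_ : (fun _ => _) = (fun v => \sum_(i < n) h i v) + h n).
  by apply: is_deriveD; [apply: IH => i /ltnW; exact: H|exact: H].
by apply/funext => v; rewrite big_ord_recr.
Qed.

(** The derivative of the remainder of [g 0] is the remainder of [g 1] of one order less; induction
    with the mean value inequality gives a bound without the factorial. *)
Lemma taylor_bound (g : nat -> R -> R) q (b C u : R) : 0 <= u ->
  (forall i (t : R), (i <= q)%N -> is_derive t (1 : R) (g i) (g i.+1 t)) ->
  (forall t, b - u <= t <= b + u -> `|g q.+1 t| <= C) ->
  forall v, `|v| <= u ->
  `|g 0%N (b + v) - \sum_(l < q.+1) g l b / l`!%:R * v ^+ l| <= C * `|v| ^+ q.+1.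
Proof.
move=> u0.
have mvt (F f : R -> R) (v D : R) : (forall t, is_derive t (1 : R) F (f t)) -> F 0 = 0 ->
    (forall c, `|c| <= `|v| -> `|f c| <= D) -> `|F v| <= D * `|v|.
  move=> Fd F0 fD; have [v0|v0] := leP 0 v.
    have [c /andP[c0 cv]] := MVT_deriv Fd v0; rewrite F0 !subr0 => ->.
    by rewrite normrM ler_wpM2r// fD// !ger0_norm.
  have [c /andP[c0 cv] E] := MVT_deriv Fd (ltW v0).
  have -> : F v = f c * v by move: E; rewrite F0; lra.
  by rewrite normrM ler_wpM2r// fD// !ler0_norm ?lerN2// ltW.
elim: q g => [|q IH] g gd gC v vu.
  rewrite big_ord_recl big_ord0 fact0 divr1 expr0 mulr1 addr0 expr1.
  apply: (mvt (fun v => g 0%N (b + v) - g 0%N b) (fun v => g 1%N (b + v))).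
  - move=> t; rewrite -[g 1%N _]subr0.
    apply: is_deriveB.
    have := is_derive_comp_shift b t (gd 0%N ^~ (leqnn _)).
    by rewrite addrC; under eq_fun do rewrite addrC.
  - by rewrite addr0 subrr.
  - move=> c cv; apply: gC.
    have := le_trans cv vu; rewrite ler_norml => /andP[? ?].
    by apply/andP; split; lra.
rewrite [in leRHS]exprSr mulrA.
apply: (mvt (fun v => g 0%N (b + v) - \sum_(l < q.+2) g l b / l`!%:R * v ^+ l)
  (fun v => g 1%N (b + v) - \sum_(l < q.+1) g l.+1 b / l`!%:R * v ^+ l)).
- move=> t; apply: is_deriveB.
    have := is_derive_comp_shift b t (gd 0%N ^~ (leq0n _)).
    by rewrite addrC; under eq_fun do rewrite addrC.
  have := @is_derive_bigsum q.+2 (fun l v => g l b / l`!%:R * v ^+ l)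
    (fun l => g l b / l`!%:R * (l%:R * t ^+ l.-1)) t
    (fun l _ => is_deriveZ _ (is_derive_pow l t)).
  rewrite big_ord_recl mul0r mulr0 add0r; congr is_derive.
  apply: eq_bigr => l _; rewrite !lift0 /= factS natrM invfM -!mulrA; congr (_ * _).
  by rewrite mulrCA; congr (_ * _); rewrite mulrA mulVf ?mul1r// pnatr_eq0.
- rewrite addr0 big_ord_recl big1 ?addr0 /= ?fact0 ?divr1 ?expr0 ?mulr1 ?subrr//.
  by move=> i _; rewrite expr0n mulr0.
- move=> c cv; apply: le_trans (IH (fun i => g i.+1) _ _ _ _) _.
  + by move=> i t iq; exact: gd.
  + exact: gC.
  + exact: le_trans cv vu.
  + rewrite ler_wpM2l ?lerXn2r ?nnegrE//.
    have := gC b; rewrite lerDl gerBl u0 => /(_ erefl); exact: le_trans.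
Qed.

End Calculus.

(** * The closed span of dilates and translates of a function *)

Section ProfileClosure.
Variables (R : realType) (A : nat -> R -> R) (m : nat).
Hypothesis Ad : forall l (t : R), is_derive t (1 : R) (A l.+1) (A l t).
Hypothesis Ac : continuous (A 0%N).
Hypothesis An : forall p, exists b : R, iter p dif (A m) b != 0.
Hypothesis m_gt0 : (0 < m)%N.

Definition rsum (L : seq (R * R * R)) k (t : R) : R :=
  \sum_(c <- L) c.1.1 * c.1.2 ^+ k * A (m - k) (c.1.2 * t + c.2).

(* [theta k] plays the role of the [k]-th derivative of [theta 0]; membership
   means approximation of [theta 0] in C^m, uniformly on compact sets, by linear
   combinations of the functions [A m (w t + b)]. *)
Definition spanned (theta : nat -> R -> R) : Prop :=
  forall M e : R, 0 < e -> exists L, forall k t, (k <= m)%N -> `|t| <= M ->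
    `|theta k t - rsum L k t| <= e.

Lemma spanned_ext theta theta' : (forall k t, (k <= m)%N -> theta k t = theta' k t) ->
  spanned theta -> spanned theta'.
Proof.
move=> E H M e e0; have [L HL] := H M e e0; exists L => k t km tM.
by rewrite -E//; exact: HL.
Qed.

Lemma spanned_closed theta :
  (forall M e : R, 0 < e -> exists2 theta', spanned theta' &
     forall k t, (k <= m)%N -> `|t| <= M -> `|theta k t - theta' k t| <= e) ->
  spanned theta.
Proof.
move=> H M e e0; have e2 : 0 < e / 2 by rewrite divr_gt0.
have [theta' S' E'] := H M _ e2; have [L HL] := S' M _ e2; exists L => k t km tM.
rewrite -(subrKA (theta' k t)) (splitr e) (le_trans (ler_normD _ _))// lerD//.
  exact: E'.
exact: HL.
Qed.

Lemma spanned_lin a theta theta' : spanned theta -> spanned theta' ->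
  spanned (fun k t => a * theta k t + theta' k t).
Proof.
move=> H H' M e e0.
have a0 : 0 < 1 + `|a| by rewrite ltr_pwDl.
have e2 : 0 < e / 2 by rewrite divr_gt0.
have [L HL] := H M (e / 2 / (1 + `|a|)) (divr_gt0 e2 a0).
have [L' HL'] := H' M _ e2.
exists ([seq (a * c.1.1, c.1.2, c.2) | c <- L] ++ L') => k t km tM.
rewrite /rsum big_cat big_map /=.
have -> : \sum_(c <- L) a * c.1.1 * c.1.2 ^+ k * A (m - k) (c.1.2 * t + c.2) = a * rsum L k t.
  by rewrite /rsum mulr_sumr; apply: eq_bigr => c _; rewrite !mulrA.
rewrite opprD addrACA -mulrBr (splitr e) (le_trans (ler_normD _ _))// lerD ?HL'//.
rewrite normrM (le_trans (ler_wpM2l (normr_ge0 _) (HL k t km tM)))//.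
by rewrite mulrA ler_pdivrMr// [leLHS]mulrC ler_pM2l// lerDr.
Qed.

Lemma spanned0 : spanned (fun _ _ => 0).
Proof.
by move=> M e e0; exists [::] => k t _ _; rewrite /rsum big_nil subrr normr0 ltW.
Qed.

Lemma spanned_sum n (c : nat -> R) (theta : nat -> nat -> R -> R) :
  (forall i, (i < n)%N -> spanned (theta i)) ->
  spanned (fun k t => \sum_(i < n) c i * theta i k t).
Proof.
elim: n => [|n IH] H.
  by apply: spanned_ext spanned0 => k t _; rewrite big_ord0.
have := spanned_lin (c n) (H n (ltnSn n)) (IH (fun i i_n => H i (ltnW i_n))).
by apply: spanned_ext => k t _; rewrite big_ord_recr addrC.
Qed.

Lemma spanned_generator : spanned (fun k => A (m - k)).
Proof.
move=> M e e0; exists [:: (1, 1, 0)] => k t _ _.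
by rewrite /rsum big_seq1 /= expr1n !mul1r addr0 subrr normr0 ltW.
Qed.

Lemma spanned_affine theta w b : spanned theta ->
  spanned (fun k t => w ^+ k * theta k (w * t + b)).
Proof.
move=> H M e e0.
pose W := (1 + `|w|) ^+ m.
have W0 : 0 < W by rewrite exprn_gt0// ltr_pwDl.
have [L HL] := H (`|w| * M + `|b|) (e / W) (divr_gt0 e0 W0).
exists [seq (c.1.1, c.1.2 * w, c.1.2 * b + c.2) | c <- L] => k t km tM.
rewrite /rsum big_map /=.
have -> : \sum_(c <- L) c.1.1 * (c.1.2 * w) ^+ k *
    A (m - k) (c.1.2 * w * t + (c.1.2 * b + c.2)) = w ^+ k * rsum L k (w * t + b).
  rewrite /rsum mulr_sumr; apply: eq_bigr => c _.
  by rewrite exprMn mulrDr addrA !mulrA; congr (_ * _); ring.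
rewrite -mulrBr normrM normrX.
have tb : `|w * t + b| <= `|w| * M + `|b|.
  by rewrite (le_trans (ler_normD _ _))// lerD2r normrM ler_wpM2l.
apply: (le_trans (ler_pM _ (normr_ge0 _) _ (HL k _ km tb))).
- by rewrite exprn_ge0.
- apply: (_ : _ <= W); apply: (le_trans (y := (1 + `|w|) ^+ k)).
    by rewrite lerXn2r ?nnegrE ?addr_ge0// lerDr.
  by rewrite ler_weXn2l// lerDl.
by rewrite mulrCA divff ?mulr1// gt_eqF.
Qed.

(** The difference is the integral of [theta] from [t] to [t + 1], a limit of Riemann sums, that is
    of averages of translates of [theta]; the mean value theorem on each cell gives the error. *)
Lemma spanned_dif (P theta : nat -> R -> R) :
  (forall k (t : R), (k <= m)%N -> is_derive t (1 : R) (P k) (theta k t)) ->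
  (forall k, (k <= m)%N -> continuous (theta k)) ->
  spanned theta -> spanned (fun k t => P k (t + 1) - P k t).
Proof.
move=> Pd tc St; apply: spanned_closed => M e e0.
have /choice[d dP] k : exists d : R, 0 < d /\ ((k <= m)%N -> forall x y,
    `|x| <= M + 2 -> `|y| <= M + 2 -> `|x - y| < d -> `|theta k x - theta k y| < e).
  have [km|_] := leqP k m; last by exists 1.
  by have [d d0 dH] := real_unif_continuous (M + 2) (tc k km) e0; exists d.
have [N HN] : exists N : nat, forall k, (k <= m)%N -> N.+1%:R^-1 < d k.
  exists (\max_(k < m.+1) Num.truncn (d k)^-1) => k km.
  rewrite invf_plt ?posrE ?ltr0n//; last by have [] := dP k.
  rewrite (lt_le_trans (truncnS_gt _))// ler_nat ltnS.
  exact: (@leq_bigmax _ (fun k : 'I_m.+1 => Num.truncn (d k)^-1) (Ordinal (km : (k < m.+1)%N))).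
have n0 : 0 < (N.+1%:R : R) by rewrite ltr0n.
exists (fun k t => \sum_(j < N.+1) N.+1%:R^-1 * (1 ^+ k * theta k (1 * t + j%:R / N.+1%:R))).
  apply: (@spanned_sum N.+1 (fun=> N.+1%:R^-1)
    (fun j k t => 1 ^+ k * theta k (1 * t + j%:R / N.+1%:R))) => j _.
  exact: spanned_affine.
move=> k t km tM; pose s j : R := t + j%:R / N.+1%:R.
have sS j : s j.+1 - s j = N.+1%:R^-1.
  by rewrite /s opprD addrACA subrr add0r -mulrBl -natr1 addrAC subrr add0r mul1r.
have -> : P k (t + 1) - P k t = \sum_(j < N.+1) (P k (s j.+1) - P k (s j)).
  rewrite -(big_mkord xpredT (fun j => P k (s j.+1) - P k (s j))) telescope_sumr//.
  by rewrite /s divff ?gt_eqF// mul0r addr0.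
rewrite -sumrB (le_trans (ler_norm_sum _ _ _))//.
apply: (le_trans (y := \sum_(j < N.+1) N.+1%:R^-1 * e)); last first.
  by rewrite sumr_const card_ord -[leLHS]mulr_natl mulrA divff ?mul1r// gt_eqF.
apply: ler_sum => j _; rewrite expr1n !mul1r -/(s j).
have [|c /andP[c1 c2] ->] := MVT_deriv (Pd k ^~ km) (x := s j) (y := s j.+1).
  by rewrite -subr_ge0 sS invr_ge0 ltW.
rewrite sS [theta k c * _]mulrC -mulrBr normrM gtr0_norm ?invr_gt0// ler_wpM2l ?invr_ge0 ?ltW//.
have [_ dk] := dP k; apply: dk => //.
- have sj1 : s j.+1 <= t + 1.
    by rewrite lerD2l ler_pdivrMr// mul1r ler_nat.
  have sj0 : t <= s j by rewrite lerDl divr_ge0.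
  move: tM; rewrite !ler_norml => /andP[? ?]; apply/andP; split; lra.
- have sj1 : s j <= t + 1.
    by rewrite lerD2l ler_pdivrMr// mul1r ler_nat ltnW.
  have sj0 : t <= s j by rewrite lerDl divr_ge0.
  move: tM; rewrite !ler_norml => /andP[? ?]; apply/andP; split; lra.
- rewrite ger0_norm ?subr_ge0//; apply: le_lt_trans (HN k km).
  by rewrite -(sS j) lerD2r.
Qed.

Lemma tower_continuous l : continuous (A l).
Proof. by case: l => [//|l]; exact: is_derive_continuous (Ad l). Qed.

Lemma dif_continuous p (f : R -> R) : continuous f -> continuous (iter p dif f).
Proof.
move=> fc; elim: p => //= p IH t; apply: cvgB; last exact: IH.
apply: (continuous_comp (f := fun t : R => t + 1) (g := iter p dif f)); last exact: IH.
by apply: cvgD; [exact: cvg_id|exact: cvg_cst].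
Qed.

(** A [p]-th difference of a [p]-fold antiderivative is [A m] averaged against a B-spline: it stays
    in the closed span and gains [p] derivatives, which a Taylor expansion of order [p] in C^m
    consumes. *)
Lemma spanned_smoothed p : spanned (fun k => iter p dif (A (m + p - k))).
Proof.
elim: p => [|p IH]; first by rewrite addn0; exact: spanned_generator.
have := spanned_dif (P := fun k => iter p dif (A (m + p.+1 - k))) _ _ IH.
apply.
  move=> k t km; rewrite addnS subSn ?(leq_trans km) ?leq_addr//.
  exact: is_derive_dif.
by move=> k km; apply: dif_continuous; exact: tower_continuous.
Qed.

(* Taylor expansion of [s |-> theta (b + s t)] at order [p] with [theta^(p) b]
   nonzero extracts [t^p] from the span, the lower order terms being in it
   already. *)
Lemma spanned_monomial p : spanned (fun k t => (p ^_ k)%:R * t ^+ (p - k)).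
Proof.
elim/ltn_ind: p => p IH.
pose th k := iter p dif (A (m + p - k)).
have thd k (t : R) : (k < m + p)%N -> is_derive t (1 : R) (th k) (th k.+1 t).
  by move=> km; rewrite /th -(subnSK km); exact: is_derive_dif.
have thc k : continuous (th k) by apply: dif_continuous; exact: tower_continuous.
(* At order [p] the additional antiderivatives are used up: [th p] is the [p]-th difference of [A m]
   itself. *)
have [b b0] := An p.
have thb : th p b != 0 by rewrite /th addnK.
pose c := th p b / p`!%:R.
have c0 : c != 0 by rewrite mulf_neq0// invr_eq0 pnatr_eq0 -lt0n fact_gt0.
apply: spanned_closed => M0 e e0.
pose M := Num.max 1 M0.
have M1 : 1 <= M by rewrite le_max lexx.
have Mge0 : 0 <= M by exact: le_trans M1.
have [C0 [C0ge0 HC0]] : exists C0 : R, 0 <= C0 /\ forall j, (j <= m + p)%N ->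
    forall t, b - M <= t <= b + M -> `|th j t| <= C0.
  have /choice[B HB] j : exists B : R, forall t, b - M <= t <= b + M -> `|th j t| <= B.
    have bM : b - M <= b + M by lra.
    have nc : {within `[b - M, b + M], continuous (fun t => `|th j t|)}.
      apply: continuous_subspaceT => t.
      exact: (continuous_comp (thc j t) (@norm_continuous _ R _)).
    have [t0 _ Ht0] := EVT_max bM nc.
    by exists `|th j t0| => t tM; apply: Ht0; rewrite in_itv.
  exists (\sum_(j < (m + p).+1) `|B j|); split; first exact: sumr_ge0.
  move=> j jm t tM; apply: (le_trans (HB j t tM)); apply: (le_trans (ler_norm _)).
  rewrite -ltnS in jm; rewrite (bigD1 (Ordinal jm))//= lerDl; exact: sumr_ge0.
pose C' := C0 * M ^+ p.+1.
have C'0 : 0 <= C' by rewrite mulr_ge0// exprn_ge0.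
(* The remainder is at most [C' * s ^+ p.+1]; divided by the leading coefficient [c * s ^+ p] it is
   at most [e] for this [s]. *)
pose s := Num.min 1 (e * `|c| / (C' + 1)).
have C'1 : 0 < C' + 1 by rewrite ltr_wpDl.
have s0 : 0 < s by rewrite lt_min ltr01 divr_gt0// mulr_gt0// normr_gt0.
have s1 : s <= 1 by rewrite ge_min lexx.
have sC : C' * s <= e * `|c|.
  apply: (le_trans (y := (C' + 1) * s)); first by rewrite ler_wpM2r ?ltW// ltrDl.
  by rewrite mulrC -ler_pdivlMr// ge_min lexx orbT.
pose Q k (t : R) := \sum_(l < p) (- (th l b / l`!%:R * s ^+ l)) * ((l ^_ k)%:R * t ^+ (l - k)).
exists (fun k t => (c * s ^+ p)^-1 * (1 * (s ^+ k * th k (s * t + b)) + Q k t) + 0).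
  apply: (@spanned_lin _ (fun k t => 1 * (s ^+ k * th k (s * t + b)) + Q k t)
    (fun _ _ => 0) _ spanned0).
  apply: spanned_lin.
    exact: (spanned_affine s b (spanned_smoothed p)).
  apply: (@spanned_sum p (fun l => - (th l b / l`!%:R * s ^+ l))
    (fun l k t => (l ^_ k)%:R * t ^+ (l - k))) => l; exact: IH.
move=> k t km tM0; rewrite addr0 mul1r.
have tM : `|t| <= M by rewrite le_max tM0 orbT.
have stM : `|s * t| <= M.
  by rewrite normrM gtr0_norm// (le_trans _ tM)// ler_piMl.
have cs0 : 0 < `|c * s ^+ p| by rewrite normr_gt0 mulf_neq0// expf_neq0// gt_eqF.
have csn : c * s ^+ p != 0 by rewrite -normr_gt0.
have -> : (p ^_ k)%:R * t ^+ (p - k) - (c * s ^+ p)^-1 * (s ^+ k * th k (s * t + b) + Q k t) =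
    - ((c * s ^+ p)^-1 * (s ^+ k * th k (b + s * t) -
      \sum_(l < p.+1) th l b / l`!%:R * s ^+ l * ((l ^_ k)%:R * t ^+ (l - k)))).
  have -> : Q k t = - \sum_(l < p) th l b / l`!%:R * s ^+ l * ((l ^_ k)%:R * t ^+ (l - k)).
    by rewrite /Q -sumrN; apply: eq_bigr => l _; rewrite mulNr.
  rewrite big_ord_recr /= -/c [s * t + b]addrC; move: (\sum_(_ < _) _) => S.
  move: (c * s ^+ p) csn => u u0; move: (s ^+ k * _) => X.
  by field.
rewrite normrN normrM normfV ler_pdivrMl// [leRHS]mulrC.
apply: (le_trans (y := C' * s ^+ p.+1)); last first.
  rewrite exprS mulrA normrM mulrA [`|s ^+ p|]ger0_norm ?exprn_ge0 ?(ltW s0)//.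
  by rewrite ler_wpM2r// exprn_ge0// ltW.
(* For [k > p] the monomial and the subtracted terms have zero derivative, and the factor [s ^+ k]
   alone makes the contribution of [th k] small. *)
have [kp|pk] := leqP k p; last first.
  rewrite big1 ?subr0; last first.
    by move=> l _; rewrite ffact_small ?mul0r ?mulr0// (leq_ltn_trans _ pk)// -ltnS.
  rewrite normrM ger0_norm ?exprn_ge0 ?(ltW s0)// mulrC ler_pM ?exprn_ge0 ?(ltW s0)//.
    apply: (le_trans (y := C0)); last by rewrite ler_peMr// exprn_ege1.
    apply: HC0; first exact: (leq_trans km (leq_addr _ _)).
    move: stM; rewrite ler_norml => /andP[? ?]; apply/andP; split; lra.
  by rewrite ler_wiXn2l// ltW.
have -> : \sum_(l < p.+1) th l b / l`!%:R * s ^+ l * ((l ^_ k)%:R * t ^+ (l - k)) =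
    s ^+ k * \sum_(l < (p - k).+1) th (k + l)%N b / l`!%:R * (s * t) ^+ l.
  rewrite -(big_mkord xpredT (fun l => th l b / l`!%:R * s ^+ l * ((l ^_ k)%:R * t ^+ (l - k)))).
  rewrite (big_cat_nat (n := k))//=; last exact: leqW.
  rewrite big_nat_cond big1 ?add0r; last first.
    by move=> l /andP[/andP[_ lk] _]; rewrite ffact_small// mul0r mulr0.
  rewrite -{1}[k]add0n big_addn big_mkord subSn// mulr_sumr.
  apply: eq_bigr => l _; rewrite addnK [(k + l)%N]addnC exprMn exprD.
  have f0 : ((l : nat)`!%:R : R) != 0 by rewrite pnatr_eq0 -lt0n fact_gt0.
  have F0 : ((l + k)`!%:R : R) != 0 by rewrite pnatr_eq0 -lt0n fact_gt0.
  have -> : ((l + k) ^_ k)%:R = (l + k)`!%:R / (l : nat)`!%:R :> R.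
    have := @ffact_fact (l + k) k (leq_addl _ _); rewrite addnK => <-.
    by rewrite natrM mulfK.
  by field; rewrite f0 F0.
rewrite -mulrBr normrM ger0_norm ?exprn_ge0 ?(ltW s0)//.
have T := @taylor_bound R (fun i => th (k + i)%N) (p - k) b C0 M Mge0 _ _ (s * t) stM.
rewrite addn0 in T.
apply: (le_trans (ler_wpM2l _ (T _ _))).
- by rewrite exprn_ge0// ltW.
- move=> i u iq; rewrite addnS; apply: thd.
  apply: (leq_ltn_trans (n := p)); last by rewrite -[X in (X < _)%N]add0n ltn_add2r.
  by rewrite -(subnKC kp) leq_add2l.
- move=> u uM; apply: HC0 => //; rewrite addnS subnKC//.
  by rewrite -[X in (X < _)%N]add0n ltn_add2r.
rewrite normrM exprMn gtr0_norm// mulrCA /C' -mulrA ler_wpM2l//.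
rewrite mulrA -exprD addnS subnKC// mulrC ler_wpM2r ?exprn_ge0 ?(ltW s0)//.
apply: (le_trans (y := M ^+ (p - k).+1)); first by rewrite lerXn2r ?nnegrE.
by rewrite ler_weXn2l// ltnS leq_subr.
Qed.

End ProfileClosure.

(** * Multivariate approximation by ridge functions *)

Section RidgeClosure.
Variables (R : realType) (A : nat -> R -> R) (m d : nat).
Hypothesis Ad : forall l (t : R), is_derive t (1 : R) (A l.+1) (A l t).
Hypothesis Ac : continuous (A 0%N).
Hypothesis An : forall p, exists b : R, iter p dif (A m) b != 0.
Hypothesis m_gt0 : (0 < m)%N.
Implicit Types (x w v : 'rV[R]_d) (s : seq 'I_d) (J : seq 'I_d -> 'rV[R]_d -> R).

Definition wprod w s : R := \prod_(i <- s) w 0 i.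

(** Iterated partial derivative along [s] of the sum of ridge functions
    [c.1.1 * A m (dot c.1.2 x + c.2)], as long as [size s <= m]. *)
Definition rpot (L : seq (R * 'rV[R]_d * R)) s x : R :=
  \sum_(c <- L) c.1.1 * wprod c.1.2 s * A (m - size s) (dot c.1.2 x + c.2).

(* [J s] is the iterated partial derivative of [J [::]] along [s], the head of
   [s] being the outermost derivative. *)
Definition jet J : Prop := forall s i x, (size s < m)%N ->
  is_derive x (ej R i) (J s) (J (i :: s) x).

Definition ridge_limit J : Prop := forall M e : R, 0 < e -> exists L,
  forall s x, (size s <= m)%N -> `|x| <= M -> `|J s x - rpot L s x| <= e.

Definition ridge_closure (f : 'rV[R]_d -> R) : Prop :=
  exists J, [/\ forall x, J [::] x = f x, jet J & ridge_limit J].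

Lemma jet_unique J J' : jet J -> jet J' -> (forall x, J [::] x = J' [::] x) ->
  forall s x, (size s <= m)%N -> J s x = J' s x.
Proof.
move=> HJ HJ' E; elim=> [|i s IH] x //= sm.
have [_ <-] := HJ s i x sm; have [_ <-] := HJ' s i x sm.
by congr (derive _ _ _); apply/funext => y; apply: IH; exact: ltnW.
Qed.

Lemma ridge_closure_ext f g : (forall x, f x = g x) -> ridge_closure f -> ridge_closure g.
Proof. by move=> E [J [J0 J1 J2]]; exists J; split => // x; rewrite J0. Qed.

Lemma ridge_closure_lin a f g : ridge_closure f -> ridge_closure g ->
  ridge_closure (fun x => a * f x + g x).
Proof.
move=> [J [J0 J1 J2]] [J' [J0' J1' J2']].
exists (fun s x => a * J s x + J' s x); split.
- by move=> x; rewrite J0 J0'.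
- move=> s i x sm.
  exact: is_deriveD (is_deriveZ a (J1 s i x sm)) (J1' s i x sm).
move=> M e e0.
have a0 : 0 < 1 + `|a| by rewrite ltr_pwDl.
have e2 : 0 < e / 2 by rewrite divr_gt0.
have [L HL] := J2 M (e / 2 / (1 + `|a|)) (divr_gt0 e2 a0).
have [L' HL'] := J2' M _ e2.
exists ([seq (a * c.1.1, c.1.2, c.2) | c <- L] ++ L') => s x sm xM.
rewrite /rpot big_cat big_map /=.
have -> : \sum_(c <- L) a * c.1.1 * wprod c.1.2 s * A (m - size s) (dot c.1.2 x + c.2)
    = a * rpot L s x.
  by rewrite /rpot mulr_sumr; apply: eq_bigr => c _; rewrite !mulrA.
rewrite opprD addrACA -mulrBr (splitr e) (le_trans (ler_normD _ _))// lerD ?HL'//.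
rewrite normrM (le_trans (ler_wpM2l (normr_ge0 _) (HL s x sm xM)))//.
by rewrite mulrA ler_pdivrMr// [leLHS]mulrC ler_pM2l// lerDr.
Qed.

Lemma ridge_closure0 : ridge_closure (fun=> 0).
Proof.
exists (fun _ _ => 0); split => //.
  by move=> s i x _; exact: is_derive_cst.
by move=> M e e0; exists [::] => s x _ _; rewrite /rpot big_nil subrr normr0 ltW.
Qed.

Lemma ridge_closure_scale a f : ridge_closure f -> ridge_closure (fun x => a * f x).
Proof.
move=> H; apply: ridge_closure_ext (ridge_closure_lin a H ridge_closure0) => x.
by rewrite addr0.
Qed.

Lemma ridge_closure_sum (I : Type) (r : seq I) (f : I -> 'rV[R]_d -> R) :
  (forall i, ridge_closure (f i)) -> ridge_closure (fun x => \sum_(i <- r) f i x).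
Proof.
move=> H; elim: r => [|i r IH].
  by apply: ridge_closure_ext ridge_closure0 => x; rewrite big_nil.
by apply: ridge_closure_ext (ridge_closure_lin 1 (H i) IH) => x; rewrite big_cons mul1r.
Qed.

Lemma dotDr w x y : dot w (x + y) = dot w x + dot w y.
Proof. by rewrite !(dotC w) dotDl. Qed.

Lemma dotZr w a x : dot w (a *: x) = a * dot w x.
Proof. by rewrite /dot linearZ /= -scalemxAr mxE. Qed.

Lemma dotZl w a x : dot (a *: w) x = a * dot w x.
Proof. by rewrite dotC dotZr dotC. Qed.

Lemma dot_linear w : linear (dot w : 'rV[R]_d -> R).
Proof. by move=> a x y; rewrite dotDr dotZr. Qed.

Lemma dot_continuous w : continuous (dot w : 'rV[R]_d -> R).
Proof.
have H (l : seq 'I_d) : continuous (fun y : 'rV[R]_d => \sum_(k <- l) w 0 k * y 0 k : R).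
  elim: l => [|k l IH] x.
    rewrite (_ : (fun _ => _) = cst 0); first exact: cst_continuous.
    by apply/funext => y; rewrite big_nil.
  rewrite (_ : (fun _ => _) = fun y : 'rV[R]_d => w 0 k * y 0 k + \sum_(j <- l) w 0 j * y 0 j).
    have c1 : {for x, continuous (fun y : 'rV[R]_d => w 0 k * y 0 k : R)}.
      exact: (cvgM (cvg_cst (w 0 k)) (@coord_continuous _ _ _ 0 k x)).
    exact: (cvgD c1 (IH x)).
  by apply/funext => y; rewrite big_cons.
rewrite (_ : dot w = fun x => \sum_(k <- enum 'I_d) w 0 k * x 0 k); first exact: H.
by apply/funext => y; rewrite dotE big_enum.
Qed.

Lemma is_diff_ridge w b x (g : R -> R) l : is_derive (dot w x + b) (1 : R) g l ->
  is_diff x (fun x => g (dot w x + b)) (fun v => l * dot w v).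
Proof.
move=> gd.
have ld : is_diff x (dot w : 'rV[R]_d -> R) (dot w).
  pose D : {linear 'rV[R]_d -> R} := HB.pack (dot w) (GRing.isLinear.Build _ _ _ _ (dot w) (@dot_linear w)).
  split; first exact: (@linear_differentiable _ _ _ D x (@dot_continuous w)).
  exact: (@diff_lin _ _ _ D x (@dot_continuous w)).
have gdd : is_diff (dot w x + b) g (fun t => l * t).
  have gder : derivable g (dot w x + b) (1 : R) by exact: (@ex_derive _ _ _ _ _ _ _ gd).
  split; first by apply/derivable1_diffP.
  rewrite deriv1E//; apply/funext => t; rewrite derive1E.
  by have [_ ->] := gd; rewrite /GRing.scale /= mulrC.
have ad : is_diff x (fun x => dot w x + b) (dot w).
  by have := is_diffD ld (is_diff_cst b x); rewrite addr0.
exact: is_diff_comp ad gdd.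
Qed.

Lemma is_diff_derive (V : normedModType R) (f df : V -> R) (x v : V) : is_diff x f df -> is_derive x v f (df v).
Proof.
move=> fd.
have fdd : differentiable f x by exact: (@ex_diff _ _ _ _ _ _ _ fd).
have fv : derivable f x v by exact: diff_derivable.
have := derivableP fv; rewrite deriveE//.
by rewrite (@diff_val _ _ _ _ _ _ _ fd).
Qed.

Lemma dot_ej w i : dot w (ej R i) = w 0 i.
Proof. exact: dot_delta. Qed.

Lemma wprod_cons w i s : wprod w (i :: s) = w 0 i * wprod w s.
Proof. exact: big_cons. Qed.

Lemma wprodZ a w s : wprod (a *: w) s = a ^+ size s * wprod w s.
Proof.
elim: s => [|i s IH]; first by rewrite /wprod !big_nil mulr1.
by rewrite !wprod_cons IH mxE exprS; ring.
Qed.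

Lemma ridge_closure_pow w b p : ridge_closure (fun x => (dot w x + b) ^+ p).
Proof.
exists (fun s x => wprod w s * ((p ^_ size s)%:R * (dot w x + b) ^+ (p - size s))); split.
- by move=> x; rewrite /wprod big_nil ffactn0 subn0 !mul1r.
- move=> s i x sm.
  have E (t : R) : is_derive t (1 : R) (fun t : R => wprod w s * ((p ^_ size s)%:R * t ^+ (p - size s)))
     (wprod w s * ((p ^_ (size s).+1)%:R * t ^+ (p - (size s).+1))).
    have := is_deriveZ (wprod w s) (is_deriveZ (p ^_ size s)%:R (is_derive_pow (p - size s) t)).
    congr is_derive; rewrite /GRing.scale /= ffactnSr natrM -subn1 -subnDA addn1; ring.
  have := is_diff_derive (ej R i) (is_diff_ridge (E (dot w x + b))).
  by rewrite dot_ej wprod_cons; congr is_derive; rewrite /=; ring.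
move=> M e e0.
pose W := \sum_(s : {i : 'I_m.+1 & i.-tuple 'I_d}) `|wprod w (tagged s)| + 1.
have W0 : 0 < W by rewrite ltr_wpDl// sumr_ge0.
have WP s : (size s <= m)%N -> `|wprod w s| <= W.
  move=> sm; have sm' : (size s < m.+1)%N by [].
  pose u : {i : 'I_m.+1 & i.-tuple 'I_d} := Tagged (fun i : 'I_m.+1 => i.-tuple 'I_d)
    (in_tuple s : (nat_of_ord (Ordinal sm')).-tuple 'I_d).
  by rewrite /W (bigD1 u)//= -addrA lerDl addr_ge0// sumr_ge0.
pose M' := \sum_k `|w 0 k| * M + `|b|.
have [L HL] := spanned_monomial Ad Ac An m_gt0 p M' (divr_gt0 e0 W0).
exists [seq (c.1.1, c.1.2 *: w, c.1.2 * b + c.2) | c <- L] => s x sm xM.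
rewrite /rpot big_map /=.
have -> : \sum_(c <- L) c.1.1 * wprod (c.1.2 *: w) s *
    A (m - size s) (dot (c.1.2 *: w) x + (c.1.2 * b + c.2)) =
    wprod w s * rsum A m L (size s) (dot w x + b).
  rewrite /rsum mulr_sumr; apply: eq_bigr => c _.
  by rewrite wprodZ dotZl mulrDr addrA; ring.
rewrite -mulrBr normrM.
have tb : `|dot w x + b| <= M'.
  rewrite (le_trans (ler_normD _ _))// lerD2r dotE (le_trans (ler_norm_sum _ _ _))//.
  apply: ler_sum => k _; rewrite normrM ler_wpM2l// (le_trans _ xM)//.
  exact: norm_coord.
apply: (le_trans (ler_pM _ _ (WP s sm) (HL _ _ sm tb))) => //.
by rewrite mulrCA divff ?mulr1// gt_eqF.
Qed.

(* A polynomial identity in [s] separates its coefficients: [q(2s) - 2^(N-1) q(s)]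
   has lower degree. *)
Lemma ridge_closure_coef N (v : nat -> 'rV[R]_d -> R) :
  (forall s : R, ridge_closure (fun x => \sum_(j < N) s ^+ j * v j x)) ->
  forall j, (j < N)%N -> ridge_closure (v j).
Proof.
elim: N v => [//|N IH] v H j.
have low i : (i < N)%N -> ridge_closure (v i).
  move=> iN.
  have := IH (fun i x => (2 ^+ i - 2 ^+ N) * v i x) _ i iN.
  have n0 : 2 ^+ i - 2 ^+ N != 0 :> R.
    by rewrite subr_eq0 -!natrX eqr_nat eqn_exp2l// ltn_eqF.
  move=> H'; have {}H' := ridge_closure_scale (2 ^+ i - 2 ^+ N)^-1 (H' _).
  apply: ridge_closure_ext (H' _) => [x|s]; first by rewrite mulKf.
  apply: ridge_closure_ext (ridge_closure_lin (- 2 ^+ N) (H s) (H (2 * s))) => x.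
  have -> : \sum_(k < N) s ^+ k * ((2 ^+ k - 2 ^+ N) * v k x) =
      - 2 ^+ N * \sum_(k < N) s ^+ k * v k x + \sum_(k < N) (2 * s) ^+ k * v k x.
    by rewrite mulr_sumr -big_split /=; apply: eq_bigr => k _; rewrite exprMn; ring.
  by rewrite !big_ord_recr /= exprMn; ring.
rewrite ltnS leq_eqVlt => /predU1P[->|]; last exact: low.
have := ridge_closure_lin (-1) (ridge_closure_sum (index_enum 'I_N) (fun i => low _ (ltn_ord i))) (H 1).
apply: ridge_closure_ext => x; rewrite big_ord_recr /= !expr1n mul1r mulN1r addrA.
have -> : \sum_(i < N) 1 ^+ i * v i x = \sum_(i < N) v i x.
  by apply: eq_bigr => i _; rewrite expr1n mul1r.
by rewrite addNr add0r.
Qed.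

Definition affine (l : 'rV[R]_d * R) x : R := dot l.1 x + l.2.

Lemma ridge_closure_prod (ls : seq ('rV[R]_d * R)) :
  ridge_closure (fun x => \prod_(l <- ls) affine l x).
Proof.
(* Polarization with a spare power: in the power [k.+1] of [lam + s l] the coefficient of [s] is
   [k.+1] times [lam ^+ k * l], so a factor [l] is traded for one more power of a single affine
   form. *)
suff H lam k : ridge_closure (fun x => \prod_(l <- ls) affine l x * affine lam x ^+ k).
  by apply: ridge_closure_ext (H (0, 0) 0%N) => x; rewrite expr0 mulr1.
elim: ls lam k => [|l ls IH] lam k.
  by apply: ridge_closure_ext (ridge_closure_pow lam.1 lam.2 k) => x; rewrite big_nil mul1r.
have := @ridge_closure_coef k.+2
  (fun j x => \prod_(l <- ls) affine l x * (affine lam x ^+ (k.+1 - j) * affine l x ^+ j *+ 'C(k.+1, j))) _ 1%N.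
move=> H; have {}H := ridge_closure_scale (k.+1%:R)^-1 (H _ isT).
apply: ridge_closure_ext (H _) => [x|s].
  rewrite big_cons bin1 subn1 /= expr1 -[_ *+ k.+1]mulr_natr.
  by field; rewrite (addrC 1) natr1 pnatr_eq0.
apply: ridge_closure_ext (IH (lam.1 + s *: l.1, lam.2 + s * l.2) k.+1) => x.
have -> : affine (lam.1 + s *: l.1, lam.2 + s * l.2) x = affine lam x + s * affine l x.
  by rewrite /affine /= dotDl dotZl; ring.
rewrite exprDn mulr_sumr; apply: eq_bigr => j _.
rewrite exprMn -[X in _ * X]mulr_natr -[X in _ = _ * (_ * X)]mulr_natr.
by move: ('C(k.+1, j)%:R : R) => bin; ring.
Qed.

End RidgeClosure.

(** * Bernstein polynomials *)

Section BernsteinBasis.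
Variable R : realType.

(** The Bernstein polynomial ['C(k, c) * t ^+ c * (1 - t) ^+ (k - c)], by recursion on the degree;
    it vanishes for [c > k], so sums may run over a range independent of [k]. *)
Fixpoint bern k c (t : R) : R :=
  if k is k'.+1 then (1 - t) * bern k' c t + t * (if c is c'.+1 then bern k' c' t else 0)
  else (c == 0%N)%:R.

Lemma bern_small k c t : (k < c)%N -> bern k c t = 0.
Proof.
elim: k c => [|k IH] [|c] //= kc; rewrite !IH ?mulr0 ?addr0//.
exact: leq_trans kc.
Qed.

Lemma bern_ge0 k c t : 0 <= t -> t <= 1 -> 0 <= bern k c t.
Proof.
move=> t0 t1; elim: k c => [|k IH] c /=; first by case: eqP.
by rewrite addr_ge0// mulr_ge0 ?subr_ge0//; case: c.
Qed.

(** Generating function of the binomial law: [z] = 1 gives the partition of unity, an exponential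
    [z] the moment generating function. *)
Lemma bern_gen n k t z : (k <= n)%N ->
  \sum_(c < n.+1) bern k c t * z ^+ c = (1 - t + t * z) ^+ k.
Proof.
elim: k => [|k IH] kn /=.
  rewrite big_ord_recl big1 /= ?expr0 ?mulr1 ?addr0// => i _.
  by rewrite /bump /= mul0r.
under eq_bigr do rewrite mulrDl -!mulrA.
rewrite big_split /= -mulr_sumr IH; last exact: ltnW.
rewrite -mulr_sumr big_ord_recl mul0r add0r.
have -> : \sum_(i < n) (match nat_of_ord (lift ord0 i) with 0%N => 0 | c.+1 => bern k c t end) * z ^+ lift ord0 i
    = z * \sum_(c < n.+1) bern k c t * z ^+ c.
  rewrite [in RHS]big_ord_recr /= (bern_small t kn) mul0r addr0 mulr_sumr.
  by apply: eq_bigr => i _; rewrite /= /bump leq0n add1n exprS; ring.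
by rewrite IH ?(ltnW kn)// exprS; ring.
Qed.

Lemma is_derive_bern k c (t : R) : is_derive t (1 : R) (bern k c)
  (k%:R * ((if c is c'.+1 then bern k.-1 c' t else 0) - bern k.-1 c t)).
Proof.
elim: k c => [|k IH] c.
  by rewrite mul0r; exact: is_derive_cst.
have d1 (f : R -> R) df : is_derive t (1 : R) f df ->
    is_derive t (1 : R) (fun t => (1 - t) * f t) ((1 - t) * df - f t).
  move=> fd; have h : is_derive t (1 : R) (fun t : R => 1 - t) (- 1).
    by have := is_deriveB (is_derive_cst (1 : R) t (1 : R)) (is_derive_id t (1 : R)); rewrite sub0r.
  by have := is_deriveM h fd; congr is_derive; rewrite /GRing.scale /=; ring.
have d2 (f : R -> R) df : is_derive t (1 : R) f df ->
    is_derive t (1 : R) (fun t => t * f t) (t * df + f t).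
  move=> fd; have := is_deriveM (is_derive_id t (1 : R)) fd.
  by congr is_derive; rewrite /GRing.scale /=; ring.
have d0 : is_derive t (1 : R) (fun=> 0 : R) 0 by exact: is_derive_cst.
rewrite [k.+1.-1]/=.
case: k IH => [|k] IH.
  case: c => [|c].
    have := is_deriveD (d1 _ _ (IH 0%N)) (d2 _ _ d0).
    by congr is_derive => /=; ring.
  have := is_deriveD (d1 _ _ (IH c.+1)) (d2 _ _ (IH c)).
  by congr is_derive => /=; ring.
case: c => [|[|c]].
- have := is_deriveD (d1 _ _ (IH 0%N)) (d2 _ _ d0).
  by congr is_derive; rewrite -[k.+2%:R]natr1 /=; ring.
- have := is_deriveD (d1 _ _ (IH 1%N)) (d2 _ _ (IH 0%N)).
  by congr is_derive; rewrite -[k.+2%:R]natr1 /=; ring.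
- have := is_deriveD (d1 _ _ (IH c.+2)) (d2 _ _ (IH c.+1)).
  by congr is_derive; rewrite -[k.+2%:R]natr1 /=; ring.
Qed.

(* Summation by parts: differentiating the basis amounts to differencing the
   coefficients. *)
Lemma bern_by_parts n k (G : nat -> R) t : (k <= n)%N ->
  \sum_(c < n.+1) k%:R * ((if val c is c'.+1 then bern k.-1 c' t else 0) - bern k.-1 c t) * G c
  = k%:R * \sum_(c < n.+1) bern k.-1 c t * (G c.+1 - G c).
Proof.
case: k => [|k] kn.
  by rewrite mul0r big1// => c _; rewrite !mul0r.
rewrite mulr_sumr [X in _ = X](_ : _ = \sum_(c < n.+1) (k.+1%:R * bern k c t * G c.+1
   - k.+1%:R * bern k c t * G c)); last by apply: eq_bigr => c _ /=; ring.
rewrite [X in X = _](_ : _ = \sum_(c < n.+1) (k.+1%:R * (if val c is c'.+1 then bern k c' t else 0) * G c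
   - k.+1%:R * bern k c t * G c)); last first.
  by apply: eq_bigr => c _; rewrite /=; move: (G c); case: (nat_of_ord c) => [|b] g; ring.
rewrite !sumrB; congr (_ - _).
rewrite big_ord_recl /= mulr0 mul0r add0r [RHS]big_ord_recr /= (bern_small t kn) mulr0 mul0r addr0.
by apply: eq_bigr => c _; rewrite /bump /= ?add1n.
Qed.

End BernsteinBasis.

(** * Bernstein operators on a cube *)

Section BernsteinOperators.
Variables (R : realType) (d n : nat) (M : R).
Hypothesis M_gt0 : 0 < M.
Hypothesis n_gt0 : (0 < n)%N.
Implicit Types (x y : 'rV[R]_d) (g : 'rV[R]_d -> R) (i j : 'I_d).

Definition node (c : nat) : R := - M + 2 * M * (c%:R / n%:R).
Definition tau (a : R) : R := (a + M) / (2 * M).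
Definition step : R := 2 * M / n%:R.
Definition upd x i (a : R) : 'rV[R]_d := \row_k (if k == i then a else x 0 k).

(** The degree is [k] but the nodes keep the spacing of degree [n]: a derivative lowers the degree
    and leaves the mesh unchanged, so all differences are taken with the same [step]. *)
Definition Bop i k g x : R :=
  \sum_(c < n.+1) bern k c (tau (x 0 i)) * g (upd x i (node c)).
Definition Lop (l : seq 'I_d) (K : 'I_d -> nat) g : 'rV[R]_d -> R :=
  foldr (fun i => Bop i (K i)) g l.

Definition delta i g x : R := (g (x + step *: ej R i) - g x) / step.

Definition box x : Prop := forall i, `|x 0 i| <= M.

Lemma upd_same x i a : upd x i a 0 i = a.
Proof. by rewrite mxE eqxx. Qed.

Lemma upd_other x i j a : j != i -> upd x i a 0 j = x 0 j.
Proof. by rewrite mxE => /negbTE ->. Qed.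

Lemma tau_itv a : `|a| <= M -> 0 <= tau a /\ tau a <= 1.
Proof.
rewrite ler_norml => /andP[a1 a2].
have M2 : 0 < 2 * M by rewrite mulr_gt0.
split; first by rewrite divr_ge0 ?(ltW M2)//; lra.
by rewrite ler_pdivrMr//; lra.
Qed.

Lemma node_box c : (c <= n)%N -> `|node c| <= M.
Proof.
move=> cn; have n0 : 0 < (n%:R : R) by rewrite ltr0n.
have c1 : c%:R / n%:R <= 1 :> R by rewrite ler_pdivrMr// mul1r ler_nat.
have c0 : 0 <= c%:R / n%:R :> R by rewrite divr_ge0.
rewrite /node ler_norml; move: (c%:R / n%:R) c0 c1 => q q0 q1.
have h1 := mulr_ge0 (ltW M_gt0) q0.
have h2 : M * q <= M by rewrite ler_piMr// ltW.
by apply/andP; split; lra.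
Qed.

Lemma box_upd x i c : box x -> (c <= n)%N -> box (upd x i (node c)).
Proof.
move=> bx cn k; rewrite mxE; case: eqP => _; last exact: bx.
exact: node_box.
Qed.

Lemma nodeS c : node c.+1 = node c + step.
Proof. by rewrite /node /step -[c.+1%:R]natr1; ring. Qed.

Lemma Bop_le i k g g' : (forall y, box y -> g y <= g' y) ->
  forall x, box x -> Bop i k g x <= Bop i k g' x.
Proof.
move=> gg' x bx; have [t0 t1] := tau_itv (bx i).
apply: ler_sum => c _; rewrite ler_wpM2l ?bern_ge0//; apply: gg'.
by apply: box_upd => //; rewrite -ltnS.
Qed.

Lemma Bop_cst i k a x : (k <= n)%N -> Bop i k (fun=> a) x = a.
Proof.
move=> kn; rewrite /Bop -mulr_suml.
have := bern_gen (tau (x 0 i)) 1 kn; under eq_bigr do rewrite expr1n mulr1.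
by move=> ->; rewrite mulr1 subrK expr1n mul1r.
Qed.

(** Positivity, the source of the error bounds: majorants are transported from the function to the
    polynomial. *)
Lemma Lop_le l K g g' : (forall y, box y -> g y <= g' y) ->
  forall x, box x -> Lop l K g x <= Lop l K g' x.
Proof. by move=> gg'; elim: l => //= i l IH; exact: Bop_le. Qed.

Lemma Lop_cst l K a x : (forall i, (K i <= n)%N) -> Lop l K (fun=> a) x = a.
Proof.
move=> Kn; elim: l x => //= i l IH x.
rewrite (_ : Lop l K (fun=> a) = fun=> a); first exact: Bop_cst.
by apply/funext.
Qed.

Lemma Lop_lin l K a g g' x : Lop l K (fun y => a * g y + g' y) x = a * Lop l K g x + Lop l K g' x.
Proof.
elim: l x => //= i l IH x; rewrite /Bop mulr_sumr -big_split /=.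
by apply: eq_bigr => c _; rewrite IH; ring.
Qed.

Lemma Lop_sum (I : Type) (r : seq I) (F : I -> 'rV[R]_d -> R) l K x :
  (forall i, (K i <= n)%N) ->
  Lop l K (fun y => \sum_(p <- r) F p y) x = \sum_(p <- r) Lop l K (F p) x.
Proof.
move=> Kn; elim: r x => [|p r IH] x.
  rewrite big_nil (_ : (fun y => _) = fun=> 0); first exact: Lop_cst.
  by apply/funext => y; rewrite big_nil.
rewrite big_cons -IH -[X in X + _]mul1r -Lop_lin; congr Lop.
by apply/funext => y; rewrite big_cons mul1r.
Qed.

Lemma Lop_coord l K i (phi : R -> R) x : uniq l -> i \in l -> (forall i, (K i <= n)%N) ->
  Lop l K (fun y => phi (y 0 i)) x = \sum_(c < n.+1) bern (K i) c (tau (x 0 i)) * phi (node c).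
Proof.
move=> + + Kn; elim: l x => //= j l IH x /andP[jl ul]; rewrite inE => /orP[/eqP ij|il].
  subst j; rewrite /Bop; apply: eq_bigr => c _; congr (_ * _).
  have notin l' y : i \notin l' -> Lop l' K (fun y => phi (y 0 i)) y = phi (y 0 i).
    elim: l' y => //= j' l' IH' y; rewrite inE negb_or => /andP[ij' il'].
    rewrite (_ : Lop l' K _ = fun y => phi (y 0 i)); last by apply/funext => z; exact: IH'.
    rewrite /Bop -[RHS](@Bop_cst j' (K j') _ y (Kn j')) /Bop.
    by apply: eq_bigr => c' _; rewrite upd_other.
  by rewrite notin// upd_same.
have ij : i != j by apply: contraNneq jl => <-.
rewrite /Bop -[RHS](@Bop_cst j (K j) _ x (Kn j)) /Bop.
by apply: eq_bigr => c' _; rewrite IH// upd_other.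
Qed.

Lemma is_derive_lineP (V : normedModType R) (f : V -> R) (x v : V) l :
  is_derive (0 : R) (1 : R) (fun t : R => f (x + t *: v)) l <-> is_derive x v f l.
Proof.
have E (h : R) : h^-1 *: (((fun t : R => f (x + t *: v)) \o shift (0 : R)) (h *: (1 : R)) -
    f (x + 0 *: v)) = h^-1 *: ((f \o shift x) (h *: v) - f x).
  by rewrite /= scale0r !addr0 (_ : h *: (1 : R) = h) ?[x + _]addrC//; exact: mulr1.
split=> -[dv dE]; split.
- by move: dv; rewrite /derivable; under eq_fun do rewrite E.
- by rewrite -dE /derive; congr (lim _); under [in RHS]eq_fun do rewrite E.
- by move: dv; rewrite /derivable; under [in X in _ -> X]eq_fun do rewrite E.
- by rewrite -dE /derive; congr (lim _); under [in LHS]eq_fun do rewrite E.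
Qed.

Lemma shift_coord_same x i t : (x + t *: ej R i) 0 i = x 0 i + t.
Proof. by rewrite !mxE !eqxx mulr1. Qed.

Lemma shift_coord_other x i j t : j != i -> (x + t *: ej R i) 0 j = x 0 j.
Proof. by rewrite !mxE => /negbTE ->; rewrite andbF mulr0 addr0. Qed.

Lemma upd_shift_same x i a t : upd (x + t *: ej R i) i a = upd x i a.
Proof. by apply/rowP => k; rewrite !mxE eqxx; case: eqP => //= _; rewrite mulr0 addr0. Qed.

Lemma upd_shift_other x i j a t : j != i ->
  upd (x + t *: ej R i) j a = upd x j a + t *: ej R i.
Proof.
move=> ji; apply/rowP => k; rewrite !mxE eqxx /=; case: eqP => // ->.
by rewrite (negbTE ji) mulr0 addr0.
Qed.

Lemma upd_node_step x i c : upd x i (node c) + step *: ej R i = upd x i (node c.+1).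
Proof.
apply/rowP => k; rewrite !mxE eqxx /= nodeS; case: eqP => _; first by rewrite mulr1.
by rewrite mulr0 addr0.
Qed.

Lemma Bop_delta_other i j k g x : j != i -> Bop j k (delta i g) x = delta i (Bop j k g) x.
Proof.
move=> ji; rewrite /delta /Bop -sumrB mulr_suml; apply: eq_bigr => c _.
rewrite upd_shift_other// shift_coord_other//.
by rewrite mulrA mulrBr.
Qed.

Lemma Lop_delta_notin l K i g x : i \notin l -> Lop l K (delta i g) x = delta i (Lop l K g) x.
Proof.
elim: l x => //= j l IH x; rewrite inE negb_or => /andP[ij il].
rewrite (_ : Lop l K (delta i g) = delta i (Lop l K g)); last by apply/funext => y; exact: IH.
by rewrite Bop_delta_other// eq_sym.
Qed.

(** The chain rule through [tau] brings [1 / (2 * M)], summation by parts the degree [K i] and a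
    difference between neighbouring nodes; writing it as [delta] times [step] leaves [K i / n].
    Operators in the other coordinates commute with [delta i]. *)
Lemma is_derive_Lop l K i g x : uniq l -> i \in l -> (forall i, (K i <= n)%N) ->
  is_derive x (ej R i) (Lop l K g)
    ((K i)%:R / n%:R * Lop l (fun j => (K j - (j == i))%N) (delta i g) x).
Proof.
have n0 : (n%:R : R) != 0 by rewrite pnatr_eq0 -lt0n.
have M0 : M != 0 by rewrite gt_eqF.
move=> + + Kn; elim: l x => //= j l IH x /andP[jl ul]; rewrite inE => /orP[/eqP ij|il].
  subst j; apply/is_derive_lineP.
  have LE : Lop l (fun j => (K j - (j == i))%N) (delta i g) = delta i (Lop l K g).
    apply/funext => y; rewrite -Lop_delta_notin//; move: jl; elim: l {IH ul} y => //= j l IH y.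
    rewrite inE negb_or eq_sym => /andP[/negbTE ij il]; rewrite ij subn0.
    by congr Bop; apply/funext => z; exact: IH.
  rewrite LE eqxx subn1.
  have Ed c : is_derive (0 : R) (1 : R)
      (fun t : R => bern (K i) c (tau ((x + t *: ej R i) 0 i)) * Lop l K g (upd (x + t *: ej R i) i (node c)))
      ((2 * M)^-1 * ((K i)%:R * ((if c is c'.+1 then bern (K i).-1 c' (tau (x 0 i)) else 0) -
         bern (K i).-1 c (tau (x 0 i)))) * Lop l K g (upd x i (node c))).
    rewrite (_ : (fun t => _) = (fun t : R => Lop l K g (upd x i (node c)) *
        bern (K i) c (t * (2 * M)^-1 + tau (x 0 i)))); last first.
      apply/funext => t; rewrite upd_shift_same shift_coord_same mulrC.
      by congr (_ * bern _ _ _); rewrite /tau; ring.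
    have := is_derive_bern (K i) c (0 * (2 * M)^-1 + tau (x 0 i)).
    rewrite {2 3}mul0r add0r => bd.
    have ad : is_derive (0 : R) (1 : R) (fun t : R => t * (2 * M)^-1 + tau (x 0 i)) (2 * M)^-1.
      have := is_deriveD (is_deriveM (is_derive_id (0 : R) (1 : R)) (is_derive_cst ((2 * M)^-1) (0 : R) (1 : R)))
        (is_derive_cst (tau (x 0 i)) (0 : R) (1 : R)).
      by congr is_derive; rewrite /GRing.scale /= mul0r add0r addr0 mulr1.
    have := is_deriveZ (Lop l K g (upd x i (node c))) (@is_derive1_comp R (bern (K i) c) (fun t : R => t * (2 * M)^-1 + tau (x 0 i)) 0 _ _ bd ad).
    by congr is_derive; rewrite /GRing.scale /=; ring.
  have := @is_derive_bigsum R n.+1 _ _ 0 (fun c _ => Ed c).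
  congr is_derive.
  rewrite [in RHS]/Bop.
  have BP := bern_by_parts (fun c => Lop l K g (upd x i (node c))) (tau (x 0 i)) (Kn i).
  transitivity ((2 * M)^-1 * \sum_(c < n.+1) (K i)%:R * ((if val c is c'.+1 then bern (K i).-1 c' (tau (x 0 i)) else 0)
     - bern (K i).-1 c (tau (x 0 i))) * Lop l K g (upd x i (node c))).
    by rewrite mulr_sumr; apply: eq_bigr => c _; rewrite !mulrA.
  rewrite BP -mulrA mulrCA; congr (_ * _); rewrite !mulr_sumr; apply: eq_bigr => c _.
  by rewrite /delta upd_node_step /step; field; rewrite n0 M0.
have ij : j != i by apply: contraNneq jl => ->.
rewrite (negbTE ij) subn0; apply/is_derive_lineP.
have Ed (c : nat) : is_derive (0 : R) (1 : R)
    (fun t : R => bern (K j) c (tau ((x + t *: ej R i) 0 j)) * Lop l K g (upd (x + t *: ej R i) j (node c)))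
    (bern (K j) c (tau (x 0 j)) * ((K i)%:R / n%:R *
       Lop l (fun j => (K j - (j == i))%N) (delta i g) (upd x j (node c)))).
  rewrite (_ : (fun t => _) = (fun t : R => bern (K j) c (tau (x 0 j)) *
      Lop l K g (upd x j (node c) + t *: ej R i))); last first.
    by apply/funext => t; rewrite upd_shift_other// shift_coord_other.
  exact: is_deriveZ ((is_derive_lineP _ _ _ _).2 (IH _ ul il)).
have := @is_derive_bigsum R n.+1 _ _ 0 (fun c _ => Ed c).
congr is_derive; rewrite /Bop mulr_sumr; apply: eq_bigr => c _; ring.
Qed.

End BernsteinOperators.

(** * Partial derivatives of Bernstein polynomials *)

Section BernsteinJets.
Variables (R : realType) (d n : nat) (M : R).
Hypothesis M_gt0 : 0 < M.
Hypothesis n_gt0 : (0 < n)%N.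
Implicit Types (x y : 'rV[R]_d) (g : 'rV[R]_d -> R) (i j : 'I_d) (s : seq 'I_d).

Definition degs s i : nat := (n - count_mem i s)%N.

Fixpoint falling s : R := if s is i :: s' then (degs s' i)%:R / n%:R * falling s' else 1.

Definition deltas s g : 'rV[R]_d -> R := foldr (delta n M) g s.

(* The partial derivatives of a Bernstein polynomial are Bernstein polynomials of
   lower degree of its difference quotients, up to the factor [falling s]. *)
Definition bernstein_jet g s x : R :=
  falling s * Lop n M (enum 'I_d) (degs s) (deltas s g) x.

Lemma degs_le s i : (degs s i <= n)%N.
Proof. exact: leq_subr. Qed.

Lemma bernstein_jetP g s i x :
  is_derive x (ej R i) (bernstein_jet g s) (bernstein_jet g (i :: s) x).
Proof.
have := is_deriveZ (falling s) (is_derive_Lop M_gt0 n_gt0 (deltas s g) x (enum_uniq _)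
  (mem_enum 'I_d i) (degs_le s)).
congr is_derive; rewrite /GRing.scale /bernstein_jet /= mulrA [falling s * _]mulrC; congr (_ * Lop _ _ _ _ _ _).
by apply/funext => j; rewrite /degs /= addnC subnDA eq_sym.
Qed.

(** Every factor is at least [1 - q / n], and a product of numbers in [0, 1] falls short of 1 by at
    most the sum of the shortfalls. *)
Lemma falling_bounds s q : (size s <= q)%N ->
  [/\ 0 <= falling s, falling s <= 1 & 1 - falling s <= (size s)%:R * (q%:R / n%:R)].
Proof.
have n0 : 0 < (n%:R : R) by rewrite ltr0n.
elim: s => [|i s IH] sq /=; first by rewrite subrr mul0r.
have [f0 f1 f2] := IH (ltnW sq).
have a0 : 0 <= (degs s i)%:R / n%:R :> R by rewrite divr_ge0.
have a1 : (degs s i)%:R / n%:R <= 1 :> R by rewrite ler_pdivrMr// mul1r ler_nat degs_le.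
have a2 : 1 - (degs s i)%:R / n%:R <= q%:R / n%:R :> R.
  rewrite lerBlDr -mulrDl ler_pdivlMr// mul1r -natrD ler_nat /degs.
  have := count_size (pred1 i) s => cs.
  rewrite (leq_trans _ (leq_add (leq_trans cs (ltnW sq)) (leqnn _)))//.
  by rewrite -leq_subLR.
move: (_ / n%:R) a0 a1 a2 => a a0 a1 a2; split.
- exact: mulr_ge0.
- by rewrite mulr_ile1.
rewrite -[(size s).+1%:R]natr1 mulrDl mul1r; nra.
Qed.

(** Coordinates already summed over by the operator are frozen at a node ([Some]); the others remain
    variables. *)
Definition assign (a : 'I_d -> option R) x : 'rV[R]_d := \row_k odflt (x 0 k) (a k).

Lemma upd_assign a x i v :
  upd (assign a x) i v = assign (fun k => if k == i then Some v else a k) x.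
Proof. by apply/rowP => k; rewrite !mxE; case: eqP. Qed.

Section Membership.
Variables (A : nat -> R -> R) (m : nat).
Hypothesis Ad : forall l (t : R), is_derive t (1 : R) (A l.+1) (A l t).
Hypothesis Ac : continuous (A 0%N).
Hypothesis An : forall p, exists b : R, iter p dif (A m) b != 0.
Hypothesis m_gt0 : (0 < m)%N.

(** The closure is not known to be stable under products; building multiplication by affine forms
    into the property lets Bernstein polynomials be assembled one affine factor at a time. *)
Let mult_closed g := forall ls, ridge_closure A m (fun x => (\prod_(l <- ls) affine l x) * g x).

Let mult_closed_ext f g : (forall x, f x = g x) -> mult_closed f -> mult_closed g.
Proof.
by move=> E H ls; apply: ridge_closure_ext (H ls) => x; rewrite E.
Qed.

Let mult_closed_scale a f : mult_closed f -> mult_closed (fun x => a * f x).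
Proof.
move=> H ls; apply: ridge_closure_ext (ridge_closure_scale a (H ls)) => x.
by rewrite mulrCA.
Qed.

Let mult_closed_add f g : mult_closed f -> mult_closed g -> mult_closed (fun x => f x + g x).
Proof.
move=> Hf Hg ls; apply: ridge_closure_ext (ridge_closure_lin 1 (Hf ls) (Hg ls)) => x.
by rewrite mul1r mulrDr.
Qed.

Let mult_closed_affine l f : mult_closed f -> mult_closed (fun x => affine l x * f x).
Proof.
move=> H ls; apply: ridge_closure_ext (H (l :: ls)) => x.
by rewrite big_cons mulrCA mulrA.
Qed.

Let mult_closed_sum N (f : nat -> 'rV[R]_d -> R) : (forall c, mult_closed (f c)) ->
  mult_closed (fun x => \sum_(c < N) f c x).
Proof.
move=> H; elim: N => [|N IH].
  apply: mult_closed_ext (mult_closed_scale 0 (H 0%N)) => x.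
  by rewrite big_ord0 mul0r.
by apply: mult_closed_ext (mult_closed_add IH (H N)) => x; rewrite big_ord_recr.
Qed.

Let mult_closed_bern k c l f : mult_closed f ->
  mult_closed (fun x => bern k c (affine l x) * f x).
Proof.
move=> Hf; elim: k c => [|k IH] c.
  exact: (mult_closed_scale _ Hf).
have H1 : mult_closed (fun x => affine (- l.1, 1 - l.2) x * (bern k c (affine l x) * f x)).
  exact/mult_closed_affine/IH.
have H2 : mult_closed (fun x => affine l x *
    ((if c is c'.+1 then bern k c' (affine l x) else 0) * f x)).
  apply: mult_closed_affine; case: c {H1} => [|c]; last exact: IH.
  exact: (mult_closed_scale 0 Hf).
apply: mult_closed_ext (mult_closed_add H1 H2) => x /=.
rewrite {1}/affine /= (_ : dot (- l.1) x = - dot l.1 x); last first.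
  by rewrite -scaleN1r dotZl mulN1r.
by rewrite [in RHS]/affine; case: c {H1 H2} => [|c]; rewrite /affine; ring.
Qed.

Let mult_closed_Lop K g l (a : 'I_d -> option R) : (forall k, k \notin l -> a k != None) ->
  mult_closed (fun x => Lop n M l K g (assign a x)).
Proof.
elim: l a => [|i l IH] a H /=.
  have E x : assign a x = assign a 0.
    by apply/rowP => k; rewrite !mxE; case: (a k) (H k isT).
  move=> ls; apply: ridge_closure_ext (ridge_closure_scale (g (assign a 0))
    (ridge_closure_prod Ad Ac An m_gt0 ls)) => x.
  by rewrite E mulrC.
apply: (@mult_closed_sum n.+1 (fun c x => bern (K i) c (tau M (assign a x 0 i)) *
  Lop n M l K g (upd (assign a x) i (node n M c)))) => c.
have IHc : mult_closed (fun x => Lop n M l K g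
    (assign (fun k => if k == i then Some (node n M c) else a k) x)).
  apply: IH => k kl; have [//|ki] := eqVneq k i; apply: H.
  by rewrite inE negb_or ki.
case E : (a i) => [v|].
  apply: mult_closed_ext (mult_closed_scale (bern (K i) c (tau M v)) IHc) => x.
  by rewrite upd_assign [assign a x 0 i]mxE E.
have := @mult_closed_bern (K i) c ((2 * M)^-1 *: ej R i, M / (2 * M)) _ IHc.
apply: mult_closed_ext => x; rewrite upd_assign; congr (bern _ _ _ * _).
by rewrite /affine /= dotZl dotC dot_ej /tau [assign a x 0 i]mxE E /=; ring.
Qed.

Lemma ridge_closure_bernstein g : ridge_closure A m (bernstein_jet g [::]).
Proof.
have := @mult_closed_Lop (degs [::]) g (enum 'I_d) (fun=> None) _ [::].
move=> H; apply: ridge_closure_ext (H _) => [x|k].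
  rewrite big_nil /bernstein_jet /= !mul1r; congr Lop.
  by apply/rowP => k; rewrite mxE.
by rewrite mem_enum.
Qed.

Lemma bernstein_approx g (e r : R) : 0 < e -> exists L, forall s x, (size s <= m)%N ->
  `|x| <= r -> `|bernstein_jet g s x - rpot A m L s x| <= e.
Proof.
move=> e0; have [J [J0 J1 J2]] := ridge_closure_bernstein g.
have [L HL] := J2 r e e0; exists L => s x sm xr.
rewrite -(@jet_unique R m d J (bernstein_jet g) J1 _ J0)//; first exact: HL.
by move=> s' i y _; exact: bernstein_jetP.
Qed.

End Membership.

Lemma delta_comm i j g : delta n M i (delta n M j g) = delta n M j (delta n M i g).
Proof.
apply/funext => x; rewrite /delta.
by rewrite [x + _ + _ *: ej R j]addrAC; ring.
Qed.

Lemma deltas_comm i s g : delta n M i (deltas s g) = deltas s (delta n M i g).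
Proof. by elim: s => //= j s IH; rewrite delta_comm IH. Qed.

Let h := step n M.

Let h_gt0 : 0 < h.
Proof. by rewrite /h /step divr_gt0 ?ltr0n// mulr_gt0. Qed.

(** This grows like the power [size s] of [n]; it serves far from the evaluation point, where the
    Bernstein weights are exponentially small. *)
Lemma deltas_bound s g B y : (forall y, `|g y| <= B) -> `|deltas s g y| <= (2 / h) ^+ size s * B.
Proof.
move=> gB; elim: s y => [|i s IH] y /=; first by rewrite expr0 mul1r.
rewrite /delta normrM normfV (gtr0_norm h_gt0) ler_pdivrMr//.
apply: (le_trans (ler_normB _ _)).
have -> : (2 / h) ^+ (size s).+1 * B * step n M = (2 / h) ^+ size s * B + (2 / h) ^+ size s * B.
  by rewrite exprS /h; field; rewrite gt_eqF.
by rewrite lerD.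
Qed.

Lemma norm_ej i (t : R) : `|t *: ej R i| <= `|t|.
Proof.
rewrite normrZ ler_piMr//.
rewrite [leLHS]/Num.norm /= mx_normrE; apply: bigmax_le => // k _ /=.
by rewrite /ej mxE; case: (_ && _); rewrite ?normr0 ?normr1.
Qed.

(** One mean value step per difference. Induction is applied to the jet differenced in direction
    [i], available on a radius smaller by [h]; that difference is then traded for a derivative on a
    segment of length [h]. *)
Lemma deltas_mvt q s (J : seq 'I_d -> 'rV[R]_d -> R) g y rho :
  (size s <= q)%N ->
  (forall s i z, (size s < q)%N -> `|z - y| <= rho -> is_derive z (ej R i) (J s) (J (i :: s) z)) ->
  (forall z, `|z - y| <= rho -> g z = J [::] z) -> (size s)%:R * h <= rho ->
  exists2 xi, `|xi - y| <= (size s)%:R * h & deltas s g y = J s xi.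
Proof.
elim: s J g rho => [|i s IH] J g rho sq HJ gJ srho.
  exists y; first by rewrite subrr normr0 mul0r.
  by apply: gJ; rewrite subrr normr0; rewrite mul0r in srho.
have hrho : h <= rho.
  by apply: le_trans srho; rewrite ler_peMl ?(ltW h_gt0)// ler1n.
have shift_near z t : `|z - y| <= rho - h -> 0 <= t <= h -> `|z + t *: ej R i - y| <= rho.
  move=> zy /andP[t0 th]; rewrite addrAC (le_trans (ler_normD _ _))//.
  rewrite -[rho](subrK h) lerD// (le_trans (norm_ej _ _))// ger0_norm//.
have near z : `|z - y| <= rho - h -> `|z - y| <= rho.
  by move/le_trans; apply; rewrite gerBl ltW.
have h0h : 0 <= h <= h by rewrite lexx ltW.
have [||||xi xiy E] := IH (fun s => delta n M i (J s)) (delta n M i g) (rho - h).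
- exact: ltnW.
- move=> s' k z s'q zy; rewrite /delta.
  have d1 := HJ s' k (z + h *: ej R i) s'q (shift_near z h zy h0h).
  have d2 := HJ s' k z s'q (near z zy).
  have d1' : is_derive z (ej R k) (fun x => J s' (x + h *: ej R i)) (J (k :: s') (z + h *: ej R i)).
    apply/is_derive_lineP; have := (is_derive_lineP _ _ _ _).2 d1.
    by under eq_fun do rewrite addrAC.
  have := is_deriveZ (h^-1) (is_deriveB d1' d2).
  rewrite /GRing.scale /= [h^-1 * _]mulrC; congr is_derive.
  by apply/funext => x; rewrite /GRing.scale /= mulrC.
- move=> z zy; rewrite /delta (gJ _ (near z zy)) (gJ (z + _))//.
  exact: (shift_near z h zy h0h).
- by rewrite lerBrDr; move: srho; rewrite -[(size s).+1%:R]natr1 mulrDl mul1r.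
have xirho : `|xi - y| <= rho - h.
  by rewrite (le_trans xiy)// lerBrDr; move: srho; rewrite -[(size s).+1%:R]natr1 mulrDl mul1r.
have sq' : (size s < q)%N by [].
pose phi (t : R) := J s (xi + t *: ej R i).
have phid (t : R) : 0 <= t <= h -> is_derive t (1 : R) phi (J (i :: s) (xi + t *: ej R i)).
  move=> th; have := (is_derive_lineP _ _ _ _).2 (HJ s i _ sq' (shift_near xi t xirho th)).
  move=> dd; apply/(@is_derive_lineP R R phi t (1 : R)).
  move: dd; congr is_derive; apply/funext => u.
  by rewrite /phi -addrA -scalerDl; congr (J s (_ + _ *: _)); rewrite /GRing.scale /= mulr1.
have phic : {within `[0, h], continuous phi}.
  apply: continuous_in_subspaceT => t; rewrite inE /= in_itv /= => th.
  apply: differentiable_continuous; apply/derivable1_diffP.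
  exact: (@ex_derive _ _ _ _ _ _ _ (phid t th)).
have [|c] := @MVT_segment R phi (fun t => J (i :: s) (xi + t *: ej R i)) 0 h (ltW h_gt0) _ phic.
  by move=> t; rewrite in_itv /= => /andP[t0 th]; apply: phid; rewrite !ltW.
rewrite in_itv /= => ch; rewrite /phi scale0r addr0 subr0 => Ec.
exists (xi + c *: ej R i).
  rewrite addrAC (le_trans (ler_normD _ _))// -[(size s).+1%:R]natr1 mulrDl mul1r lerD//.
  by case/andP: ch => c0 ch; rewrite (le_trans (norm_ej _ _))// ger0_norm.
rewrite /= deltas_comm E /delta -/h Ec mulfK// gt_eqF//.
Qed.

End BernsteinJets.

(** * Convergence of Bernstein polynomials with derivatives *)

Section BernsteinConvergence.
Variables (R : realType) (d : nat).
Implicit Types (x y : 'rV[R]_d) (g : 'rV[R]_d -> R) (i j : 'I_d) (s : seq 'I_d).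

Lemma expR_quadratic : exists2 E : R, 1 <= E & forall l : R, `|l| <= 1 ->
  expR l <= 1 + l + E * l ^+ 2.
Proof.
exists (expR 1); first by rewrite (le_trans _ (expR_ge1Dx 1))// lerDl.
move=> l l1.
have bd t : 0 - 1 <= t <= 0 + 1 -> `|(fun _ : nat => expR (R := R)) 2%N t| <= expR 1.
  by rewrite !add0r => /andP[_ t1]; rewrite ger0_norm ?expR_ge0// ler_expR.
have := @taylor_bound R (fun _ => expR) 1 0 (expR 1) 1 ler01
  (fun _ t _ => is_derive_expR t) bd l l1.
rewrite add0r big_ord_recl big_ord1 /= /bump /= expR0 !divr1 expr0 expr1 !mul1r.
rewrite -normrX [`|l ^+ 2|]ger0_norm ?sqr_ge0// => h.
by have := le_trans (ler_norm _) h; lra.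
Qed.

(* Moment generating function of a centred binomial variable, for the Chernoff
   bound on the mass that the Bernstein basis puts far from [x]. *)
Lemma mgf_bound (E t l : R) n k q : 1 <= E ->
  (forall l : R, `|l| <= 1 -> expR l <= 1 + l + E * l ^+ 2) ->
  0 <= t -> t <= 1 -> `|l| <= 1 -> (k <= n)%N -> (n - k <= q)%N ->
  expR (- (l * n%:R * t)) * (1 - t + t * expR l) ^+ k <= expR (q%:R + n%:R * (E * l ^+ 2)).
Proof.
move=> E1 HE t0 t1 l1 kn nkq.
have E0 : 0 <= E by exact: le_trans E1.
have h1 : 1 - t + t * expR l <= expR (t * l + E * l ^+ 2).
  apply: le_trans (expR_ge1Dx _).
  have := ler_wpM2l t0 (HE l l1).
  have h2 : t * (E * l ^+ 2) <= E * l ^+ 2 by rewrite ler_piMl// mulr_ge0// sqr_ge0.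
  lra.
have p0 : 0 <= 1 - t + t * expR l by rewrite addr_ge0 ?subr_ge0// mulr_ge0// expR_ge0.
have h2 : (1 - t + t * expR l) ^+ k <= expR (k%:R * (t * l + E * l ^+ 2)).
  by rewrite expRM_natl lerXn2r ?nnegrE ?expR_ge0.
apply: (le_trans (ler_wpM2l (expR_ge0 _) h2)).
rewrite -expRD ler_expR.
have kn' : (k%:R : R) <= n%:R by rewrite ler_nat.
have nk : n%:R - k%:R <= q%:R :> R by rewrite -natrB// ler_nat.
have nk0 : 0 <= n%:R - k%:R :> R by rewrite subr_ge0.
have lt : - (l * t) <= 1.
  by rewrite (le_trans (ler_norm _))// normrN normrM mulr_ile1// ger0_norm.
have : (n%:R - k%:R) * - (l * t) <= n%:R - k%:R by rewrite ler_piMr.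
have : k%:R * (E * l ^+ 2) <= n%:R * (E * l ^+ 2) by rewrite ler_wpM2r// mulr_ge0// sqr_ge0.
lra.
Qed.

Lemma power_exp_small (kap D e : R) q : 0 < kap -> 0 < e ->
  exists N : nat, forall n, (N <= n)%N -> D * n%:R ^+ q * expR (- (kap * n%:R)) <= e.
Proof.
move=> k0 e0.
pose c := kap / q.+1%:R.
have c0 : 0 < c by rewrite divr_gt0// ltr0n.
exists (Num.truncn (`|D| / c ^+ q.+1 / e)).+1 => n Nn.
have n0 : (0 < n)%N by exact: leq_trans Nn.
have n0' : 0 < (n%:R : R) by rewrite ltr0n.
have nD : `|D| / c ^+ q.+1 / e <= n%:R.
  by apply: (le_trans (ltW (truncnS_gt _))); rewrite ler_nat.
(* The exponential dominates a power one higher than the one to be beaten, by [1 + x <= expR x] at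
   [x = c * n%:R]. *)
have ex : (c * n%:R) ^+ q.+1 <= expR (kap * n%:R).
  have -> : kap * n%:R = q.+1%:R * (c * n%:R) by rewrite /c; field; rewrite nat1r pnatr_eq0.
  have cn0 : 0 <= c * n%:R by rewrite mulr_ge0// ltW.
  rewrite expRM_natl lerXn2r ?nnegrE ?expR_ge0//.
  by rewrite (le_trans _ (expR_ge1Dx _))// lerDr.
rewrite expRN -[X in _ * X]/((expR (kap * n%:R))^-1) ler_pdivrMr ?expR_gt0//.
apply: (le_trans (y := e * (c * n%:R) ^+ q.+1)); last by rewrite ler_pM2l.
rewrite exprMn [c ^+ q.+1]exprS [n%:R ^+ q.+1]exprS.
apply: (le_trans (y := `|D| * n%:R ^+ q)); first by rewrite ler_wpM2r ?exprn_ge0// ler_norm.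
move: nD; rewrite ler_pdivrMr// ler_pdivrMr ?exprn_gt0// exprS => nD.
apply: (le_trans (ler_wpM2r (exprn_ge0 q (ltW n0')) nD)).
by rewrite le_eqVlt; apply/orP; left; apply/eqP; ring.
Qed.

Lemma bounded_size_uniform m (P : seq 'I_d -> nat -> Prop) :
  (forall s, (size s <= m)%N -> exists N : nat, forall n, (N <= n)%N -> P s n) ->
  exists N : nat, forall n, (N <= n)%N -> forall s, (size s <= m)%N -> P s n.
Proof.
move=> H.
have /choice[N HN] (u : {i : 'I_m.+1 & i.-tuple 'I_d}) : exists N : nat,
    forall n, (N <= n)%N -> P (tagged u) n.
  by case: u => i t /=; apply: H; rewrite size_tuple -ltnS.
exists (\max_u N u) => n Nn s sm; have sm' : (size s < m.+1)%N by [].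
apply: (HN (Tagged (fun i : 'I_m.+1 => i.-tuple 'I_d)
  (in_tuple s : (nat_of_ord (Ordinal sm')).-tuple 'I_d))).
exact: leq_trans (leq_bigmax _) Nn.
Qed.

(** Three errors: the oscillation of the difference quotient near [x]; its size elsewhere times the
    mass of the weights there, with two exponential tails per coordinate; the distance of [falling]
    from 1. *)
Lemma bernstein_jet_estimate (n q : nat) (M E a delta0 B C e : R) s g (x : 'rV[R]_d) l :
  0 < M -> (0 < n)%N -> (size s <= q)%N -> box M x -> 1 <= E ->
  (forall l : R, `|l| <= 1 -> expR l <= 1 + l + E * l ^+ 2) ->
  0 < delta0 -> delta0 <= M -> a = delta0 / (2 * M) -> 0 <= e -> 0 <= C -> `|l| <= B ->
  (forall y, `|y - x| <= delta0 -> `|deltas n M s g y - l| <= e) ->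
  (forall y, `|deltas n M s g y - l| <= C) ->
  `|bernstein_jet n M g s x - l| <=
     e + C * (d%:R * (2 * expR q%:R * expR (- (a ^+ 2 / (4 * E) * n%:R)))) +
     q%:R * (q%:R / n%:R) * B.
Proof.
move=> M0 n0 sq bx E1 HE d0 dM aE e0 C0 lB near far.
have E0 : 0 < E by exact: lt_le_trans E1.
have M2 : 0 < 2 * M by rewrite mulr_gt0.
have a0 : 0 < a by rewrite aE divr_gt0.
have a1 : a <= 1 by rewrite aE ler_pdivrMr// mul1r; lra.
(* Minimises [- lam * a + E * lam ^+ 2]; the least value [- a ^+ 2 / (4 * E)] is the rate of the
   tail. *)
pose lam := a / (2 * E).
have lam0 : 0 < lam by rewrite divr_gt0// mulr_gt0.
have lam1 : lam <= 1 by rewrite ler_pdivrMr ?mulr_gt0// mul1r; lra.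
pose nM := n%:R / (2 * M).
have nM0 : 0 < nM by rewrite divr_gt0// ltr0n.
(* Exponential majorant of the indicator of the points farther than [delta0] from [x 0 i], one term
   for each side; [nM] converts lengths into numbers of nodes. *)
pose phi i (u : R) := expR (lam * ((u - x 0 i) * nM) - lam * n%:R * a) +
  expR (- lam * ((u - x 0 i) * nM) - lam * n%:R * a).
have phi0 i u : 0 <= phi i u by rewrite addr_ge0 ?expR_ge0.
have nMd : nM * delta0 = n%:R * a by rewrite /nM aE; field; rewrite gt_eqF.
have bound y : `|deltas n M s g y - l| <= e + C * \sum_(i <- enum 'I_d) phi i (y 0 i).
  have [yx|/negP yx] := boolP (`|y - x| <= delta0).
    rewrite (le_trans (near y yx))// lerDl mulr_ge0// sumr_ge0//.
  have [i yi] : exists i, delta0 < `|y 0 i - x 0 i|.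
    apply: contrapT => nH; apply: yx; apply: norm_le_coord; first exact: ltW.
    move=> i; rewrite leNgt; apply/negP => yi; apply: nH; exists i.
    by move: yi; rewrite !mxE.
  rewrite (le_trans (far y))// -[leLHS]add0r lerD// ler_peMr// big_enum (bigD1 i)//=.
  apply: (le_trans (y := phi i (y 0 i))); last by rewrite lerDl sumr_ge0.
  have yn : n%:R * a <= `|(y 0 i - x 0 i) * nM|.
    by rewrite normrM (gtr0_norm nM0) -nMd mulrC ler_wpM2r ?ltW.
  move: yn; rewrite ler_normr => /orP[] yn.
    rewrite (le_trans _ (_ : expR (lam * ((y 0 i - x 0 i) * nM) - lam * n%:R * a) <= _))//.
      by rewrite -[X in X <= _]expR0 ler_expR subr_ge0 -mulrA ler_pM2l.
    by rewrite lerDl expR_ge0.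
  rewrite (le_trans _ (_ : expR (- lam * ((y 0 i - x 0 i) * nM) - lam * n%:R * a) <= _))//.
    by rewrite -[X in X <= _]expR0 ler_expR subr_ge0 -mulrA mulNr -mulrN ler_pM2l.
  by rewrite lerDr expR_ge0.
pose K := degs n s.
have Kn i : (K i <= n)%N by exact: degs_le.
pose l' := enum 'I_d.
have Lphi i : Lop n M l' K (fun y => phi i (y 0 i)) x <=
    2 * expR q%:R * expR (- (a ^+ 2 / (4 * E) * n%:R)).
  rewrite Lop_coord ?enum_uniq ?mem_enum//.
  have [t0 t1] := tau_itv M0 (bx i).
  set t := tau M (x 0 i) in t0 t1 *.
  have nodeE c : (node n M c - x 0 i) * nM = c%:R - n%:R * t.
    rewrite /node /nM /t /tau; field; rewrite gt_eqF//= pnatr_eq0 -lt0n n0 //.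
  have half (mu : R) : `|mu| <= 1 -> mu ^+ 2 = lam ^+ 2 ->
      \sum_(c < n.+1) bern (K i) c t * expR (mu * ((node n M c - x 0 i) * nM) - lam * n%:R * a) <=
      expR q%:R * expR (- (a ^+ 2 / (4 * E) * n%:R)).
    move=> mu1 mu2.
    have -> : \sum_(c < n.+1) bern (K i) c t * expR (mu * ((node n M c - x 0 i) * nM) - lam * n%:R * a)
      = expR (- (lam * n%:R * a)) * (expR (- (mu * n%:R * t)) * (1 - t + t * expR mu) ^+ K i).
      rewrite -(bern_gen t (expR mu) (Kn i)) mulrA mulr_sumr; apply: eq_bigr => c _.
      rewrite nodeE -expRM_natl [RHS]mulrCA -!expRD; congr (_ * _); congr expR; ring.
    have nk : (n - K i <= q)%N.
      rewrite /K /degs leq_subLR (leq_trans (n := count_mem i s + (n - count_mem i s)))//.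
        by rewrite -leq_subLR.
      by rewrite addnC leq_add2l (leq_trans (count_size _ _)).
    apply: (le_trans (ler_wpM2l (expR_ge0 _) (mgf_bound E1 HE t0 t1 mu1 (Kn i) nk))).
    rewrite -!expRD ler_expR mu2 /lam.
    rewrite le_eqVlt; apply/orP; left; apply/eqP; field; rewrite gt_eqF//.
  under eq_bigr do rewrite /phi mulrDr.
  rewrite big_split /= -[X in _ <= X]mulrA [X in _ <= X]mulr_natl mulr2n.
  apply: lerD; apply: half => //.
  - by rewrite gtr0_norm.
  - by rewrite normrN gtr0_norm.
  - by rewrite sqrrN.
pose S := C * (d%:R * (2 * expR q%:R * expR (- (a ^+ 2 / (4 * E) * n%:R)))).
have LS : Lop n M l' K (fun y => C * \sum_(i <- enum 'I_d) phi i (y 0 i) + (e + 0)) x <= S + e.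
  rewrite addr0 Lop_lin Lop_cst// lerD2r ler_wpM2l// Lop_sum//.
  rewrite big_enum /= (le_trans (ler_sum _ (fun i _ => Lphi i)))//.
  by rewrite sumr_const card_ord -[leLHS]mulr_natl.
have up : Lop n M l' K (deltas n M s g) x <= l + (S + e).
  apply: (le_trans (Lop_le M0 n0 l' K (g' := fun y => 1 * (C * \sum_(i <- enum 'I_d) phi i (y 0 i) + (e + 0)) + l) _ bx)).
    move=> y _; have := le_trans (ler_norm _) (bound y); lra.
  by rewrite Lop_lin Lop_cst// mul1r addrC lerD2l.
have dn : l - (S + e) <= Lop n M l' K (deltas n M s g) x.
  apply: (le_trans _ (Lop_le M0 n0 l' K (g := fun y => (-1) * (C * \sum_(i <- enum 'I_d) phi i (y 0 i) + (e + 0)) + l) _ bx)).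
    by rewrite Lop_lin Lop_cst// mulN1r addrC lerD2r lerN2.
  move=> y _; have := bound y; rewrite ler_norml => /andP[+ _]; lra.
have [f0 f1 f2] := falling_bounds R n0 sq.
rewrite /bernstein_jet -/K -/l'; set Lv := Lop _ _ _ _ _ _ in up dn *.
have -> : falling R n s * Lv - l = falling R n s * (Lv - l) - (1 - falling R n s) * l by ring.
rewrite (le_trans (ler_normB _ _))// lerD//.
  rewrite normrM (ger0_norm f0) (le_trans (y := `|Lv - l|))//; first by rewrite ler_piMl.
  by rewrite ler_norml -/S; apply/andP; split; lra.
rewrite normrM ger0_norm ?subr_ge0// ler_pM ?subr_ge0// (le_trans f2)// ler_wpM2r ?divr_ge0//.
by rewrite ler_nat.
Qed.

Lemma ge_truncn_div (a b : R) n : 0 < b -> ((Num.truncn (a / b)).+1 <= n)%N -> a <= b * n%:R.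
Proof.
move=> b0 Nn; rewrite mulrC -ler_pdivrMr//.
by apply: (le_trans (ltW (truncnS_gt _))); rewrite ler_nat.
Qed.

(** The data live on [U] and are extended by 0 outside a compact tube around [C]. The difference
    quotients of this jumping extension grow like a power of [n] and meet exponentially small
    weights; near [C] they are values of the derivatives by the mean value theorem. *)
Lemma bernstein_converges m (J : seq 'I_d -> 'rV[R]_d -> R) (U C : set 'rV[R]_d) (e : R) :
  open U -> compact C -> C `<=` U ->
  (forall s i x, (size s < m)%N -> U x -> is_derive x (ej R i) (J s) (J (i :: s) x)) ->
  (forall s, (size s <= m)%N -> ccvg U (fun=> J s) (J s)) -> 0 < e ->
  exists (M : R) (n : nat) g, [/\ 0 < M, (0 < n)%N &
    forall s x, (size s <= m)%N -> C x -> `|bernstein_jet n M g s x - J s x| <= e].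
Proof.
move=> oU cC CU dJ cJ e0.
have [rho rho0 [C' [cC' C'U tube]]] := compact_tube (proper_rV (d := d)) cC oU CU.
have Jb s : (size s <= m)%N -> exists2 B : R, 0 < B & forall x, C' x -> `|J s x| <= B.
  move=> /cJ H; have [N [B B0 K]] := ccvg_bounded_compact H cC' C'U.
  by exists B => // x C'x; have [] := K N x (leqnn _) C'x.
pose g y := if `[< C' y >] then J [::] y else 0.
have [B0 B00 gB] : exists2 B0 : R, 0 < B0 & forall y, `|g y| <= B0.
  have [B B0 H] := Jb [::] (leq0n _); exists B => // y; rewrite /g.
  by case: asboolP => [/H//|_]; rewrite normr0 ltW.
have [M M0 CM] : exists2 M : R, 0 < M & forall x, C x -> `|x| <= M.
  have H : @ccvg R _ _ [set: 'rV[R]_d] (fun _ => id) id.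
    by move=> y _ e' e'0; apply: evtS (evt_near y e'0).
  have [N [B B0' K]] := ccvg_bounded_compact H cC (@subsetT _ _).
  by exists B => // x Cx; have [] := K N x (leqnn _) Cx.
have [E E1 HE] := expR_quadratic.
have E0 : 0 < E by exact: lt_le_trans E1.
have e3 : 0 < e / 3 by rewrite divr_gt0.
suff [N HN] : exists N : nat, forall n, (N <= n)%N -> forall s, (size s <= m)%N ->
    (0 < n)%N -> forall x, C x -> `|bernstein_jet n M g s x - J s x| <= e.
  by exists M, N.+1, g; split => // s x sm; exact: (HN N.+1 (leqnSn _) s sm isT).
apply: bounded_size_uniform => s sm.
have [B1 B10 JB] := Jb s sm.
have [N0 [dd dd0 unif]] := ccvg_unif_compact (cJ s sm) cC' C'U e3.
(* Twice [rho / 2] keeps node and stencil in the tube; twice [dd / 3] keeps the mean value point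
   within [dd] of [x]; [M] keeps [a] below 1. *)
pose delta0 := Num.min (Num.min (rho / 2) (dd / 3)) M.
have d0 : 0 < delta0 by rewrite !lt_min M0 !divr_gt0.
have dM : delta0 <= M by rewrite ge_min lexx orbT.
have drho : delta0 <= rho / 2 by rewrite !ge_min lexx.
have ddd : delta0 <= dd / 3 by rewrite !ge_min lexx orbT.
pose a : R := delta0 / (2 * M).
have a0 : 0 < a by rewrite divr_gt0// mulr_gt0.
have kap0 : 0 < a ^+ 2 / (4 * E) by rewrite divr_gt0 ?exprn_gt0// mulr_gt0.
pose q := size s.
pose D : R := (B0 / M ^+ q + B1) * (d%:R * (2 * expR q%:R)).
have [N1 HN1] := power_exp_small D q kap0 e3.
pose N2 := (Num.truncn (q%:R * q%:R * B1 / (e / 3))).+1.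
pose N3 := (Num.truncn (q%:R * (2 * M) / delta0)).+1.
exists (maxn N1 (maxn N2 N3)) => n; rewrite !geq_max => /and3P[Nn1 Nn2 Nn3] n0 x Cx.
have n0' : 0 < (n%:R : R) by rewrite ltr0n.
have n1' : 1 <= (n%:R : R) by rewrite ler1n.
have st : q%:R * step n M <= delta0.
  by rewrite /step mulrA ler_pdivrMr//; exact: ge_truncn_div.
have C'x : C' x by apply: (tube x x Cx); rewrite subrr normr0 ltW.
have bx : box M x by move=> i; rewrite (le_trans (norm_coord x i))// CM.
have BM0 : 0 <= B0 / M ^+ q by rewrite divr_ge0 ?exprn_ge0// ltW.
pose Cn : R := n%:R ^+ q * (B0 / M ^+ q + B1).
have Cn0 : 0 <= Cn by rewrite mulr_ge0 ?exprn_ge0 ?addr_ge0// ltW.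
have near y : `|y - x| <= delta0 -> `|deltas n M s g y - J s x| <= e / 3.
  move=> yx.
  have tub z : `|z - y| <= rho / 2 -> C' z.
    move=> zy; apply: (tube z x Cx); rewrite -(subrK y z) -addrA.
    by rewrite (le_trans (ler_normD _ _))//; lra.
  have [xi xiy ->] : exists2 xi, `|xi - y| <= (size s)%:R * step n M & deltas n M s g y = J s xi.
    apply: (deltas_mvt M0 n0 sm (rho := rho / 2)).
    - by move=> s' i z s'm zy; apply: dJ => //; exact/C'U/tub.
    - by move=> z zy; rewrite /g; case: asboolP => // /(_ (tub z zy)).
    - exact: le_trans drho.
  apply/ltW/(unif N0 xi x (leqnn _)) => //.
    by apply: tub; apply: le_trans xiy _; exact: le_trans drho.
  rewrite -(subrK y xi) -addrA (le_lt_trans (ler_normD _ _))//.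
  have : `|xi - y| <= dd / 3 by apply: (le_trans xiy); exact: le_trans ddd.
  have : `|y - x| <= dd / 3 by exact: le_trans ddd.
  lra.
have far y : `|deltas n M s g y - J s x| <= Cn.
  rewrite (le_trans (ler_normB _ _))// /Cn mulrDr lerD//.
    apply: (le_trans (deltas_bound M0 n0 s y gB)).
    have -> : 2 / step n M = n%:R / M by rewrite /step; field; rewrite !gt_eqF.
    by rewrite expr_div_n -/q mulrAC mulrA.
  apply: (le_trans (JB x C'x)); rewrite ler_peMl //; [exact: ltW | exact: exprn_ege1].
have := bernstein_jet_estimate M0 n0 (leqnn (size s)) bx E1 HE d0 dM
  (erefl a) (ltW e3) Cn0 (JB x C'x) near far.
move/le_trans; apply.
have := HN1 n Nn1; rewrite -/q.
have -> : Cn * (d%:R * (2 * expR q%:R * expR (- (a ^+ 2 / (4 * E) * n%:R)))) =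
  D * n%:R ^+ q * expR (- (a ^+ 2 / (4 * E) * n%:R)) by rewrite /Cn /D; ring.
have : q%:R * (q%:R / n%:R) * B1 <= e / 3.
  have -> : q%:R * (q%:R / n%:R) * B1 = q%:R * q%:R * B1 / n%:R by field; rewrite gt_eqF.
  by rewrite ler_pdivrMr//; exact: ge_truncn_div.
lra.
Qed.

End BernsteinConvergence.

(** * Jets of functions on open sets *)

Section PartialDerivatives.
Variables (R : realType) (d : nat).
Implicit Types (x y : 'rV[R]_d) (U : set 'rV[R]_d) (i j : 'I_d) (G : 'rV[R]_d -> R).

Lemma pdx_quotE U i G x : open U -> U x ->
  pdx_quot U i G x =
  (fun h : R => h^-1 *: ((G \o shift x) (h *: ej R i) - G x)) @ (0 : R)^'.
Proof.
move=> oU Ux; rewrite /pdx_quot.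
have -> : within [set t : R | t != 0 /\ U (x + t *: ej R i)] (nbhs (0 : R)) = (0 : R)^'.
  have Ut : \forall t \near (0 : R), U (x + t *: ej R i).
    have c : {for (0 : R), continuous (fun t : R => x + t *: ej R i)}.
      by apply: cvgD; [exact: cvg_cst|apply: cvgZr_tmp; exact: cvg_id].
    by apply: c; rewrite scale0r addr0; exact: open_nbhs_nbhs.
  apply/predeqP => P; rewrite /dnbhs /within /=; split.
    by move=> H; apply: filterS2 H Ut => t H Ut t0; exact: H.
  by move=> H; apply: filterS H => t H [t0 _]; exact: H.
rewrite (_ : (fun t : R => t^-1 * _) =
  (fun h : R => h^-1 *: ((G \o shift x) (h *: ej R i) - G x)))//; apply/funext => t /=.
by rewrite [_ *: _ + x]addrC.
Qed.

Lemma pdxE U i G x : open U -> U x -> pdx U i G x = 'D_(ej R i) G x.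
Proof. by move=> oU Ux; rewrite /pdx pdx_quotE. Qed.

Lemma pdx_is_derive U i G x : open U -> U x ->
  (exists l : R, pdx_quot U i G x --> l) -> is_derive x (ej R i) G (pdx U i G x).
Proof.
move=> oU Ux [l]; rewrite pdxE// pdx_quotE// => H.
by split => //; apply/cvg_ex; exists l.
Qed.

Lemma Ck_pdx U m G s : Ck U m G -> (size s <= m)%N ->
  Ck U (m - size s) (foldr (pdx U) G s).
Proof.
move=> CG; elim: s => [|i s IH] sm /=; first by rewrite subn0.
have := IH (ltnW sm); rewrite -subnSK// => -[_] /(_ i)[].
by [].
Qed.

Lemma Ck_jet U m G : open U -> Ck U m G -> forall s i x, (size s < m)%N -> U x ->
  is_derive x (ej R i) (foldr (pdx U) G s) (foldr (pdx U) G (i :: s) x).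
Proof.
move=> oU CG s i x sm Ux; apply: pdx_is_derive => //.
have := Ck_pdx CG (ltnW sm); rewrite -subnSK// => -[_] /(_ i)[H _].
exact: H.
Qed.

Lemma Ck_ccvg U m G : Ck U m G -> forall s, (size s <= m)%N ->
  ccvg U (fun=> foldr (pdx U) G s) (foldr (pdx U) G s).
Proof.
move=> CG s sm.
have H : forall x, U x -> {for x, continuous (foldr (pdx U) G s)}.
  by have := Ck_pdx CG sm; case: (m - size s)%N => [|k] [].
move=> y Uy e e0; have /cvgr_distC_lt/(_ _ e0)/nbhs_ballP[c /= c0 K] := H y Uy.
apply/evtP; exists 0%N, c => // n z _ zc _; apply: K.
by rewrite -ball_normE /= distrC.
Qed.

(** The tangent of [g n s] is linear in [v] with coefficients [g n (k :: s)]; sums and products of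
    convergent families carry the induction on the order. *)
Lemma jet_Ccvg m U (g : nat -> seq 'I_d -> 'rV[R]_d -> R) (J : seq 'I_d -> 'rV[R]_d -> R) :
  open U ->
  (forall n s y, (size s < m)%N ->
     is_diff y (g n s) (fun v => \sum_(k <- enum 'I_d) v 0 k * g n (k :: s) y)) ->
  (forall s, (size s <= m)%N -> ccvg U (fun n => g n s) (J s)) ->
  forall k s, (size s + k <= m)%N -> Ccvg k U (fun n => g n s) (J s).
Proof.
move=> oU dg gJ; elim=> [|k IH] s sk; first by apply: gJ; rewrite addn0 in sk.
have sm : (size s < m)%N by apply: leq_trans sk; rewrite addnS ltnS leq_addr.
exists (fun n y (v : 'rV[R]_d) => \sum_(k <- enum 'I_d) v 0 k * g n (k :: s) y),
  (fun y (v : 'rV[R]_d) => \sum_(k <- enum 'I_d) v 0 k * J (k :: s) y); split; first by move=> n y; exact: dg.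
have Cfst : Ccvg k (U `*` setT) (fun _ : nat => @fst 'rV[R]_d 'rV[R]_d) (fun z => z.1).
  by apply: (Ccvg_lin k _ (f := fst)) => [a [? ?] [? ?]//|z]; exact: cvg_fst.
have comp s' : (size s' + k <= m)%N ->
    Ccvg k (U `*` [set: 'rV[R]_d]) (fun n z => g n s' z.1) (fun z => J s' z.1).
  by move=> s'k; apply: (Ccvg_comp_open oU _ (IH s' s'k) Cfst) => y [].
apply: Ccvg_pair; first by apply: comp; apply: leq_trans sk; rewrite addnS.
apply: Ccvg_sum => j.
apply: (Ccvg_scale); last by apply: comp; rewrite /= addSn -addnS.
apply: (Ccvg_lin k _ (f := fun z : 'rV[R]_d * 'rV[R]_d => z.2 0 j : R)).
  by move=> a u v; rewrite !mxE.
move=> z; apply: (continuous_comp (f := snd) (g := fun v : 'rV[R]_d => v 0 j : R)).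
  exact: cvg_snd.
exact: coord_continuous.
Qed.

End PartialDerivatives.

(** * Density of ridge gradients *)

Section RidgeDensity.
Variables (R : realType) (d : nat).
Implicit Types (x y : 'rV[R]_d) (U : set 'rV[R]_d) (i j : 'I_d) (s : seq 'I_d).

(** Exhaustion of [U] by compact sets: bounded, and at distance at least [1 / n.+1] from the
    complement. *)
Definition inner U n : set 'rV[R]_d :=
  [set x | `|x| <= n%:R] `&` ~` \bigcup_(z in ~` U) ball z (n.+1%:R^-1).

Lemma inner_compact U n : compact (inner U n).
Proof.
apply: (@subclosed_compact _ _ [set x : 'rV[R]_d | `|x| <= n%:R]); [|exact: proper_rV|exact: subIsetl].
apply: closedI; last by apply: open_closedC; apply: bigcup_open => z _; exact: ball_open.
apply: compact_closed; [exact: norm_hausdorff|exact: proper_rV].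
Qed.

Lemma inner_sub U n : inner U n `<=` U.
Proof.
move=> x [_ H]; apply: contrapT => Ux; apply: H; exists x => //.
exact: ballxx.
Qed.

Lemma inner_evt U y : open U -> U y -> evt y (fun n z => inner U n z).
Proof.
move=> oU Uy; have /nbhs_ballP[e /= e0 eU] := open_nbhs_nbhs (conj oU Uy).
have e2 : 0 < e / 2 by rewrite divr_gt0.
apply/evtP; exists (maxn (Num.truncn (`|y| + e)).+1 (Num.truncn (e / 2)^-1).+1), (e / 2) => //.
move=> n z; rewrite geq_max => /andP[n1 n2] zy; split => /=.
  have : `|y| + e <= n%:R by apply: (le_trans (ltW (truncnS_gt _))); rewrite ler_nat.
  by have := ler_normD y (z - y); rewrite [y + _]addrC subrK; lra.
move=> [t Ut]; rewrite -ball_normE /= => tz; apply: Ut; apply: eU; rewrite -ball_normE /=.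
have ne : n.+1%:R^-1 <= e / 2.
  rewrite invf_ple ?posrE// (le_trans (ltW (truncnS_gt _)))// ler_nat.
  exact: leq_trans n2 _.
rewrite -(subrK z y) -addrA (le_lt_trans (ler_normD _ _))//.
move: zy tz; rewrite distrC [`|t - z|]distrC => zy tz.
by rewrite [ltRHS]splitr ltrD// (lt_le_trans tz).
Qed.

Lemma is_diff_rpot (A : nat -> R -> R) m (L : seq (R * 'rV[R]_d * R)) s x :
  (forall l (t : R), is_derive t (1 : R) (A l.+1) (A l t)) -> (size s < m)%N ->
  is_diff x (rpot A m L s) (fun v : 'rV[R]_d => \sum_(k <- enum 'I_d) v 0 k * rpot A m L (k :: s) x).
Proof.
move=> Ad sm; elim: L => [|c L IH].
  rewrite (_ : rpot A m [::] s = cst 0); last by apply/funext => y; rewrite /rpot big_nil.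
  apply: is_diff_eq (is_diff_cst (0 : R) x) _.
  by apply/funext => v; rewrite big1_seq// => k _; rewrite /rpot big_nil mulr0.
have dA : is_derive (dot c.1.2 x + c.2) (1 : R)
    (fun t : R => c.1.1 * wprod c.1.2 s * A (m - size s)%N t)
    (c.1.1 * wprod c.1.2 s * A (m - (size s).+1)%N (dot c.1.2 x + c.2)).
  by have := Ad (m - (size s).+1)%N (dot c.1.2 x + c.2); rewrite subnSK//; exact: is_deriveZ.
rewrite (_ : rpot A m (c :: L) s = (fun y => c.1.1 * wprod c.1.2 s * A (m - size s)%N (dot c.1.2 y + c.2))
  \+ rpot A m L s); last by apply/funext => y; rewrite /rpot big_cons.
apply: is_diff_eq (is_diffD (is_diff_ridge dA) IH) _.
apply/funext => v; set a := _ * A _ _.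
rewrite [LHS](_ : _ = a * dot c.1.2 v + \sum_(k <- enum 'I_d) v 0 k * rpot A m L (k :: s) x)//.
rewrite dotE !big_enum /= mulr_sumr -big_split /=; rewrite {}/a.
apply: eq_bigr => k _; rewrite /rpot big_cons wprod_cons /=; ring.
Qed.

Lemma ridge_rpot (A : nat -> R -> R) r (L : seq (R * 'rV[R]_d * R)) x :
  ridge (A r) L x = \sum_(k <- enum 'I_d) rpot A r.+1 L [:: k] x *: ej R k.
Proof.
rewrite big_enum /=; apply/rowP => k; rewrite /ridge !summxE.
rewrite [RHS](bigD1 k)//= [X in _ = _ + X]big1 ?addr0; last first.
  by move=> i ik; rewrite /ej !mxE eq_sym (negbTE ik) mulr0.
rewrite !mxE !eqxx mulr1 /rpot; apply: eq_bigr => c _.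
by rewrite mxE /= subn1 /wprod big_seq1 mulrAC.
Qed.

Lemma grad_sum U K x : grad U K x = \sum_(k <- enum 'I_d) pdx U k K x *: ej R k.
Proof.
rewrite big_enum /=; apply/rowP => k; rewrite summxE mxE (bigD1 k)//= big1 ?addr0.
  by rewrite !mxE !eqxx mulr1.
by move=> i ik; rewrite /ej !mxE eq_sym (negbTE ik) mulr0.
Qed.

(** Potentials are approximated in order [r.+1] with profile [A r.+1], so that their gradients,
    which have profile [A r = sigma], converge in order [r]. *)
Lemma ridge_dense r sigma U K : Ck_real r sigma -> r_finite r sigma -> open U -> Ck U r.+1 K ->
  exists L, Ccvg r U (fun n => ridge sigma (L n)) (grad U K).
Proof.
move=> Cs fs oU CK; have [A [Ad Ar A0 Ac]] := tower Cs.
have Ai : (0 < \int[@lebesgue_measure R]_x (`| A 0%N x |)%:E < +oo)%E by rewrite A0.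
have An p : exists b : R, iter p dif (A r.+1) b != 0 := tower_dif_neq0 Ad Ac Ai p r.+1.
pose m := r.+1; pose J s := foldr (pdx U) K s.
have JC s : (size s <= m)%N -> ccvg U (fun=> J s) (J s) by exact: Ck_ccvg.
(* Diagonal choice: [L n] is accurate to [1 / n.+1] on the [n]-th set of the exhaustion, half for
   the Bernstein polynomial and half for its ridge approximation. *)
have HL n : exists L, forall s x, (size s <= m)%N -> inner U n x ->
    `|rpot A m L s x - J s x| <= n.+1%:R^-1.
  have n2 : 0 < n.+1%:R^-1 / 2 :> R by rewrite divr_gt0// invr_gt0.
  have [M [N [g [M0 N0 HB]]]] := bernstein_converges oU (@inner_compact U n) (@inner_sub U n)
    (Ck_jet oU CK) JC n2.
  have [L HL] := bernstein_approx M0 N0 Ad Ac An isT g n%:R n2.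
  exists L => s x sm Ix.
  have h1 := HB s x sm Ix; have h2 : `|_| <= _ := HL s x sm Ix.1.
  rewrite -(subrK (bernstein_jet N M g s x) (rpot _ _ _ _ _)) -addrA.
  by rewrite (le_trans (ler_normD _ _))// [leRHS]splitr lerD// distrC.
have {HL}[L HL] := choice HL; exists L.
have cv s : (size s <= m)%N -> ccvg U (fun n => rpot A m (L n) s) (J s).
  move=> sm y Uy e e0; have e2 : 0 < e / 2 by rewrite divr_gt0.
  have ev := evtI (evt_ge y (Num.truncn (e / 2)^-1).+1) (inner_evt oU Uy).
  apply: evtS2 ev (JC s sm y Uy _ e2) => n z [Nn In] h Uz.
  have ne : n.+1%:R^-1 <= e / 2.
    rewrite invf_ple ?posrE// (le_trans (ltW (truncnS_gt _)))// ler_nat.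
    exact: leq_trans Nn _.
  rewrite -(subrK (J s z) (rpot _ _ _ _ _)) -addrA (le_lt_trans (ler_normD _ _))//.
  by rewrite [ltRHS]splitr ler_ltD// ?(le_trans _ ne)//; [exact: HL|exact: h].
have Cv := jet_Ccvg oU (fun n s y sm => is_diff_rpot (L n) y Ad sm) cv.
have CS : Ccvg r U (fun n y => \sum_(k <- enum 'I_d) rpot A m (L n) [:: k] y *: ej R k)
    (fun y => \sum_(k <- enum 'I_d) J [:: k] y *: ej R k).
  apply: Ccvg_sum => k; apply: Ccvg_scale; first by apply: Cv; rewrite add1n.
  exact: Ccvg_cst (cvg_cst _).
apply: Ccvg_ext CS => [n y|y Uy]; first by rewrite -Ar ridge_rpot.
by rewrite grad_sum.
Qed.

End RidgeDensity.

(** * The separable Hamiltonian *)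

Section HamiltonianField.
Variables (R : realType) (d : nat).
Implicit Types (x y : 'rV[R]_(d + d)) (p q : 'rV[R]_d) (Up Uq : set 'rV[R]_d)
  (K V : 'rV[R]_d -> R).

Lemma linear_contraction_continuous (X Y : normedModType R) (f : X -> Y) :
  linear f -> (forall v, `|f v| <= `|v|) -> continuous f.
Proof.
move=> lf fv v; apply/cvgrPdistC_lt => e e0.
apply/nbhs_ballP; exists e => //= w; rewrite -ball_normE /= => vw.
have -> : f w - f v = f (w - v) by have := lf (-1) v w; rewrite !scaleN1r => E; rewrite [w - v]addrC E addrC.
by apply: le_lt_trans (fv _) _; rewrite distrC.
Qed.

Lemma lsubmx_linear : linear (@lsubmx R 1 d d).
Proof. by move=> a u v; rewrite linearP. Qed.

Lemma rsubmx_linear : linear (@rsubmx R 1 d d).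
Proof. by move=> a u v; rewrite linearP. Qed.

Lemma lsubmx_continuous : continuous (@lsubmx R 1 d d).
Proof.
apply: linear_contraction_continuous lsubmx_linear _ => v.
by apply: norm_le_coord => // i; rewrite mxE; exact: norm_coord.
Qed.

Lemma rsubmx_continuous : continuous (@rsubmx R 1 d d).
Proof.
apply: linear_contraction_continuous rsubmx_linear _ => v.
by apply: norm_le_coord => // i; rewrite mxE; exact: norm_coord.
Qed.

Lemma row_mxl_linear : linear (fun q => row_mx (- q) 0 : 'rV[R]_(d + d)).
Proof.
by move=> a u v; rewrite scale_row_mx scaler0 add_row_mx addr0 scalerN opprD.
Qed.

Lemma row_mxr_linear : linear (fun p => row_mx 0 p : 'rV[R]_(d + d)).
Proof. by move=> a u v; rewrite scale_row_mx scaler0 add_row_mx addr0. Qed.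

Lemma row_mxl_continuous : continuous (fun q => row_mx (- q) 0 : 'rV[R]_(d + d)).
Proof.
apply: linear_contraction_continuous row_mxl_linear _ => v.
apply: norm_le_coord => // i; case: (split_ordP i) => k ->.
  by rewrite row_mxEl mxE normrN; exact: norm_coord.
by rewrite row_mxEr mxE normr0.
Qed.

Lemma row_mxr_continuous : continuous (fun p => row_mx 0 p : 'rV[R]_(d + d)).
Proof.
apply: linear_contraction_continuous row_mxr_linear _ => v.
apply: norm_le_coord => // i; case: (split_ordP i) => k ->.
  by rewrite row_mxEl mxE normr0.
by rewrite row_mxEr; exact: norm_coord.
Qed.

Lemma open_prodU Up Uq : open Up -> open Uq -> open (prodU Up Uq).
Proof.
move=> oUp oUq; rewrite (_ : prodU _ _ = (@lsubmx R 1 d d) @^-1` Up `&` (@rsubmx R 1 d d) @^-1` Uq)//.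
by apply: openI; apply: open_comp => // x _; [exact: lsubmx_continuous|exact: rsubmx_continuous].
Qed.

Lemma invmx_Jmx : invmx (Jmx R d) = block_mx 0 (- 1%:M) 1%:M 0.
Proof.
have H : Jmx R d *m block_mx 0 (- 1%:M) 1%:M 0 = 1%:M.
  rewrite /Jmx mulmx_block !mul0mx !mulmx0 mulNmx mulmxN !mulmx1 opprK !addr0 !add0r.
  by rewrite -scalar_mx_block.
have [Ju _] := mulmx1_unit H.
by rewrite -[RHS](mulKmx Ju) H mulmx1.
Qed.

Lemma lsubmx_ejl (k : 'I_d) : lsubmx (ej R (lshift d k)) = ej R k.
Proof. by apply/rowP => j; rewrite !mxE (inj_eq (@lshift_inj _ _)). Qed.

Lemma rsubmx_ejl (k : 'I_d) : rsubmx (ej R (lshift d k)) = 0.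
Proof. by apply/rowP => j; rewrite !mxE eq_rlshift andbF. Qed.

Lemma lsubmx_ejr (k : 'I_d) : lsubmx (ej R (rshift d k)) = 0.
Proof. by apply/rowP => j; rewrite !mxE eq_lrshift andbF. Qed.

Lemma rsubmx_ejr (k : 'I_d) : rsubmx (ej R (rshift d k)) = ej R k.
Proof. by apply/rowP => j; rewrite !mxE (inj_eq (@rshift_inj _ _)). Qed.

Lemma grad_Ham Up Uq K V x : open Up -> open Uq -> prodU Up Uq x ->
  grad (prodU Up Uq) (Ham K V) x = row_mx (grad Up K (lsubmx x)) (grad Uq V (rsubmx x)).
Proof.
move=> oUp oUq Ux; have [Upx Uqx] := Ux; have oU := open_prodU oUp oUq.
apply/rowP => i; rewrite mxE pdxE//; case: (split_ordP i) => k ->.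
  rewrite row_mxEl mxE pdxE// /derive.
  rewrite (_ : (fun h : R => _) = (fun h : R => h^-1 *: ((K \o shift (lsubmx x)) (h *: ej R k) - K (lsubmx x))))//.
  apply/funext => h; rewrite /= /Ham !linearD !linearZ /= lsubmx_ejl rsubmx_ejl scaler0 add0r.
  by rewrite addrACA !scalerN subrr addr0.
rewrite row_mxEr mxE pdxE// /derive.
rewrite (_ : (fun h : R => _) = (fun h : R => h^-1 *: ((V \o shift (rsubmx x)) (h *: ej R k) - V (rsubmx x))))//.
apply/funext => h; rewrite /= /Ham !linearD !linearZ /= lsubmx_ejr rsubmx_ejr scaler0 add0r.
by rewrite addrACA !scalerN subrr add0r.
Qed.

Lemma ham_fieldE Up Uq K V x : open Up -> open Uq -> prodU Up Uq x ->
  ham_field (prodU Up Uq) (Ham K V) x =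
  row_mx (- grad Uq V (rsubmx x)) (grad Up K (lsubmx x)).
Proof.
move=> oUp oUq Ux; rewrite /ham_field grad_Ham// invmx_Jmx tr_row_mx mul_block_col.
by rewrite !mul0mx mul1mx mulNmx mul1mx addr0 add0r tr_col_mx linearN /= !trmxK.
Qed.

Lemma ridge_opp (sigma : R -> R) L p :
  ridge sigma [seq (- c.1.1, c.1.2, c.2) | c <- L] p = - ridge sigma L p.
Proof.
by rewrite /ridge big_map -sumrN; apply: eq_bigr => c _; rewrite mulNr scaleNr.
Qed.

End HamiltonianField.

(** * The symplectic Euler scheme *)

Section SymplecticEuler.
Variables (R : realType) (d r : nat) (sigma : R -> R) (Up Uq : set 'rV[R]_d).
Variables (K V : 'rV[R]_d -> R) (LK LV : nat -> seq (R * 'rV[R]_d * R)).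
Hypotheses (oUp : open Up) (oUq : open Uq).
Hypothesis CK : Ccvg r Up (fun n => ridge sigma (LK n)) (grad Up K).
Hypothesis CV : Ccvg r Uq (fun n => ridge sigma (LV n)) (grad Uq V).
Let U := prodU Up Uq.
Let state : normedModType R := (R * 'rV[R]_(d + d))%type.

Definition kick n (x : 'rV[R]_(d + d)) : 'rV[R]_(d + d) :=
  row_mx (- ridge sigma (LV n) (rsubmx x)) 0.

Definition drift n (x : 'rV[R]_(d + d)) : 'rV[R]_(d + d) :=
  row_mx 0 (ridge sigma (LK n) (lsubmx x)).

(* An explicit Euler step of size [1 / n.+1] along [increment n] is a step of
   size [h / n.+1] of the symplectic Euler scheme. *)
Definition increment n (z : R * 'rV[R]_(d + d)) : R * 'rV[R]_(d + d) :=
  (0, z.1 *: (kick n z.2 + drift n (z.2 + (z.1 / n.+1%:R) *: kick n z.2))).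

(** The displacement by [h / n.+1] times the kick tends to 0 with its derivatives up to order [r],
    so in the limit kick and drift are evaluated at the same point. As [Up] is open, displaced
    positions lie in it eventually near each point. *)
Lemma Ccvg_increment :
  @Ccvg R r state state (setT `*` U) increment (scaled (ham_field U (Ham K V))).
Proof.
pose O : set state := setT `*` U.
have Ch : Ccvg r O (fun _ z => z.1) (fun z => z.1).
  by apply: (Ccvg_lin r _ (f := fst)) => [a [? ?] [? ?]//|z]; exact: cvg_fst.
have Cx : Ccvg r O (fun _ z => z.2) (fun z => z.2).
  by apply: (Ccvg_lin r _ (f := snd)) => [a [? ?] [? ?]//|z]; exact: cvg_snd.
have Cq := Ccvg_lincomp (@rsubmx_linear R d) (@rsubmx_continuous R d) Cx.
have Ckick : Ccvg r O (fun n z => kick n z.2) (fun z => row_mx (- grad Uq V (rsubmx z.2)) 0).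
  have := Ccvg_comp_open oUq (fun (y : state) (Oy : O y) => Oy.2.2) CV Cq.
  exact: Ccvg_lincomp (@row_mxl_linear R d) (@row_mxl_continuous R d).
have Cs : Ccvg r O (fun n z => z.1 / n.+1%:R : R) (fun z => 0 : R).
  have := Ccvg_scale Ch (Ccvg_cst r O (cvg_harmonic (R := R))).
  by apply: Ccvg_ext => // y _; rewrite scaler0.
have Cp : Ccvg r O (fun n z => lsubmx (z.2 + (z.1 / n.+1%:R) *: kick n z.2)) (fun z => lsubmx z.2).
  have := Ccvg_lincomp (@lsubmx_linear R d) (@lsubmx_continuous R d)
    (Ccvg_add Cx (Ccvg_scale Cs Ckick)).
  by apply: Ccvg_ext => // y _; rewrite scale0r addr0.
have Cdrift : Ccvg r O (fun n z => drift n (z.2 + (z.1 / n.+1%:R) *: kick n z.2))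
    (fun z => row_mx 0 (grad Up K (lsubmx z.2))).
  have := Ccvg_comp_open oUp (fun (y : state) (Oy : O y) => Oy.2.1) CK Cp.
  exact: Ccvg_lincomp (@row_mxr_linear R d) (@row_mxr_continuous R d).
have C0 : Ccvg r O (fun _ _ => 0 : R) (fun=> 0) by apply: Ccvg_cst; exact: cvg_cst.
have CE := Ccvg_pair C0 (Ccvg_scale Ch (Ccvg_add Ckick Cdrift)).
refine (Ccvg_ext _ _ CE) => // y [_ Uy].
by rewrite /scaled ham_fieldE// add_row_mx addr0 add0r.
Qed.

Lemma traj_increment n k h x : traj increment n k (h, x) =
  (h, iter k (fun x : 'rV[R]_(d + d) =>
    let p := lsubmx x - (h / n.+1%:R) *: ridge sigma (LV n) (rsubmx x) in
    row_mx p (rsubmx x + (h / n.+1%:R) *: ridge sigma (LK n) p)) x).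
Proof.
elim: k => // k; rewrite /traj /= => ->; rewrite /euler /increment /=.
move: (iter _ _ _) => y; apply: injective_projections => /=; first by rewrite scaler0 addr0.
rewrite scalerA [_^-1 * h]mulrC; set s := h / _.
have E : y + s *: kick n y = row_mx (lsubmx y - s *: ridge sigma (LV n) (rsubmx y)) (rsubmx y).
  by rewrite -{1}(hsubmxK y) /kick scale_row_mx scaler0 add_row_mx addr0 scalerN.
by rewrite scalerDr addrA E /drift row_mxKl scale_row_mx scaler0 add_row_mx addr0.
Qed.

(** Continuity is read off at [h] = 1 from the preceding convergence, whose limit is continuous. *)
Lemma ham_field_continuous x : U x -> forall e : R, 0 < e -> exists2 c : R, 0 < c &
  forall z, U z -> `|z - x| < c ->
    `|ham_field U (Ham K V) z - ham_field U (Ham K V) x| < e.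
Proof.
move=> Ux e e0.
have [c c0 H] := ccvg_continuous (Ccvg_ccvg Ccvg_increment) (y := (1, x)) (conj I Ux) e0.
exists c => // z Uz zx; have := H (1, z) (conj I Uz).
rewrite !prod_normE /= !subrr !normr0 !scale1r !gt_max c0 e0 zx /=.
by apply.
Qed.

End SymplecticEuler.

Theorem theorem4p5 (R : realType) (d r : nat) (sigma : R -> R)
  (Hsigma : Ck_real r sigma) (Hfin : r_finite r sigma)
  (Up Uq : set 'rV[R]_d) (HUp : open Up) (HUq : open Uq)
  (K V : 'rV[R]_d -> R) (HK : Ck Up r.+1 K) (HV : Ck Uq r.+1 V)
  (Phi : R -> 'rV[R]_(d + d) -> 'rV[R]_(d + d))
  (HPhi : phase_flow (prodU Up Uq)
            (ham_field (prodU Up Uq) (Ham K V)) Phi) :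
  forall (T : R), 0 < T ->
  forall W : set 'rV[R]_(d + d), compact W -> W `<=` prodU Up Uq ->
  forall eps : R, 0 < eps ->
  exists ls : seq (tla_layer R d),
    valid_tla ls /\
    CrNorm r [set y : R * 'rV[R]_(d + d) | 0 <= y.1 /\ prodU Up Uq y.2] T W
      (fun h x => Phi h x - tla_net sigma ls h x) < eps.
Proof.
move=> T _ W cW WU eps eps0.
have [LK CK] := ridge_dense Hsigma Hfin HUp HK.
have [LV CV] := ridge_dense Hsigma Hfin HUq HV.
have oU := open_prodU HUp HUq.
have CE := Ccvg_increment HUp HUq CK CV.
have fc := ham_field_continuous HUp HUq CK CV.
have [P CP] := flow_Ccvg (@proper_state R (d + d)) CE
  (well_posed_scaled HPhi oU fc (Ccvg_ccvg CE)).
have PE := scaled_limit HPhi oU fc (Ccvg_ccvg CE) (Ccvg_ccvg CP).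
(* The first half of the coordinates moves by [- grad V], whereas networks add ridge fields; the
   amplitudes are negated. *)
have [ls lsP] := choice (fun n => ridge_euler_net sigma
  [seq (- c.1.1, c.1.2, c.2) | c <- LV n] (LK n) n).
have CN : Ccvg r [set y : R * 'rV[R]_(d + d) | 0 <= y.1 /\ prodU Up Uq y.2]
    (fun n y => tla_net sigma (ls n) y.1 y.2) (fun y => Phi y.1 y.2).
  apply: Ccvg_ext (Ccvg_snd CP) => [n [h x]|y Dy]; last by rewrite PE.
  rewrite traj_increment (lsP n).2; apply: eq_iter => y /=.
  by rewrite ridge_opp scalerN.
have [k Hk] := CrNorm_cvg oU T cW WU CN eps0.
by exists (ls k); split; [exact: (lsP k).1|exact: Hk].
Qed.
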